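(* Let $1\leq p\leq \infty$ and let $X$ be either $L_1$ or $\ell_1$. Then: (i) If $H$ is a closed subspace of $L(\ell_{p^*},X)$ which contains $\ell_p\otimes X$, then the norm of $H$ is octahedral if, and only if, $2\leq p$ or $p=1$. (ii) If $H$ is a closed subspace of $L(\ell_1,X)$ which contains $c_0\otimes X$, then the norm of $H$ is octahedral. (iii) If $n$ is a natural number and $H$ is a closed subspace of $L(\ell_{p^*}^n,X)$ which contains $\ell_p^n\otimes X$, then the norm of $H$ is octahedral if, and only if, either $n\leq 2$, or $n>2$ and ($2\leq p$ or $p=1$).
   Context: All Banach spaces are real and non-zero. $L_1$ denotes $L_1[0,1]$. $p^*$ is the conjugate exponent, $\frac1p+\frac1{p^*}=1$ (with $1^*=\infty$, $\infty^*=1$). $\ell_p^n$ is $\mathbb{R}^n$ with the $\ell_p$-norm. $L(Z,X)$ is the space of bounded linear operators from $Z$ to $X$ with the operator norm, and subspaces $H$ carry this norm. An elementary tensor $a\otimes x$ with $a$ in $\ell_p$ (respectively $c_0$, $\ell_p^n$) and $x\in X$ is identified with the rank-one operator $b\mapsto \big(\sum_k a_kb_k\big)x$ on $\ell_{p^*}$ (respectively $\ell_1$, $\ell_{p^*}^n$), and $\otimes$ denotes the algebraic tensor product (the linear span of such operators). The norm of a Banach space $W$ is octahedral if for every finite-dimensional subspace $E$ of $W$ and every $\varepsilon>0$ there exists $y\in S_W$ (the unit sphere) such that $\|x+\lambda y\|\geq(1-\varepsilon)(\|x\|+|\lambda|)$ for every $x\in E$ and every $\lambda\in\mathbb{R}$.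 *)

(* Defs.v *)
From HB Require Import structures.
From mathcomp Require Import all_boot all_order all_algebra.
From mathcomp Require Import all_classical all_reals all_analysis.
From mathcomp Require Import ess_sup_inf measurable_realfun hoelder.
From mathcomp Require finmap.
Set Implicit Arguments.
Unset Strict Implicit.
Unset Printing Implicit Defensive.
Import Order.TTheory GRing.Theory Num.Theory.
Import numFieldNormedType.Exports.
Local Open Scope classical_set_scope.
Local Open Scope ring_scope.

Section octahedral.
Context {R : realType} {W : normedModType R}.

Definition lin_span (A : set W) : set W :=
  [set x | exists n (c : 'I_n -> R) (e : 'I_n -> W),
    (forall i, A (e i)) /\ x = \sum_i c i *: e i].

Definition finite_dimensional (E : set W) : Prop :=
  exists s : seq W, E = lin_span [set` s].

Definition closed_subspace (H : set W) : Prop :=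
  submod_closed (mem H) /\ closed H.

(* H is a linear subspace with the norm induced by W; H = setT is W itself. *)
Definition octahedral (H : set W) : Prop :=
  forall (E : set W) (eps : R), finite_dimensional E -> E `<=` H -> 0 < eps ->
    exists y : W, [/\ H y, `|y| = 1 &
      forall (x : W) (lambda : R), E x ->
        (1 - eps) * (`|x| + `|lambda|) <= `|x + lambda *: y|].

End octahedral.

Section bounded_operators.
Context {R : realType} (Z X : normedModType R).

Definition bounded_operator_pred : {pred Z -> X} :=
  mem [set f : Z -> X | linear f /\ exists M : R, forall x, `|f x| <= M * `|x|].

Record bounded_operator := BoundedOperator {
  bounded_operator_fun :> Z -> X;
  bounded_operatorP : bounded_operator_fun \in bounded_operator_pred }.

HB.instance Definition _ := [isSub for bounded_operator_fun].
HB.instance Definition _ := [Choice of bounded_operator by <:].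

Lemma bounded_operator_submod_closed : submod_closed bounded_operator_pred.
Proof.
split.
  rewrite inE/=; split; first by move=> a x y; rewrite scaler0 addr0.
  by exists 0 => x; rewrite mul0r normr0.
move=> a f g; rewrite !inE/= => -[lf [M fM]] [lg [N gN]]; split.
  have E h : (a *: f + g) h = a *: f h + g h by [].
  by move=> b x y; rewrite !E lf lg !scalerDr addrACA !scalerA mulrC.
exists (`|a| * M + N) => x.
rewrite [X in `|X|]/(a *: f x + g x).
rewrite (le_trans (ler_normD _ _))// mulrDl lerD// normrZ -mulrA ler_wpM2l//.
Qed.

HB.instance Definition _ :=
  GRing.isSubmodClosed.Build _ _ bounded_operator_pred
    bounded_operator_submod_closed.
HB.instance Definition _ := [SubChoice_isSubLmodule of bounded_operator by <:].

Lemma bounded_operator_linear (T : bounded_operator) : linear T.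
Proof. by case: T => f /=; rewrite inE => -[]. Qed.

HB.instance Definition _ (T : bounded_operator) :=
  GRing.isLinear.Build R Z X _ T (bounded_operator_linear T).

(* The closed unit ball always contains 0, so this is also right when Z is the
   zero space. *)
Definition operator_norm (T : bounded_operator) : R :=
  sup [set `|T x| | x in [set x | `|x| <= 1]].

Lemma operator_norm_has_sup (T : bounded_operator) :
  has_sup [set `|T x| | x in [set x | `|x| <= 1]].
Proof.
split; first by exists `|T 0|, 0 => //=; rewrite normr0.
have := bounded_operatorP T; rewrite inE => -[_ [M TM]].
exists `|M| => _ [x /= x1 <-]; rewrite (le_trans (TM x))//.
rewrite (le_trans (ler_norm _))// normrM normr_id ler_piMr//.
Qed.

Lemma operator_norm_ge0 (T : bounded_operator) : 0 <= operator_norm T.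
Proof.
apply: (@le_trans _ _ `|T 0|) => //.
by apply: sup_upper_bound; [exact: operator_norm_has_sup|exists 0 => //=; rewrite normr0].
Qed.

Lemma ler_operator_norm (T : bounded_operator) x :
  `|T x| <= operator_norm T * `|x|.
Proof.
have [->|x0] := eqVneq x 0.
  by rewrite linear0 !normr0 mulr0.
have nx : 0 < `|x| by rewrite normr_gt0.
rewrite -ler_pdivrMr//.
apply: sup_upper_bound; first exact: operator_norm_has_sup.
exists (`|x|^-1 *: x) => /=.
  by rewrite normrZ normfV normr_id mulVf// gt_eqF.
rewrite linearZ normrZ normfV normr_id mulrC//.
Qed.

Lemma operator_norm_le (T : bounded_operator) M :
  (forall x, `|x| <= 1 -> `|T x| <= M) -> operator_norm T <= M.
Proof.
move=> TM; apply: ge_sup; first by case: (operator_norm_has_sup T).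
by move=> _ [x /= x1 <-]; exact: TM.
Qed.

Let normD (S T : bounded_operator) :
  operator_norm (S + T) <= operator_norm S + operator_norm T.
Proof.
apply: operator_norm_le => x x1.
rewrite [X in `|X|]/(S x + T x) (le_trans (ler_normD _ _))// lerD//.
  by rewrite (le_trans (ler_operator_norm _ _))// ler_piMr// operator_norm_ge0.
by rewrite (le_trans (ler_operator_norm _ _))// ler_piMr// operator_norm_ge0.
Qed.

Let normZ_le (a : R) (T : bounded_operator) :
  operator_norm (a *: T) <= `|a| * operator_norm T.
Proof.
apply: operator_norm_le => x x1.
rewrite [X in `|X|]/(a *: T x) normrZ ler_wpM2l//.
by rewrite (le_trans (ler_operator_norm _ _))// ler_piMr// operator_norm_ge0.
Qed.

Let normZ (a : R) (T : bounded_operator) :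
  operator_norm (a *: T) = `|a| * operator_norm T.
Proof.
apply/eqP; rewrite eq_le normZ_le/=.
have [->|a0] := eqVneq a 0; first by rewrite normr0 mul0r operator_norm_ge0.
rewrite -ler_pdivlMl ?normr_gt0// -normfV.
by rewrite -[in leLHS](scalerK a0 T) normZ_le.
Qed.

Let norm_eq0 (T : bounded_operator) : operator_norm T = 0 -> T = 0.
Proof.
move=> T0; apply/val_inj/funext => x /=.
by apply/normr0_eq0/eqP; rewrite eq_le normr_ge0 (le_trans (ler_operator_norm T x))// T0 mul0r.
Qed.

HB.instance Definition _ := Lmodule_isNormed.Build R bounded_operator
  normD normZ norm_eq0.

Lemma bounded_operator_normE (T : bounded_operator) : `|T| = operator_norm T.
Proof. by []. Qed.

End bounded_operators.

Notation "''L' ( Z , X )" := (bounded_operator Z X)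
  (at level 8, format "''L' ( Z ,  X )") : type_scope.

Section Lspace_normed.
Context d (T : measurableType d) (R : realType).
Variables (mu : {measure set T -> \bar R}) (p : \bar R) (p1 : (1 <= p)%E).
Local Open Scope quotient_scope.

Local Notation Lsp := (LspaceType mu p1).

HB.instance Definition _ := gen_eqMixin Lsp.
HB.instance Definition _ := gen_choiceMixin Lsp.

Implicit Types (f g h : Lsp).

Lemma Lspace_eqP f g : f = g <-> (f : T -> R) = g %[ae mu].
Proof.
split=> [->|fg]; first exact: ae_eq_refl.
suff E : (LebesgueSpace.sort f) = LebesgueSpace.sort g.
  case: f g E {fg} => [f [[fP]]] [g [[gP]]] /= E.
  by subst g; rewrite (Prop_irrelevance fP gP).
rewrite -(reprK (LebesgueSpace.sort f)) -(reprK (LebesgueSpace.sort g)).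
by apply/eqmodP/asboolP.
Qed.

Lemma Lspace_Lfun f : (f : T -> R) \in Lfun mu p.
Proof.
apply/andP; split; rewrite inE//=.
  exact: (measurable_funPT (repr (LebesgueSpace.sort f))).
by case: f => f [[]].
Qed.

Definition Lspace_mfun (u : T -> R) (up : u \in Lfun mu p) :
    {mfun T >-> measurableTypeR R} :=
  HB.pack u (@isMeasurableFun.Build _ _ T (measurableTypeR R) u
    (set_mem (sub_Lfun_mfun up))).

Definition Lspace_pi (u : T -> R) (up : u \in Lfun mu p) :
    {mfun_ mu, T >-> measurableTypeR R} :=
  \pi_({mfun_ mu, T >-> measurableTypeR R}) (Lspace_mfun up).

Lemma Lspace_pi_ae (u : T -> R) (up : u \in Lfun mu p) :
  (Lspace_pi up : T -> R) = u %[ae mu].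
Proof.
suff : ae_eq_op mu (repr (Lspace_pi up)) (Lspace_mfun up) by move/asboolP.
by apply/eqmodP; rewrite reprK.
Qed.

Lemma eq_ae_Lnorm (u v : T -> R) :
  measurable_fun setT u -> measurable_fun setT v -> u = v %[ae mu] ->
  'N[mu]_p[EFin \o u]%E = 'N[mu]_p[EFin \o v]%E.
Proof.
pose pw (w : T -> R) (r : R) : T -> \bar R := fun x =>
  (`|(EFin \o w) x| `^ r)%E.
have mpow (w : T -> R) (r : R) : measurable_fun setT w ->
    measurable_fun setT (pw w r).
  move=> mw; apply: (measurableT_comp (measurable_poweR _)).
  apply: measurableT_comp => //; exact/measurable_EFinP.
move=> mu_ mv uv; rewrite unlock /Lnorm; case: p p1 => [r r1|_|//].
  congr poweR; apply: ge0_ae_eq_integral => //.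
  - exact: mpow.
  - exact: mpow.
  - by move=> x _; exact: poweR_ge0.
  - by move=> x _; exact: poweR_ge0.
  - by apply: filterS uv => x /= /(_ I) -> _.
case: ifPn => // _; apply: eq_ess_sup.
by apply: filterS uv => x /= /(_ I) ->.
Qed.

Lemma Lspace_pi_finite (u : T -> R) (up : u \in Lfun mu p) :
  finite_norm mu p (Lspace_pi up : T -> R).
Proof.
rewrite /finite_norm (@eq_ae_Lnorm _ u) //.
- by have := sub_Lfun_finLfun up; rewrite inE.
- exact: (measurable_funPT (repr (Lspace_pi up))).
- exact: (set_mem (sub_Lfun_mfun up)).
- exact: Lspace_pi_ae.
Qed.

Definition Lspace_mk (u : T -> R) (up : u \in Lfun mu p) : Lsp :=
  HB.pack (Lspace_pi up)
    (isFinLebesgue.Build d T R mu p p1 _ (Lspace_pi_finite up)).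

Lemma Lspace_mkE (u : T -> R) (up : u \in Lfun mu p) :
  (Lspace_mk up : T -> R) = u %[ae mu].
Proof. exact: Lspace_pi_ae. Qed.

Let Lfun0 : (0 : T -> R) \in Lfun mu p.
Proof. by have [] := Lfun_submod_closed mu p1. Qed.

Let LfunD f g : ((f : T -> R) + (g : T -> R)) \in Lfun mu p.
Proof.
have [_ /(_ 1)] := Lfun_submod_closed mu p1.
by move=> /(_ _ _ (Lspace_Lfun f) (Lspace_Lfun g)); rewrite scale1r.
Qed.

Let LfunZ a f : (a *: (f : T -> R)) \in Lfun mu p.
Proof.
have [_ /(_ a)] := Lfun_submod_closed mu p1.
by move=> /(_ _ _ (Lspace_Lfun f) Lfun0); rewrite addr0.
Qed.

Let LfunN f : (- (f : T -> R)) \in Lfun mu p.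
Proof. by rewrite -scaleN1r LfunZ. Qed.

Let zero : Lsp := Lspace_mk Lfun0.
Let opp f : Lsp := Lspace_mk (LfunN f).
Let add f g : Lsp := Lspace_mk (LfunD f g).
Let scale a f : Lsp := Lspace_mk (LfunZ a f).

Let zeroE : \forall x \ae mu, (zero : T -> R) x = 0.
Proof. by apply: filterS (Lspace_mkE Lfun0) => x /(_ I). Qed.

Let oppE f : \forall x \ae mu, (opp f : T -> R) x = - (f : T -> R) x.
Proof. by apply: filterS (Lspace_mkE (LfunN f)) => x /(_ I). Qed.

Let addE f g : \forall x \ae mu, (add f g : T -> R) x = f x + g x.
Proof. by apply: filterS (Lspace_mkE (LfunD f g)) => x /(_ I). Qed.

Let scaleE a f : \forall x \ae mu, (scale a f : T -> R) x = a * f x.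
Proof. by apply: filterS (Lspace_mkE (LfunZ a f)) => x /(_ I). Qed.

Let Lsp_ext f g : (\forall x \ae mu, f x = g x) -> f = g.
Proof. by move=> fg; apply/Lspace_eqP; apply: filterS fg => x + _. Qed.

Let addA : associative add.
Proof.
move=> f g h; apply: Lsp_ext.
apply: (filterS2 _ _ (filterI (addE f (add g h)) (addE g h))
  (filterI (addE (add f g) h) (addE f g))).
by move=> x [e1 e2] [e3 e4]; rewrite e1 e2 e3 e4 addrA.
Qed.

Let addC : commutative add.
Proof.
move=> f g; apply: Lsp_ext; apply: (filterS2 _ _ (addE f g) (addE g f)).
by move=> x -> ->; rewrite addrC.
Qed.

Let add0 : left_id zero add.
Proof.
move=> f; apply: Lsp_ext; apply: (filterS2 _ _ zeroE (addE zero f)).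
by move=> x e1 ->; rewrite e1 add0r.
Qed.

Let addN : left_inverse zero opp add.
Proof.
move=> f; apply: Lsp_ext.
apply: (filterS3 _ _ zeroE (oppE f) (addE (opp f) f)).
by move=> x e1 e2 ->; rewrite e1 e2 addNr.
Qed.

HB.instance Definition _ := GRing.isZmodule.Build Lsp addA addC add0 addN.

Let scaleA a b f : scale a (scale b f) = scale (a * b) f.
Proof.
apply: Lsp_ext.
apply: (filterS3 _ _ (scaleE (a * b) f) (scaleE b f) (scaleE a (scale b f))).
by move=> x -> e ->; rewrite e mulrA.
Qed.

Let scale1 : left_id 1 scale.
Proof.
move=> f; apply: Lsp_ext; apply: (filterS _ (scaleE 1 f)).
by move=> x ->; rewrite mul1r.
Qed.

Let scaleDr : right_distributive scale +%R.
Proof.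
move=> a f g; apply: Lsp_ext.
apply: (filterS3 _ _ (filterI (scaleE a f) (scaleE a g))
  (filterI (scaleE a (add f g)) (addE f g)) (addE (scale a f) (scale a g))).
by move=> x [e1 e2] [e3 e4] e5; rewrite e3 e4 e5 e1 e2 mulrDr.
Qed.

Let scaleDl f : {morph scale^~ f : a b / a + b}.
Proof.
move=> a b; apply: Lsp_ext.
apply: (filterS3 _ _ (filterI (scaleE a f) (scaleE b f))
  (scaleE (a + b) f) (addE (scale a f) (scale b f))).
by move=> x [e1 e2] -> ->; rewrite e1 e2 mulrDl.
Qed.

HB.instance Definition _ :=
  GRing.Zmodule_isLmodule.Build R Lsp scaleA scale1 scaleDr scaleDl.

Definition Lspace_norm f : R := fine ('N[mu]_p[EFin \o (f : T -> R)])%E.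

Let Lspace_LfunType f : LfunType mu p1 := Lfun_Sub p1 (Lspace_Lfun f).

Let measurable_Lspace f : measurable_fun setT (f : T -> R).
Proof. exact: (measurable_funPT (repr (LebesgueSpace.sort f))). Qed.

Let normE f (u : LfunType mu p1) : (f : T -> R) = u %[ae mu] ->
  Lspace_norm f = fine ('N[mu]_p[EFin \o u])%E.
Proof. by move=> fu; rewrite /Lspace_norm (@eq_ae_Lnorm f u). Qed.

Let normD f g : Lspace_norm (f + g) <= Lspace_norm f + Lspace_norm g.
Proof.
rewrite (normE (u := Lspace_LfunType f + Lspace_LfunType g)).
  exact: ler_LnormD.
by apply: filterS (addE f g) => x + _.
Qed.

Let normZ a f : Lspace_norm (a *: f) = `|a| * Lspace_norm f.
Proof.
rewrite (normE (u := a *: Lspace_LfunType f)).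
  apply: EFin_inj.
  by rewrite EFinM (finite_norm_fine (Lspace_LfunType f)) finite_norm_fine LnormZ.
by apply: filterS (scaleE a f) => x + _.
Qed.

Let norm_eq0 f : Lspace_norm f = 0 -> f = 0.
Proof.
move=> /(@fine_Lnormr_eq0 _ _ _ _ _ _ (Lspace_LfunType f)) f0.
apply: Lsp_ext; apply: (filterS2 _ _ f0 zeroE) => x /(_ I) f0x e.
by rewrite e; exact: f0x.
Qed.

HB.instance Definition _ := Lmodule_isNormed.Build R Lsp normD normZ norm_eq0.

Lemma Lspace_addE f g : \forall x \ae mu, (f + g) x = f x + g x.
Proof. exact: addE. Qed.

Lemma Lspace_scaleE a f : \forall x \ae mu, (a *: f) x = a * f x.
Proof. exact: scaleE. Qed.

Lemma Lspace_normE f : `|f| = fine ('N[mu]_p[EFin \o (f : T -> R)])%E.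
Proof. by []. Qed.

End Lspace_normed.
(* L_1[0,1], realized as the classes of functions on the line modulo equality
   almost everywhere for the restriction of Lebesgue measure to [0,1]. *)
Definition L1 (R : realType) : Type :=
  LspaceType1 (mrestr (@lebesgue_measure R) (measurable_itv `[0, 1])).

Section ell.
Context (R : realType) (p : \bar R) (p1 : (1 <= p)%E).

(* Under the counting measure every set is measurable and only the empty set is
   negligible, so no quotient is needed: these are plain real sequences. *)
Definition ell : Type := LfunType (@counting nat R) p1.

HB.instance Definition _ := GRing.Lmodule.copy ell (LfunType (@counting nat R) p1).

Definition ell_norm (a : ell) : R := fine ('N[@counting nat R]_p[EFin \o a])%E.

Lemma counting_ae (P : set nat) : (\forall k \ae (@counting nat R), P k) ->
  forall k, P k.
Proof.
move=> [A [mA A0 PA]] k; apply: contrapT => nPk.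
have Ak : A k by exact: PA.
move: A0; rewrite /counting; case: ifPn => // /asboolP fA [] /eqP.
rewrite pnatr_eq0 finmap.cardfs_eq0 => /eqP /fset_set_set0 A0.
by move: Ak; rewrite A0.
Qed.

Let norm_eq0 (a : ell) : ell_norm a = 0 -> a = 0.
Proof.
move=> /fine_Lnormr_eq0 a0; apply/LfuneqP => k.
by have /(_ I) := counting_ae a0 k.
Qed.

Let normD (a b : ell) : ell_norm (a + b) <= ell_norm a + ell_norm b.
Proof. exact: ler_LnormD. Qed.

Let normZ c (a : ell) : ell_norm (c *: a) = `|c| * ell_norm a.
Proof.
apply: EFin_inj; rewrite EFinM (finite_norm_fine (a : LfunType _ _)).
by rewrite (finite_norm_fine (c *: a : LfunType _ _)) LnormZ.
Qed.

HB.instance Definition _ := Lmodule_isNormed.Build R ell normD normZ norm_eq0.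

Lemma ell_normE (a : ell) : `|a| = fine ('N[@counting nat R]_p[EFin \o a])%E.
Proof. by []. Qed.

End ell.

(* An alias of the row vectors: its norm is elln_norm below, and not the sup norm
   that the library puts on 'rV[R]_n. *)
Definition elln (R : realType) (p : \bar R) (p1 : (1 <= p)%E) (n : nat) : Type :=
  'rV[R]_n.

Section elln.
Context (R : realType) (p : \bar R) (p1 : (1 <= p)%E) (n : nat).

Local Notation V := (elln p1 n).

HB.instance Definition _ := GRing.Lmodule.copy V 'rV[R]_n.

Definition elln_norm (x : V) : R :=
  if p is r%:E then (\sum_(i < n) `|x 0 i| `^ r) `^ r^-1
  else \big[Num.max/0]_(i < n) `|x 0 i|.

Let ext (x : V) (k : nat) : R := if insub k is Some i then x 0 i else 0.

Let extE (x : V) (i : 'I_n) : ext x i = x 0 i.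
Proof. by rewrite /ext valK. Qed.

Let ext0 (x : V) k : (n <= k)%N -> ext x k = 0.
Proof. by move=> nk; rewrite /ext insubF// ltnNge nk. Qed.

Let elln_norm_fin (r : R) (x : V) : p = r%:E ->
  ('N[@counting nat R]_p[EFin \o ext x] = (elln_norm x)%:E)%E.
Proof.
move=> pr; have r1 : 1 <= r by rewrite -lee_fin -pr.
have r0 : 0 < r by exact: lt_le_trans r1.
rewrite /elln_norm pr Lnorm_counting//.
rewrite (nneseries_split 0 n); last by move=> k _; exact: poweR_ge0.
rewrite add0n [X in (_ + X)%E]eseries0 ?adde0; last first.
  move=> k nk _; rewrite /= ext0// normr0 powR0// gt_eqF//.
rewrite big_mkord.
under eq_bigr do rewrite /= extE.
by rewrite sumEFin poweR_EFin.
Qed.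

Let p_fin_or_y : (exists2 r, p = r%:E & 1 <= r) \/ p = +oo%E.
Proof. by case: p p1 => [r r1|_|//]; [left; exists r|right]. Qed.

Let normD (x y : V) : elln_norm (x + y) <= elln_norm x + elln_norm y.
Proof.
have [[r E r1]|E] := p_fin_or_y.
  rewrite -lee_fin EFinD -!(elln_norm_fin _ E).
  have -> : ext (x + y) = ext x \+ ext y.
    apply/funext => k /=; rewrite /ext; case: insubP => [i _ _|_].
      by rewrite mxE.
    by rewrite addr0.
  exact: eminkowski.
rewrite /elln_norm E; apply/bigmax_leP; split.
  by rewrite addr_ge0// bigmax_ge_id.
move=> i _; rewrite mxE (le_trans (ler_normD _ _))// lerD//.
  exact: (le_bigmax _ (fun i => `|x 0 i|)).
exact: (le_bigmax _ (fun i => `|y 0 i|)).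
Qed.

Let normZ c (x : V) : elln_norm (c *: x) = `|c| * elln_norm x.
Proof.
have cxE i : (c *: x : V) 0 i = c * x 0 i by rewrite mxE.
rewrite /elln_norm; have [[r -> r1]|->] := p_fin_or_y.
  have r0 : 0 < r by rewrite (lt_le_trans ltr01).
  under eq_bigr do rewrite cxE normrM powRM//.
  rewrite -mulr_sumr powRM ?powR_ge0 ?sumr_ge0//.
  by rewrite -powRrM divff ?gt_eqF// powRr1.
under eq_bigr do rewrite cxE normrM.
rewrite (big_morph (fun t => `|c| * t) (id1 := 0) (op1 := Num.max))//.
  by move=> u v; rewrite maxr_pMr.
by rewrite mulr0.
Qed.

Let norm_eq0 (x : V) : elln_norm x = 0 -> x = 0.
Proof.
rewrite /elln_norm => x0; suff xi i : x 0 i = 0.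
  by apply/rowP => i; rewrite mxE -(xi i).
apply/normr0_eq0; move: x0; have [[r -> r1]|->] := p_fin_or_y.
  have r0 : 0 < r by rewrite (lt_le_trans ltr01).
  move=> /powR_eq0_eq0/eqP.
  rewrite psumr_eq0; last by move=> j _; exact: powR_ge0.
  by move=> /allP/(_ i); rewrite mem_index_enum => /(_ isT)/eqP/powR_eq0_eq0.
move=> x0; apply/eqP; rewrite eq_le normr_ge0 andbT -x0.
exact: (le_bigmax _ (fun i => `|x 0 i|)).
Qed.

HB.instance Definition _ := Lmodule_isNormed.Build R V normD normZ norm_eq0.

Lemma elln_normE (x : V) : `|x| = elln_norm x.
Proof. by []. Qed.

End elln.

Section holder.
Context (R : realType).
Local Notation mu := (@counting nat R).
Local Open Scope ereal_scope.

Lemma counting_holder_1oo (a b : nat -> R) : 'N[mu]_+oo[EFin \o b] < +oo ->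
  'N[mu]_1[EFin \o (a \* b)%R] <= 'N[mu]_1[EFin \o a] * 'N[mu]_+oo[EFin \o b].
Proof.
move=> boo.
have muT : 0 < mu setT.
  by rewrite /= /counting asboolF//; exact: infinite_nat.
have bE : ('N[mu]_+oo[EFin \o b]) = (fine 'N[mu]_+oo[EFin \o b])%:E.
  by rewrite fineK// ge0_fin_numE// Lnorm_ge0.
have b0 : (0 <= fine 'N[mu]_+oo[EFin \o b])%R by rewrite fine_ge0// Lnorm_ge0.
have ble k : (`|b k| <= fine 'N[mu]_+oo[EFin \o b])%R.
  rewrite -lee_fin -bE; rewrite unlock /Lnorm ifT.
    by have := counting_ae (ess_sup_ge mu (abse \o (EFin \o b))) k.
  exact: muT.
rewrite bE !Lnorm1 -ge0_integralZr//.
apply: ge0_le_integral => //.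
by move=> k _ /=; rewrite -EFinM lee_fin normrM ler_wpM2l.
Qed.

Lemma counting_holder (p : \bar R) (p1 : 1 <= p) (a b : nat -> R) :
  'N[mu]_p[EFin \o a] < +oo -> 'N[mu]_(hoelder_conjugate p)[EFin \o b] < +oo ->
  'N[mu]_1[EFin \o (a \* b)%R] <=
  'N[mu]_p[EFin \o a] * 'N[mu]_(hoelder_conjugate p)[EFin \o b].
Proof.
case: p p1 => [r||//]; last first.
  move=> _ aoo _; rewrite hoelder_conjugatey muleC.
  rewrite (_ : (a \* b)%R = (b \* a)%R); last by apply/funext => k /=; rewrite mulrC.
  exact: counting_holder_1oo.
rewrite lee_fin le_eqVlt => /predU1P[<- _|r1 _ _].
  by rewrite hoelder_conjugate1; exact: counting_holder_1oo.
have r0 : (0 < r)%R by rewrite (lt_trans ltr01).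
rewrite /hoelder_conjugate/= eqe gt_eqF// -EFinB inver.
rewrite gt_eqF ?subr_gt0//.
rewrite -EFinM; apply: hoelder => //.
  by rewrite divr_gt0// subr_gt0.
rewrite invf_div -{1}(mul1r r^-1%R) -mulrDl addrC subrK divff// gt_eqF//.
Qed.

End holder.

Section ell_tensor.
Context (R : realType) (p q : \bar R) (p1 : (1 <= p)%E) (q1 : (1 <= q)%E).
Hypothesis pq : q = hoelder_conjugate p.
Context (X : normedModType R).

Definition ell_pairing (a : ell p1) (b : ell q1) : R :=
  limn (series (fun k => a k * b k)).

Lemma ell_partial_sum_le (a : ell p1) (b : ell q1) n :
  [normed series (fun k => a k * b k)] n <= `|a| * `|b|.
Proof.
rewrite -lee_fin EFinM.
have -> : `|a|%:E = 'N[@counting nat R]_p[EFin \o a]%E by exact: finite_norm_fine.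
have -> : `|b|%:E = 'N[@counting nat R]_q[EFin \o b]%E by exact: finite_norm_fine.
have := @counting_holder R p p1 a b; rewrite -pq.
move=> /(_ (Lfunction_finite p1 a) (Lfunction_finite q1 b)); apply: le_trans.
rewrite Lnorm1 ge0_integral_count//= -sumEFin.
exact: nneseries_lim_ge.
Qed.

Lemma cvg_ell_pairing (a : ell p1) (b : ell q1) :
  cvgn (series (fun k => a k * b k)).
Proof.
apply: normed_cvg; apply: nondecreasing_is_cvgn.
  by apply: nondecreasing_series => i _ _; exact: normr_ge0.
by exists (`|a| * `|b|) => _ [n _ <-]; exact: ell_partial_sum_le.
Qed.

Lemma ell_pairing_le (a : ell p1) (b : ell q1) :
  `|ell_pairing a b| <= `|a| * `|b|.
Proof.
have cv : cvgn [normed series (fun k => a k * b k)].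
  apply: nondecreasing_is_cvgn.
    by apply: nondecreasing_series => i _ _; exact: normr_ge0.
  by exists (`|a| * `|b|) => _ [n _ <-]; exact: ell_partial_sum_le.
apply: le_trans (lim_series_norm cv) _.
apply: limr_le => //; apply: nearW => n; exact: ell_partial_sum_le.
Qed.

Lemma ell_pairing_linear (a : ell p1) (c : R) (b1 b2 : ell q1) :
  ell_pairing a (c *: b1 + b2) = c * ell_pairing a b1 + ell_pairing a b2.
Proof.
rewrite /ell_pairing; apply/cvg_lim => //.
rewrite (_ : series _ =
  c *: series (fun k => a k * b1 k) + series (fun k => a k * b2 k)).
  apply: cvgD; last exact: cvg_ell_pairing.
  apply: cvgZl_tmp; exact: cvg_ell_pairing.
apply/funext => n /=; rewrite !fctE /series/= scaler_sumr -big_split/=.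
by apply: eq_bigr => k _; rewrite mulrDr mulrCA.
Qed.

Lemma ell_tensor_subproof (a : ell p1) (x : X) :
  (fun b : ell q1 => ell_pairing a b *: x) \in @bounded_operator_pred R (ell q1) X.
Proof.
rewrite inE; split.
  by move=> c b1 b2; rewrite ell_pairing_linear scalerDl scalerA.
exists (`|a| * `|x|) => b.
by rewrite normrZ mulrAC ler_wpM2r// ell_pairing_le.
Qed.

(* The elementary tensor a (x) x, seen as b |-> <a, b> x on the conjugate space. *)
Definition ell_tensor (a : ell p1) (x : X) : 'L(ell q1, X) :=
  BoundedOperator (ell_tensor_subproof a x).

End ell_tensor.

Section elln_tensor.
Context (R : realType) (p q : \bar R) (p1 : (1 <= p)%E) (q1 : (1 <= q)%E).
Context (n : nat) (X : normedModType R).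

Definition elln_pairing (a : elln p1 n) (b : elln q1 n) : R :=
  \sum_(i < n) a 0 i * b 0 i.

Lemma elln_coord_le (b : elln q1 n) i : `|b 0 i| <= `|b|.
Proof.
rewrite [leRHS]/(elln_norm b) /elln_norm.
have : (exists2 r, q = r%:E & 1 <= r) \/ q = +oo%E.
  by case: q q1 => [r r1|_|//]; [left; exists r|right].
move=> [[r -> r1]|->]; last exact: (le_bigmax _ (fun i => `|b 0 i|)).
have r0 : 0 < r by rewrite (lt_le_trans ltr01).
rewrite -{1}(@powRr1 _ `|b 0 i|)// -{1}(@mulfV _ r) ?gt_eqF// powRrM.
rewrite ge0_ler_powR ?invr_ge0 ?(ltW r0) ?nnegrE ?powR_ge0 ?sumr_ge0//.
by rewrite (bigD1 i)//= lerDl sumr_ge0.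
Qed.

Lemma elln_tensor_subproof (a : elln p1 n) (x : X) :
  (fun b : elln q1 n => elln_pairing a b *: x) \in
  @bounded_operator_pred R (elln q1 n) X.
Proof.
rewrite inE; split.
  move=> c b1 b2; rewrite scalerA -scalerDl; congr (_ *: _).
  rewrite /elln_pairing mulr_sumr -big_split/=; apply: eq_bigr => i _.
  by rewrite !mxE mulrDr mulrCA.
exists ((\sum_(i < n) `|a 0 i|) * `|x|) => b.
rewrite normrZ mulrAC ler_wpM2r// mulr_suml (le_trans (ler_norm_sum _ _ _))//.
by apply: ler_sum => i _; rewrite normrM ler_wpM2l// elln_coord_le.
Qed.

Definition elln_tensor (a : elln p1 n) (x : X) : 'L(elln q1 n, X) :=
  BoundedOperator (elln_tensor_subproof a x).

End elln_tensor.

Definition ell1 (R : realType) : Type := ell (lexx (1%E : \bar R)).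

Definition ellinfty (R : realType) : Type := ell (leey (1%E : \bar R)).

Definition c0 (R : realType) : set (ellinfty R) :=
  [set a : ellinfty R | a k @[k --> \oo] --> 0].

Definition ell_tensors (R : realType) (p q : \bar R) (p1 : (1 <= p)%E)
    (q1 : (1 <= q)%E) (pq : q = hoelder_conjugate p) (A : set (ell p1))
    (X : normedModType R) : set 'L(ell q1, X) :=
  lin_span [set ell_tensor q1 pq a x | a in A & x in [set: X]].

Definition elln_tensors (R : realType) (p q : \bar R) (p1 : (1 <= p)%E)
    (q1 : (1 <= q)%E) (n : nat) (A : set (elln p1 n)) (X : normedModType R) :
    set 'L(elln q1 n, X) :=
  lin_span [set elln_tensor q1 a x | a in A & x in [set: X]].

Arguments c0 : clear implicits.
Arguments ell_tensors {R p q p1} q1 pq A X.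
Arguments elln_tensors {R p q p1} q1 {n} A X.

(* Main.v *)
Require Import Defs.
From HB Require Import structures.
From mathcomp Require Import all_boot all_order all_algebra.
From mathcomp Require Import all_classical all_reals all_analysis.
From mathcomp Require Import ess_sup_inf measurable_realfun.
From mathcomp Require Import ring lra.
Set Implicit Arguments.
Unset Strict Implicit.
Unset Printing Implicit Defensive.
Import Order.TTheory GRing.Theory Num.Theory.
Import numFieldNormedType.Exports.
Local Open Scope classical_set_scope.
Local Open Scope ring_scope.

(* Write q for the conjugate exponent of p.

   Octahedrality.  Both L_1 and l_1 contain, for any finite set of vectors and
   up to an arbitrarily small error, copies of l_1^J in l_1-direct position to
   that set: take normalized indicators of small disjoint sets.  Hence H is
   octahedral as soon as every finite set of operators is almost normed at
   points that a map [z |-> (phi_j z)_j] with values in l_1^J, of norm at most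
   one and with [phi_j] in the space of first tensor factors, almost maps to
   the unit sphere: the required unit vector is almost [sum_j phi_j (x) h_j].
   For q = oo a single coordinate does, because the ball is the convex hull of
   the points at which it is 1 or -1.  For 1 <= q <= 2, and for every q in
   dimension 2, it suffices that l_q^N embeds almost isometrically in l_1^J.
   In dimension 2 the unit ball of the dual is a zonoid, approximated along
   its boundary arc.  For 1 < q <= 2 one uses a q-stable law: exp (- sum |b_k|^q)
   is a limit of finite positive combinations of cosines, obtained from powers
   of the binomial series of [(1 - cos^2)^(q/2)], and the first moment of such
   a combination is nearly a function of its characteristic function.

   Failure for 1 < p < 2 in dimension at least 3.  If H were octahedral, the
   unit vector y attached to the span of three tensors [e_i (x) x0] would
   satisfy |y z| = |z| up to a small error on a copy of l_q^3, by uniform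
   convexity of l_q (Clarkson).  But q > 2, and l_q^3 violates an inequality
   that holds for |.| on the line and hence, on integrating, in every L_1:
   [sum_v (|x a + v| + |x a - v| - 2 |v|) >= 2 x |a| - (2/m) (|b| + |c|)]
   where v runs over (j/m) b + c and b + (j/m) c with |j| <= m; in l_q^3 the
   left-hand side is only O(m x^q), and x = 4/m gives a contradiction. *)

(** * The binomial series and cosine polynomials *)

Section power_series.
Variables (R : realType) (a : R).
Hypothesis a01 : 0 < a <= 1.
Implicit Types (n : nat) (z : R).

(* [sibuya n] is the coefficient of [z^(n+1)] in [1 - (1 - z)^a]. *)
Fixpoint sibuya (n : nat) : R :=
  if n is m.+1 then sibuya m * (m.+1%:R - a) / m.+2%:R else a.

Lemma sibuya_ge0 n : 0 <= sibuya n.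
Proof.
have /andP[a0 a1] := a01.
elim: n => [|n IH] /=; first exact: ltW.
rewrite divr_ge0// mulr_ge0// subr_ge0 (le_trans a1)// ler1n//.
Qed.

Lemma sibuyaS n : n.+2%:R * sibuya n.+1 = (n.+1%:R - a) * sibuya n.
Proof. by rewrite /= mulrC divfK// mulrC. Qed.

Lemma sibuya_le n : n.+1%:R * sibuya n <= 1.
Proof.
have /andP[a0 a1] := a01.
elim: n => [|n IH]; first by rewrite mul1r.
rewrite sibuyaS (le_trans _ IH)// ler_wpM2r ?sibuya_ge0//.
by rewrite gerBl ltW.
Qed.

(** Taylor polynomial of [(1 - z)^a]. Its value at 1 is the mass that the first [n] coefficients
    leave out of a total of 1, a tail of Sibuya's law. *)
Definition sibuya_tail (n : nat) : {poly R} :=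
  1 - \sum_(i < n) sibuya i *: 'X^(i.+1).

Lemma sibuya_tailE n z :
  (sibuya_tail n).[z] = 1 - \sum_(i < n) sibuya i * z ^+ i.+1.
Proof.
rewrite /sibuya_tail !hornerE horner_sum; congr (_ - _).
by apply: eq_bigr => i _; rewrite !hornerE.
Qed.

(* The function [(1 - z)^a] solves [(1 - z) f' + a f = 0]. *)
Lemma sibuya_tail_ode n : (1 - 'X) * (sibuya_tail n)^`() + a *: sibuya_tail n =
  (n.+1%:R * sibuya n) *: 'X^n.
Proof.
elim: n => [|n IH].
  by rewrite /sibuya_tail big_ord0 subr0 derivC mulr0 add0r mul1r expr0.
have -> : sibuya_tail n.+1 = sibuya_tail n - sibuya n *: 'X^(n.+1).
  by rewrite /sibuya_tail big_ord_recr/= opprD addrA.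
rewrite derivB derivZ derivXn/= mulrBr scalerBr addrACA IH sibuyaS.
rewrite -!mul_polyC -opprD !mulrA !polyCM polyCB !polyCMn exprS !polyC1.
move: 'X (a%:P) ((sibuya n)%:P) => x y z; rewrite -!(mulr_natl (x ^+ n)).
ring.
Qed.

(** Division by [(1 - z)^a], a solution of the homogeneous equation, leaves only the monomial defect
    in [sibuya_tail_ode]; hence the derivative is nonnegative for [0 <= z < 1]. *)
Lemma is_derive_ratio n z : z < 1 ->
  is_derive z 1 (fun z => (sibuya_tail n).[z] * (1 - z) `^ (- a))
    (n.+1%:R * sibuya n * z ^+ n * (1 - z) `^ (- a - 1)).
Proof.
move=> z1.
have zz : 0 < 1 - z by rewrite subr_gt0.
have d1 : is_derive z 1 (fun z : R => 1 - z) (-1).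
  have := is_deriveB (is_derive_cst (1 : R) z 1) (is_derive_id z (1:R)).
  by rewrite sub0r.
have d2 : is_derive z 1 ((@powR R)^~ (- a) \o (fun z : R => 1 - z))
    ((- a) * (1 - z) `^ (- a - 1) * (-1)).
  by apply: is_derive1_comp; exact: is_derive1_powR.
have d3 : is_derive z 1 (horner (sibuya_tail n)) ((sibuya_tail n)^`().[z]).
  rewrite derivE derive1E; apply: DeriveDef => //.
apply: (is_derive_eq (is_deriveM d3 d2)).
rewrite /= ![_ *: _]mulrC.
have -> : (1 - z) `^ (- a) = (1 - z) * (1 - z) `^ (- a - 1).
  rewrite -{2}(powRr1 (ltW zz)) -powRD; last by rewrite (gt_eqF zz) implybT.
  by congr (_ `^ _); ring.
have := congr1 (fun p : {poly R} => p.[z]) (sibuya_tail_ode n).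
rewrite !hornerE /= => <-.
ring.
Qed.

Lemma sibuya_tail_ratio n z : 0 <= z < 1 -> exists2 c, c \in `[0, z] &
  (sibuya_tail n).[z] * (1 - z) `^ (- a) - 1 =
  n.+1%:R * sibuya n * c ^+ n * (1 - c) `^ (- a - 1) * z.
Proof.
move=> /andP[z0 z1].
have [||c cz] := @MVT_segment R
  (fun z => (sibuya_tail n).[z] * (1 - z) `^ (- a))
  (fun z => n.+1%:R * sibuya n * z ^+ n * (1 - z) `^ (- a - 1)) 0 z z0.
- move=> x; rewrite in_itv/= => /andP[_ xz]; apply: is_derive_ratio.
  exact: lt_trans xz _.
- apply: derivable_within_continuous => x; rewrite in_itv/= => /andP[_ xz].
  by have [] := is_derive_ratio n (le_lt_trans xz z1).
- rewrite !subr0 powR1 mulr1 (sibuya_tailE n 0) big1 ?subr0//.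
    by move=> e; exists c.
  by move=> i _; rewrite expr0n mulr0.
Qed.

Lemma sibuya_tail_ge n z : 0 <= z < 1 -> (1 - z) `^ a <= (sibuya_tail n).[z].
Proof.
move=> z01; have [c cz e] := sibuya_tail_ratio n z01.
move: z01 cz; rewrite in_itv/= => /andP[z0 z1] /andP[c0 cz].
have zz : 0 < 1 - z by rewrite subr_gt0.
have : 0 <= (sibuya_tail n).[z] * (1 - z) `^ (- a) - 1.
  by rewrite e !mulr_ge0 ?sibuya_ge0 ?exprn_ge0 ?powR_ge0.
by rewrite powRN subr_ge0 ler_pdivlMr ?powR_gt0// mul1r.
Qed.

(** In the mean value formula the coefficient is at most 1 by [sibuya_le], and the factors depending
    on [c] increase, so they are largest at [c = z]. *)
Lemma sibuya_tail_le n z : 0 <= z < 1 ->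
  (sibuya_tail n).[z] <= (1 - z) `^ a + z ^+ n / (1 - z).
Proof.
move=> z01; have [c cz e] := sibuya_tail_ratio n z01.
move: z01 cz; rewrite in_itv/= => /andP[z0 z1] /andP[c0 cz].
have zz : 0 < 1 - z by rewrite subr_gt0.
have p0 : 0 < (1 - z) `^ a by exact: powR_gt0.
have /andP[a0 a1] := a01.
have : (sibuya_tail n).[z] * (1 - z) `^ (- a) - 1 <=
    z ^+ n * (1 - z) `^ (- a - 1).
  rewrite e -[leRHS]mulr1 ler_pM//.
  - by rewrite !mulr_ge0 ?sibuya_ge0 ?exprn_ge0 ?powR_ge0.
  - rewrite ler_pM ?powR_ge0 ?mulr_ge0 ?exprn_ge0 ?sibuya_ge0//.
      rewrite -[leRHS]mul1r ler_pM ?mulr_ge0 ?exprn_ge0 ?sibuya_ge0//.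
        exact: sibuya_le.
      by rewrite lerXn2r ?nnegrE ?(le_trans c0).
    rewrite -opprD !powRN lef_pV2 ?posrE ?powR_gt0 ?subr_gt0 ?(le_lt_trans cz)//.
    rewrite ge0_ler_powR ?nnegrE ?subr_ge0 ?addr_ge0 ?(ltW a0) ?(ltW z1)//.
      exact: le_trans (ltW z1).
    by rewrite lerB.
  - exact: ltW.
rewrite lerBlDl -ler_pdivlMr ?powR_gt0// => /le_trans; apply.
rewrite powRN invrK mulrDl mul1r lerD2l -mulrA ler_wpM2l ?exprn_ge0//.
rewrite -powRD; last by rewrite (gt_eqF zz) implybT.
have -> : - a - 1 + a = -1 by ring.
by rewrite powR_inv1 ?(ltW zz).
Qed.

Lemma sibuya_tail1 n : a * (sibuya_tail n).[1] = n.+1%:R * sibuya n.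
Proof.
have := congr1 (fun p : {poly R} => p.[1]) (sibuya_tail_ode n).
by rewrite !hornerE /= subrr mul0r add0r expr1n mulr1.
Qed.

Lemma sibuya_tail1_ge0 n : 0 <= (sibuya_tail n).[1].
Proof.
have /andP[a0 a1] := a01.
by rewrite -(pmulr_rge0 _ a0) sibuya_tail1 mulr_ge0 ?sibuya_ge0.
Qed.

Lemma sibuya_tail1_le n z : 0 <= z <= 1 -> (sibuya_tail n).[1] <= (sibuya_tail n).[z].
Proof.
move=> /andP[z0 z1]; rewrite !sibuya_tailE lerD2l lerN2 ler_sum// => i _.
by rewrite ler_wpM2l ?sibuya_ge0// lerXn2r ?nnegrE.
Qed.

(** The difference of the values at [z] and at 1 is the sum of the [sibuya i (1 - z^(i+1))]; its
    terms are nonnegative, so it grows with the degree. *)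
Lemma sibuya_tail_sub n m z : (n <= m)%N -> 0 <= z <= 1 ->
  (sibuya_tail n).[z] - (sibuya_tail n).[1] <= (sibuya_tail m).[z].
Proof.
move=> nm /andP[z0 z1]; apply: (@le_trans _ _ ((sibuya_tail m).[z] - (sibuya_tail m).[1])).
  rewrite !sibuya_tailE !opprD !opprK !addrA ![1 + _ - 1]addrAC !subrr !add0r.
  rewrite -!sumrN -!big_split/=.
  rewrite -!(big_mkord xpredT (fun i => - (sibuya i * z ^+ i.+1) + sibuya i * 1 ^+ i.+1)).
  rewrite [leRHS](big_cat_nat (leq0n n) nm)/= lerDl sumr_ge0// => i _.
  rewrite addrC -mulrBr mulr_ge0 ?sibuya_ge0// subr_ge0 expr1n exprn_ile1//.
by rewrite gerBl sibuya_tail1_ge0.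
Qed.

Lemma cvg_sibuya_bound z : 0 <= z < 1 ->
  ((1 - z) `^ a + z ^+ n / (1 - z)) @[n --> \oo] --> (1 - z) `^ a.
Proof.
move=> /andP[z0 z1]; rewrite -[X in _ --> X]addr0; apply: cvgD; first exact: cvg_cst.
rewrite -[X in _ --> X](mul0r (1 - z)^-1); apply: cvgM; last exact: cvg_cst.
by apply: cvg_expr; rewrite ger0_norm.
Qed.

(** The polynomial decreases on [[0, 1]], so its value at 1 is at most that at [1 - y], which tends
    to [y^a]; and [y^a] is as small as desired. *)
Lemma cvg_sibuya_tail1 : (sibuya_tail n).[1] @[n --> \oo] --> 0.
Proof.
have /andP[a0 a1] := a01.
apply/cvgrPdist_le => e e0; rewrite /=.
pose d := Num.min 1 (e / 2).
have d0 : 0 < d by rewrite lt_min ltr01 divr_gt0.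
(* Thus [y^a = d <= e / 2], and the cap [d <= 1] keeps [1 - y] nonnegative. *)
pose y := d `^ a^-1.
have y0 : 0 < y by exact: powR_gt0.
have y1 : y <= 1.
  rewrite -[leRHS](powRr0 d) ger_powR ?d0 ?ge_min ?lexx// invr_ge0 ltW//.
have z01 : 0 <= 1 - y < 1 by rewrite subr_ge0 y1 ltrBlDr ltrDl.
have ya : (1 - (1 - y)) `^ a <= e / 2.
  rewrite opprB addrC subrK /y -powRrM mulVf ?gt_eqF// powRr1 ?(ltW d0)//.
  by rewrite ge_min lexx orbT.
have /cvgrPdist_lt/(_ (e / 2)) := cvg_sibuya_bound z01.
rewrite divr_gt0// => /(_ isT); apply: filterS => n ne.
rewrite sub0r normrN ger0_norm ?sibuya_tail1_ge0//.
have /andP[z0 z1] := z01.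
apply: (le_trans (@sibuya_tail1_le n (1 - y) _)); first by rewrite z0 ltW.
apply: (le_trans (sibuya_tail_le n z01)).
move: ne; rewrite distrC ltr_norml => /andP[_ ne]; lra.
Qed.

(** This presents [(1 - z)^a] as a mixture of the [1 - z^(i+1)]. The signs and the total mass 1
    matter: for [z = cos^2], one minus a truncation is a positive combination of powers of cosines.
    The truncation error is uniform in [z]. *)
Lemma powR_series : exists c : nat -> R,
  [/\ forall i, 0 <= c i,
      forall n, 0 <= 1 - \sum_(i < n) c i,
      (1 - \sum_(i < n) c i) @[n --> \oo] --> 0 &
      forall n z, 0 <= z <= 1 ->
        \sum_(i < n) c i * (1 - z ^+ i.+1) <= (1 - z) `^ a <=
        \sum_(i < n) c i * (1 - z ^+ i.+1) + (1 - \sum_(i < n) c i)].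
Proof.
have /andP[a0 a1] := a01.
have tE n : (sibuya_tail n).[1] = 1 - \sum_(i < n) sibuya i.
  by rewrite sibuya_tailE; under eq_bigr do rewrite expr1n mulr1.
have sE n z : \sum_(i < n) sibuya i * (1 - z ^+ i.+1) =
    (sibuya_tail n).[z] - (sibuya_tail n).[1].
  under eq_bigr do rewrite mulrBr mulr1.
  by rewrite sumrB tE sibuya_tailE; ring.
exists sibuya; split => [i|n||n z /andP[z0]].
- exact: sibuya_ge0.
- by rewrite -tE sibuya_tail1_ge0.
- by under eq_fun do rewrite -tE; exact: cvg_sibuya_tail1.
- rewrite le_eqVlt => /predU1P[->|z1].
    rewrite sE !subrr powR0 ?gt_eqF// lexx add0r -tE sibuya_tail1_ge0//.
  have z01 : 0 <= z < 1 by rewrite z0.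
  rewrite sE -tE subrK sibuya_tail_ge// andbT.
  apply: (ler_cvg_to (cvg_cst _) (cvg_sibuya_bound z01)).
  near=> m; apply: le_trans (sibuya_tail_le m z01).
  apply: sibuya_tail_sub; last by rewrite z0 ltW.
  by near: m; exists n.
Unshelve. all: by end_near. Qed.

End power_series.

Lemma ler_norm_prodB (R : realType) (I : Type) (r : seq I) (x y : I -> R) :
  (forall i, `|x i| <= 1) -> (forall i, `|y i| <= 1) ->
  `|\prod_(i <- r) x i - \prod_(i <- r) y i| <= \sum_(i <- r) `|x i - y i|.
Proof.
move=> x1 y1; elim: r => [|i r IH]; first by rewrite !big_nil subrr normr0.
rewrite !big_cons.
have -> : x i * \prod_(j <- r) x j - y i * \prod_(j <- r) y j =
    (x i - y i) * \prod_(j <- r) x j +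
    y i * (\prod_(j <- r) x j - \prod_(j <- r) y j) by ring.
rewrite (le_trans (ler_normD _ _))// !normrM lerD//.
  by rewrite ler_piMr// normr_prod prodr_ile1// => j _; rewrite normr_ge0 x1.
by apply: le_trans IH; rewrite ler_piMl.
Qed.

Lemma ler_norm_expB (R : realType) (n : nat) (x y : R) : `|x| <= 1 -> `|y| <= 1 ->
  `|x ^+ n - y ^+ n| <= n%:R * `|x - y|.
Proof.
move=> x1 y1; have := @ler_norm_prodB R 'I_n (index_enum _) (fun=> x) (fun=> y).
move=> /(_ (fun=> x1) (fun=> y1)).
by rewrite !prodr_const sumr_const card_ord mulr_natl.
Qed.

(** * The modulus bounded by cosines at dyadic scales *)

Section trigo.
Variable R : realType.
Implicit Types (x t : R).

Lemma sin_mulcos x : exists2 c : R, `|c| <= `|x| & sin x = x * cos c.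
Proof.
wlog x0 : x / 0 <= x.
  move=> h; have [/h//|/ltW xle] := leP 0 x.
  have [|c cx e] := h (- x); first by rewrite oppr_ge0.
  by exists c; [rewrite -(normrN x)|apply: oppr_inj; rewrite -sinN e mulNr].
have [|c] := @MVT_segment R sin cos 0 x x0 _.
  by apply: continuous_subspaceT => y; exact: continuous_sin.
rewrite sin0 !subr0 in_itv/= => /andP[c0 cx] e; exists c; last by rewrite e mulrC.
by rewrite !ger0_norm.
Qed.

Lemma norm_sin_le x : `|sin x| <= `|x|.
Proof.
have [c _ ->] := sin_mulcos x.
by rewrite normrM ler_piMr// cos_max.
Qed.

Lemma cosD1_sin2 x : 1 - cos (2 * x) = 2 * sin x ^+ 2.
Proof. rewrite mulr_natl cos_mulr2n cos2sin2 -mulr_natl; ring. Qed.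

Lemma cos_ge x : 1 - x ^+ 2 / 2 <= cos x.
Proof.
have := cosD1_sin2 (x / 2).
have -> : 2 * (x / 2) = x by field.
have : sin (x / 2) ^+ 2 <= (x / 2) ^+ 2.
  by rewrite -real_normK ?num_real// -[leRHS]real_normK ?num_real// lerXn2r ?nnegrE// norm_sin_le.
move=> h e; nra.
Qed.

Lemma norm_sin_ge x : `|x| * (1 - x ^+ 2 / 2) <= `|sin x|.
Proof.
have [c cx ->] := sin_mulcos x; rewrite normrM ler_wpM2l//.
apply: le_trans (ler_norm _); apply: le_trans (cos_ge c).
rewrite lerD2l lerN2 ler_wpM2r// -real_normK ?num_real//.
by rewrite -[leRHS]real_normK ?num_real// lerXn2r ?nnegrE.
Qed.

(** The left side is [2 |sin x| (1 - |cos x|)], and [1 - |cos x| <= |sin x|], while the right side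
    is [2 sin^2 x]. *)
Lemma norm_sin_double x : 2 * `|sin x| - `|sin (2 * x)| <= 1 - cos (2 * x).
Proof.
have -> : sin (2 * x) = 2 * (cos x * sin x).
  by rewrite mulr_natl sin_mulr2n mulr_natl.
rewrite cosD1_sin2 !normrM (ger0_norm (ler0n _ _)).
have := sin2cos2 x; rewrite -real_normK ?num_real// -(real_normK (num_real (cos x))).
have := sin_max x; have := cos_max x; have := normr_ge0 (sin x).
have := normr_ge0 (cos x).
move: `|sin x| `|cos x| => s c; nra.
Qed.

Lemma norm_sin_dyadic (j m : nat) t :
  2 ^+ (j + m) * `|sin (t / 2 ^+ (j + m))| - 2 ^+ j * `|sin (t / 2 ^+ j)| <=
  \sum_(i < m) 2 ^+ (j + i) * (1 - cos (t / 2 ^+ (j + i))).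
Proof.
elim: m => [|m IH]; first by rewrite addn0 subrr big_ord0.
rewrite big_ord_recr/= addnS.
have := norm_sin_double (t / 2 ^+ (j + m).+1).
have -> : 2 * (t / 2 ^+ (j + m).+1) = t / 2 ^+ (j + m).
  by rewrite exprS; field; rewrite expf_neq0.
have e0 : 0 <= 2 ^+ (j + m) :> R by rewrite exprn_ge0.
move=> /(ler_wpM2l e0); rewrite exprS; lra.
Qed.

(** The doubling bound telescopes from scale [j] to scale [j + m], where
    [2^(j+m) |sin (t / 2^(j+m))|] misses [|t|] by at most [|t|^3 / 4^m]. Up to this error only
    cosines remain, whose means are values of a characteristic function. *)
Lemma norm_dyadic_le (j m : nat) t :
  `|t| - 2 ^+ j * `|sin (t / 2 ^+ j)| <=
  \sum_(i < m) 2 ^+ (j + i) * (1 - cos (t / 2 ^+ (j + i))) +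
  `|t| ^+ 3 / 4 ^+ m.
Proof.
have := norm_sin_dyadic j m t.
have := norm_sin_ge (t / 2 ^+ (j + m)).
have e0 : 0 < 2 ^+ (j + m) :> R by rewrite exprn_gt0.
move=> /(ler_wpM2l (ltW e0)).
rewrite normrM normfV (ger0_norm (ltW e0)) mulrA mulrCA mulfV ?gt_eqF// mulr1.
have : `|t| * ((t / 2 ^+ (j + m)) ^+ 2 / 2) <= `|t| ^+ 3 / 4 ^+ m.
  rewrite (exprS _ 2) -mulrA ler_wpM2l// expr_div_n real_normK ?num_real// -mulrA.
  rewrite ler_wpM2l ?sqr_ge0// -invfM lef_pV2 ?posrE ?mulr_gt0 ?exprn_gt0//.
  have -> : 4 = 2 ^+ 2 :> R by ring.
  rewrite -exprM -exprM -exprSr ler_eXn2l ?ltr1n//.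
  by rewrite mulnC leqW// leq_mul2r leq_addl.
lra.
Qed.

(** One averaging step multiplies [s -> cos (s y)] by [cos y]; iteration therefore reads the mean of
    [cos^k] off a characteristic function. *)
Fixpoint cos_avg (k : nat) (h : R -> R) (s : R) : R :=
  if k is l.+1 then (cos_avg l h (s + 1) + cos_avg l h (s - 1)) / 2 else h s.

Lemma cos_avgE (I : finType) (w y : I -> R) (k : nat) s :
  \sum_i w i * (cos (y i) ^+ k * cos (s * y i)) =
  cos_avg k (fun s => \sum_i w i * cos (s * y i)) s.
Proof.
elim: k s => [|k IH] s /=.
  by apply: eq_bigr => i _; rewrite mul1r.
rewrite -!IH -big_split mulr_suml; apply: eq_bigr => i _ /=.
rewrite [(s + 1) * _]mulrDl [(s - 1) * _]mulrBl mul1r cosD cosB exprS; by field.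
Qed.

Lemma cvg_cos_avg (h : nat -> R -> R) (h0 : R -> R) k s :
  (forall s, h n s @[n --> \oo] --> h0 s) ->
  cos_avg k (h n) s @[n --> \oo] --> cos_avg k h0 s.
Proof.
move=> hh; elim: k s => [|k IH] s /=; first exact: hh.
by apply: cvgM; [apply: cvgD|exact: cvg_cst].
Qed.

End trigo.

(** * Characteristic functions of finitely supported symmetric measures *)

Section characteristic_functions.
Variables (R : realType) (N : nat).
Implicit Types (b g : 'rV[R]_N).

Definition dot g b : R := \sum_k g 0 k * b 0 k.

Lemma dotDl g h b : dot (g + h) b = dot g b + dot h b.
Proof.
by rewrite /dot -big_split; apply: eq_bigr => k _; rewrite !mxE mulrDl.
Qed.

Lemma dotBl g h b : dot (g - h) b = dot g b - dot h b.
Proof.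
by rewrite /dot -sumrB; apply: eq_bigr => k _; rewrite !mxE mulrBl.
Qed.

Lemma dotZr a g b : dot g (a *: b) = a * dot g b.
Proof.
by rewrite /dot mulr_sumr; apply: eq_bigr => k _; rewrite !mxE mulrCA.
Qed.

Lemma dotZl a g b : dot (a *: g) b = a * dot g b.
Proof.
by rewrite /dot mulr_sumr; apply: eq_bigr => k _; rewrite !mxE mulrA.
Qed.

Lemma dot0r g : dot g 0 = 0.
Proof. by rewrite /dot big1// => k _; rewrite mxE mulr0. Qed.

(** The [g i] are atoms of masses [w i], and taking cosines symmetrizes the measure. Finite support
    turns every expectation into a finite sum. *)
Definition pos_def (phi : 'rV[R]_N -> R) : Prop :=
  exists (I : finType) (w : I -> R) (g : I -> 'rV[R]_N),
    (forall i, 0 <= w i) /\ phi = fun b => \sum_i w i * cos (dot (g i) b).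

Lemma pos_def_cos g : pos_def (fun b => cos (dot g b)).
Proof.
exists unit, (fun=> 1), (fun=> g); split => [_//|].
by apply/funext => b; rewrite big_const card_unit /= addr0 mul1r.
Qed.

Lemma pos_def_cst (c : R) : 0 <= c -> pos_def (fun=> c).
Proof.
move=> c0; exists unit, (fun=> c), (fun=> 0); split => [_//|].
apply/funext => b; rewrite big_const card_unit /= addr0.
by rewrite /dot big1 ?cos0 ?mulr1// => k _; rewrite mxE mul0r.
Qed.

Lemma pos_defD phi psi : pos_def phi -> pos_def psi ->
  pos_def (fun b => phi b + psi b).
Proof.
move=> [I [w [g [w0 ->]]]] [J [v [h [v0 ->]]]].
exists (I + J)%type, (fun i => match i with inl i => w i | inr j => v j end),
  (fun i => match i with inl i => g i | inr j => h j end).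
split; first by case.
by apply/funext => b; rewrite big_sumType.
Qed.

(** Product-to-sum formula, that is, convolution of symmetric measures; the Boolean chooses between
    the sum and the difference of two atoms. *)
Lemma pos_defM phi psi : pos_def phi -> pos_def psi ->
  pos_def (fun b => phi b * psi b).
Proof.
move=> [I [w [g [w0 ->]]]] [J [v [h [v0 ->]]]].
exists (I * J * bool)%type, (fun i => w i.1.1 * v i.1.2 / 2),
  (fun i => if i.2 then g i.1.1 + h i.1.2 else g i.1.1 - h i.1.2).
split; first by move=> i; rewrite divr_ge0// mulr_ge0.
apply/funext => b.
rewrite -(pair_bigA _ (fun (i : I * J) (c : bool) => w i.1 * v i.2 / 2 *
   cos (dot (if c then g i.1 + h i.2 else g i.1 - h i.2) b)))/=.
rewrite -(pair_bigA _ (fun i j => \sum_(c : bool) (w i * v j / 2 *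
   cos (dot (if c then g i + h j else g i - h j) b))))/=.
rewrite mulr_suml; apply: eq_bigr => i _; rewrite mulr_sumr; apply: eq_bigr => j _.
by rewrite big_bool/= dotDl dotBl cosD cosB; field.
Qed.

Lemma pos_defX phi n : pos_def phi -> pos_def (fun b => phi b ^+ n).
Proof.
move=> phiP; elim: n => [|n IH].
  by under eq_fun do rewrite expr0; exact: pos_def_cst.
by under eq_fun do rewrite exprS; exact: pos_defM.
Qed.

Lemma pos_def_sum n (phi : 'I_n -> 'rV[R]_N -> R) : (forall i, pos_def (phi i)) ->
  pos_def (fun b => \sum_i phi i b).
Proof.
elim: n phi => [|n IH] phi phiP.
  by under eq_fun do rewrite big_ord0; exact: pos_def_cst.
under eq_fun do rewrite big_ord_recl.
by apply: pos_defD => //; exact: IH.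
Qed.

Lemma pos_def_prod n (phi : 'I_n -> 'rV[R]_N -> R) : (forall i, pos_def (phi i)) ->
  pos_def (fun b => \prod_i phi i b).
Proof.
elim: n phi => [|n IH] phi phiP.
  by under eq_fun do rewrite big_ord0; exact: pos_def_cst.
under eq_fun do rewrite big_ord_recl.
by apply: pos_defM => //; exact: IH.
Qed.

End characteristic_functions.

(** * The first absolute moment in terms of the characteristic function *)

Section first_moment.
Variables (R : realType) (N : nat) (q : R).
Hypothesis q1 : 1 < q.
Variables (I : finType) (w : I -> R) (g : I -> 'rV[R]_N).
Hypothesis w0 : forall i, 0 <= w i.
Hypothesis w1 : \sum_i w i = 1.
Implicit Types (b : 'rV[R]_N).

Definition sumpow b : R := \sum_k `|b 0 k| `^ q.

Let phi b : R := \sum_i w i * cos (dot (g i) b).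

Hypothesis phi_le : forall b, 1 - phi b <= sumpow b.

Lemma sumpow_ge0 b : 0 <= sumpow b.
Proof. by rewrite sumr_ge0// => k _; exact: powR_ge0. Qed.

Lemma sumpowZ a b : sumpow (a *: b) = `|a| `^ q * sumpow b.
Proof.
rewrite /sumpow mulr_sumr; apply: eq_bigr => k _.
by rewrite mxE normrM powRM.
Qed.

Let rho : R := 2 `^ (1 - q).

(** Integrating [norm_dyadic_le] gives terms [2^(j+l) (1 - phi (b / 2^(j+l)))], each at most
    [rho^(j+l) sumpow b]; since [q > 1], this series is geometric with ratio [rho < 1]. *)
Lemma moment_le j b :
  \sum_i w i * `|dot (g i) b| -
    2 ^+ j * \sum_i w i * `|sin (dot (g i) b / 2 ^+ j)| <=
  rho ^+ j / (1 - rho) * sumpow b.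
Proof.
have rho1 : rho < 1.
  have qB : 0 < q - 1 by rewrite subr_gt0.
  rewrite /rho -opprB powRN invf_lt1 ?powR_gt0//.
  have := @gt0_ltr_powR _ _ qB 1 2; rewrite powR1; apply; rewrite ?nnegrE//.
  by rewrite ltr1n.
have rho0 : 0 <= rho by exact: powR_ge0.
(* This third moment has no bound uniform in the measure, but it only enters with the factor [4^-m]
   and disappears as [m] tends to infinity. *)
pose K := \sum_i w i * `|dot (g i) b| ^+ 3.
have step m : \sum_i w i * `|dot (g i) b| -
    2 ^+ j * \sum_i w i * `|sin (dot (g i) b / 2 ^+ j)| <=
    rho ^+ j / (1 - rho) * sumpow b + K / 4 ^+ m.
  rewrite mulr_sumr -sumrB.
  apply: (@le_trans _ _ (\sum_i w i * (\sum_(l < m) 2 ^+ (j + l) *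
      (1 - cos (dot (g i) b / 2 ^+ (j + l))) + `|dot (g i) b| ^+ 3 / 4 ^+ m))).
    apply: ler_sum => i _; rewrite mulrCA -mulrBr ler_wpM2l//.
    exact: norm_dyadic_le.
  under eq_bigr do rewrite mulrDr mulrA.
  rewrite big_split/= -mulr_suml lerD2r.
  under eq_bigr do rewrite mulr_sumr.
  rewrite exchange_big/=.
  apply: (@le_trans _ _ (\sum_(l < m) rho ^+ (j + l) * sumpow b)).
    apply: ler_sum => l _.
    under eq_bigr do rewrite mulrCA.
    rewrite -mulr_sumr.
    under eq_bigr do rewrite mulrBr mulr1 [_ / _]mulrC -dotZr.
    rewrite sumrB w1 -/(phi _).
    apply: le_trans (ler_wpM2l _ (phi_le _)) _; first exact: exprn_ge0.
    rewrite sumpowZ mulrA ler_wpM2r ?sumpow_ge0//.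
    rewrite ger0_norm ?invr_ge0 ?exprn_ge0// /rho.
    rewrite -!powR_mulrn ?powR_ge0// -powRN -!powRrM -powRD; last by rewrite pnatr_eq0 implybT.
    by rewrite le_eqVlt; apply/orP; left; apply/eqP; congr (_ `^ _); ring.
  rewrite -mulr_suml ler_wpM2r ?sumpow_ge0//.
  under eq_bigr do rewrite exprD.
  rewrite -mulr_sumr ler_wpM2l ?exprn_ge0//.
  have e : (1 - rho) * (\sum_(l < m) rho ^+ l) = 1 - rho ^+ m.
    by rewrite -[1 - rho]opprB mulNr -subrX1 opprB.
  rewrite -[leRHS]mul1r ler_pdivlMr ?subr_gt0// mulrC e.
  by rewrite lerBlDr lerDl exprn_ge0.
rewrite -[leRHS]addr0.
have c4 : (rho ^+ j / (1 - rho) * sumpow b + K / 4 ^+ m) @[m --> \oo] -->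
    rho ^+ j / (1 - rho) * sumpow b + 0.
  apply: cvgD; first exact: cvg_cst.
  under eq_fun do rewrite -exprVn.
  apply: (@cvg_geometric R K (4^-1)).
  by rewrite ger0_norm// invf_lt1// ltr1n.
by apply: (ler_cvg_to (cvg_cst _) c4); apply: nearW => m; exact: step.
Qed.

Lemma moment_ge j b :
  2 ^+ j * (\sum_i w i * `|sin (dot (g i) b / 2 ^+ j)|) <=
  \sum_i w i * `|dot (g i) b|.
Proof.
rewrite mulr_sumr; apply: ler_sum => i _; rewrite mulrCA ler_wpM2l//.
have := norm_sin_le (dot (g i) b / 2 ^+ j).
rewrite normrM normfV (@ger0_norm _ (2 ^+ j)) ?exprn_ge0//.
by rewrite ler_pdivlMr ?exprn_gt0// mulrC.
Qed.

(** Because [(1 - cos (2 x)) / 2 = sin^2 x <= |x|]. The bound keeps the first moment away from 0, so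
    that it can be normalized later. *)
Lemma moment_ge_phi b : (1 - phi (2 *: b)) / 2 <= \sum_i w i * `|dot (g i) b|.
Proof.
rewrite -{1}w1 /phi -sumrB mulr_suml; apply: ler_sum => i _.
rewrite dotZr -{1}[w i]mulr1 -mulrBr -mulrA ler_wpM2l//.
rewrite cosD1_sin2 mulrAC divff// mul1r.
apply: le_trans (norm_sin_le _).
by rewrite -real_normK ?num_real// expr2 ler_piMr// sin_max.
Qed.

End first_moment.

(** * Stable laws and almost isometric embeddings into l_1 *)

Section stable_law.
Variables (R : realType) (q : R) (N : nat).
Hypothesis q12 : 1 < q <= 2.
Implicit Types (b : 'rV[R]_N) (s x : R).

Let q0 : 0 < q. Proof. by case/andP: q12 => /(lt_trans ltr01). Qed.

Let half_q : 0 < q / 2 <= 1.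
Proof. by case/andP: q12 => _ ?; rewrite divr_gt0//= ler_pdivrMr// mul1r. Qed.

Lemma powR_sin s (p : R) : (1 - cos s ^+ 2) `^ (p / 2) = `|sin s| `^ p.
Proof.
rewrite -sin2cos2 -real_normK ?num_real// -powR_mulrn// -powRrM.
by congr (_ `^ _); rewrite mulrC divfK.
Qed.

(** For [|x| < 1] the [q]-th power of [1 - x^2 / 2] is at least its square, as [q <= 2], and the
    square is at least [1 - x^2]. *)
Lemma powR_sin_ge x : `|x| `^ q * (1 - x ^+ 2) <= `|sin x| `^ q.
Proof.
have /andP[q1 q2] := q12.
have [x1|x1] := leP 1 (x ^+ 2).
  by rewrite (@le_trans _ _ 0) ?powR_ge0// mulr_ge0_le0 ?powR_ge0// subr_le0.
have s0 : 0 < 1 - x ^+ 2 / 2 by nra.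
apply: (@le_trans _ _ ((`|x| * (1 - x ^+ 2 / 2)) `^ q)); last first.
  by rewrite ge0_ler_powR ?nnegrE ?mulr_ge0 ?(ltW s0) ?(ltW q0)// norm_sin_ge.
rewrite powRM ?(ltW s0)// ler_wpM2l ?powR_ge0//.
apply: (@le_trans _ _ ((1 - x ^+ 2 / 2) `^ 2%:R)); last first.
  rewrite ger_powR// s0/= gerBl divr_ge0// sqr_ge0//.
by rewrite powR_mulrn ?(ltW s0)//; have := sqr_ge0 x; nra.
Qed.

Lemma expRN_approx s : 0 <= s -> `|expR (- s) - (1 - s)| <= s ^+ 2.
Proof.
move=> s0; rewrite ger0_norm ?subr_ge0 ?expR_ge1Dx//.
have : expR (- s) <= (1 + s)^-1.
  by rewrite expRN lef_pV2 ?posrE ?expR_gt0 ?expR_ge1Dx// ltr_pwDl.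
have : (1 + s)^-1 <= 1 - s + s ^+ 2.
  rewrite -[leLHS]mul1r ler_pdivrMr ?ltr_pwDl//.
  have : 0 <= s ^+ 3 by exact: exprn_ge0.
  rewrite exprS expr2; nra.
lra.
Qed.

(** A limit theorem for stable laws. In each coordinate [phi M] is the characteristic function of a
    sum of [M + 1] independent steps, each with characteristic function about [1 - |sin|^q] at scale
    [t M]; compare [(1 - v / (M + 1))^(M + 1)] with [exp (- v)]. *)
Lemma stable_approx : exists phi : nat -> 'rV[R]_N -> R,
  [/\ forall M, pos_def (phi M), forall M, phi M 0 = 1,
      forall M b, 1 - phi M b <= sumpow q b &
      forall b, phi M b @[M --> \oo] --> expR (- sumpow q b)].
Proof.
have [c [c0 c1 ccvg cP]] := powR_series half_q.
have /andP[q1 q2] := q12.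
pose r n := 1 - \sum_(i < n) c i.
pose psi n s := \sum_(i < n) c i * (1 - (cos s ^+ 2) ^+ i.+1).
have psiP n s : psi n s <= `|sin s| `^ q <= psi n s + r n.
  rewrite -powR_sin; apply: cP; rewrite sqr_ge0/=.
  by rewrite -real_normK ?num_real// expr_le1// cos_max.
have psi0 n s : 0 <= psi n s.
  apply: sumr_ge0 => i _; rewrite mulr_ge0// subr_ge0.
  rewrite -real_normK ?num_real// -exprM expr_le1// cos_max//.
have psi1 n s : psi n s <= 1.
  have /andP[h _] := psiP n s; apply: (le_trans h).
  have <- : (1 : R) `^ q = 1 by rewrite powR1.
  by rewrite ge0_ler_powR ?nnegrE ?(ltW q0)// sin_max.
have psi_le n s : psi n s <= `|s| `^ q.
  have /andP[h _] := psiP n s; apply: (le_trans h).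
  by rewrite ge0_ler_powR ?nnegrE ?(ltW q0)// norm_sin_le.
(* The truncation error will be multiplied by the [M + 1] factors, hence the square. *)
have /choice[m mP] : forall M : nat, exists m, r m <= (M.+1%:R ^+ 2)^-1.
  move=> M; have /cvgrPdist_le/(_ (M.+1%:R ^+ 2)^-1) := ccvg.
  rewrite invr_gt0 exprn_gt0// => /(_ isT) [m _ /(_ m (leqnn m))] /= h.
  exists m; apply: le_trans h; rewrite sub0r normrN; exact: ler_norm.
(* The stable scaling: [M + 1] steps of size [t M] contribute [|b_k|^q] in total. *)
pose t (M : nat) : R := M.+1%:R `^ (- q^-1).
have t0 M : 0 <= t M by exact: powR_ge0.
have tq M : t M `^ q = M.+1%:R^-1.
  by rewrite /t -powRrM mulNr mulVf ?gt_eqF// powR_inv1.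
pose x M b k : R := b 0 k * t M.
have xq M b k : `|x M b k| `^ q = `|b 0 k| `^ q / M.+1%:R.
  by rewrite /x normrM powRM// (ger0_norm (t0 M)) tq.
pose phi M b := \prod_k (1 - psi (m M) (x M b k)) ^+ M.+1.
have f1 M b k : `|1 - psi (m M) (x M b k)| <= 1.
  by rewrite ger0_norm ?subr_ge0// gerBl.
exists phi; split.
- move=> M; apply: pos_def_prod => k; apply: pos_defX.
  (* All coefficients on the right are nonnegative, the remainder [r (m M)] included. *)
  have -> : (fun b => 1 - psi (m M) (x M b k)) = (fun b => r (m M) +
      \sum_(i < m M) c i * (cos (dot (t M *: delta_mx 0 k) b) ^+ 2) ^+ i.+1).
    apply/funext => b; rewrite /psi /r -addrA; congr (_ + _).
    rewrite -!sumrN -big_split; apply: eq_bigr => i _.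
    rewrite dotZl (_ : dot _ b = b 0 k) ?[t M * _]mulrC.
     rewrite -/(x M b k) /=.
     ring.
    rewrite /dot (bigD1 k)//= mxE !eqxx mul1r big1 ?addr0// => l lk.
    by rewrite mxE (negbTE lk) andbF mul0r.
  apply: pos_defD; first exact/pos_def_cst/c1.
  apply: pos_def_sum => i; apply: pos_defM; first exact/pos_def_cst/c0.
  by apply: pos_defX; apply: pos_defX; exact: pos_def_cos.
- move=> M; rewrite /phi big1// => k _.
  rewrite /x mxE mul0r /psi big1 ?subr0 ?expr1n// => i _.
  by rewrite cos0 !expr1n subrr mulr0.
- move=> M b; apply: le_trans (ler_norm _) _; rewrite distrC.
  have := @ler_norm_prodB R _ (index_enum 'I_N)
    (fun k => (1 - psi (m M) (x M b k)) ^+ M.+1) (fun=> 1).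
  rewrite [X in `|_ - X|]big1// => h; apply: le_trans (h _ _) _.
  + by move=> k; rewrite normrX exprn_ile1.
  + by move=> k; rewrite normr1.
  + apply: ler_sum => k _; have := @ler_norm_expB R M.+1 (1 - psi (m M) (x M b k)) 1.
    rewrite expr1n normr1 => /(_ (f1 M b k) (lexx _)) /le_trans; apply.
    rewrite distrC opprB addrC subrK ger0_norm//.
    rewrite mulrC -ler_pdivlMr// -xq; exact: psi_le.
- move=> b.
  (* The three terms pay for the second order of the exponential, for replacing [|sin x|^q] by
     [|x|^q], and for the truncation. *)
  pose C := \sum_k ((`|b 0 k| `^ q) ^+ 2 + `|b 0 k| `^ q * b 0 k ^+ 2 + 1).
  have expR1 M k : `|expR (- (`|b 0 k| `^ q / M.+1%:R))| <= 1.
    rewrite ger0_norm; last exact: expR_ge0.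
    by rewrite expR_le1 oppr_le0 divr_ge0// powR_ge0.
  have main M : `|phi M b - expR (- sumpow q b)| <= C / M.+1%:R.
    have -> : expR (- sumpow q b) = \prod_k expR (- (`|b 0 k| `^ q / M.+1%:R)) ^+ M.+1.
      rewrite /sumpow -sumrN expR_sum; apply: eq_bigr => k _.
      by rewrite -expRM_natl mulrN mulrCA divff// mulr1.
    apply: le_trans (ler_norm_prodB _ _ _) _.
    + by move=> k; rewrite normrX exprn_ile1.
    + by move=> k; rewrite normrX exprn_ile1.
    rewrite /C mulr_suml; apply: ler_sum => k _.
    apply: le_trans (ler_norm_expB _ _ _) _ => //.
    set v := `|b 0 k| `^ q.
    have v0 : 0 <= v by exact: powR_ge0.
    have := expRN_approx (divr_ge0 v0 (ler0n _ M.+1)).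
    have := psi_le (m M) (x M b k); rewrite xq -/v.
    have /andP[_] := psiP (m M) (x M b k).
    have := mP M; have := powR_sin_ge (x M b k); rewrite xq -/v.
    (* As [t M <= 1] and [q <= 2], the square is at most the [q]-th power. *)
    have tM : t M ^+ 2 <= M.+1%:R^-1.
      rewrite -tq -powR_mulrn// ger_powR//; apply/andP; split.
        exact: powR_gt0.
      by rewrite /t powRN invf_le1 ?powR_gt0// -[leLHS](powRr0 M.+1%:R)
        ler_powR ?ler1n// invr_ge0 ltW.
    have : x M b k ^+ 2 <= b 0 k ^+ 2 / M.+1%:R.
      by rewrite /x exprMn ler_wpM2l ?sqr_ge0.
    have M0 : M.+1%:R != 0 :> R by [].
    have xx0 := sqr_ge0 (x M b k).
    have -> : (v ^+ 2 + v * b 0 k ^+ 2 + 1) / M.+1%:R = M.+1%:R *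
        ((v / M.+1%:R) ^+ 2 + v / M.+1%:R * (b 0 k ^+ 2 / M.+1%:R) +
         (M.+1%:R ^+ 2)^-1) by field.
    have vM : 0 <= v / M.+1%:R by rewrite divr_ge0.
    move: (psi (m M) _) (`|sin (x M b k)| `^ q) (r (m M)) (expR _) => u sq rm ev.
    move=> xb sx rM sr su; rewrite ler_pM2l//.
    have rM0 : 0 <= (M.+1%:R ^+ 2)^-1 :> R by rewrite invr_ge0 exprn_ge0.
    have := ler_wpM2l vM xb; have := mulr_ge0 vM xx0.
    move: vM sx su rM0 rM; rewrite !ler_norml.
    move: (_ ^-1) (x M b k ^+ 2) (b 0 k ^+ 2 / _) (v / _) => mm xx d vv.
    move=> vM sx su rM0 rM h1 h2 /andP[ve1 ve2]; apply/andP; split; nra.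
  apply/cvgrPdist_le => e e0 /=.
  have h : (C / M.+1%:R) @[M --> \oo] --> 0.
    rewrite -(mulr0 C); apply: cvgM; [exact: cvg_cst|exact: cvg_harmonic].
  have /cvgrPdist_le/(_ e e0) := h.
  apply: filterS => M; rewrite sub0r normrN => hM.
  by rewrite distrC (le_trans (main M))// (le_trans (ler_norm _)).
Qed.

End stable_law.

Lemma near_seq (T : eqType) (U : Type) (F : set_system U) (s : seq T)
    (P : T -> U -> Prop) :
  Filter F -> (forall x, x \in s -> \forall u \near F, P x u) ->
  \forall u \near F, forall x, x \in s -> P x u.
Proof.
move=> FF; elim: s => [|x s IH] sP; first by apply: nearW => u y.
have h1 : \forall u \near F, P x u by apply: sP; rewrite mem_head.
have h2 : \forall u \near F, forall y, y \in s -> P y u.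
  by apply: IH => y ys; apply: sP; rewrite inE ys orbT.
apply: filterS2 h1 h2 => u Px Ps y; rewrite inE => /predU1P[->//|]; exact: Ps.
Qed.

Lemma cvg_sum (R : numFieldType) (V : normedModType R) (T I : Type)
    (F : set_system T) (r : seq I) (f : I -> T -> V) (l : I -> V) : Filter F ->
  (forall i, f i x @[x --> F] --> l i) ->
  \sum_(i <- r) f i x @[x --> F] --> \sum_(i <- r) l i.
Proof.
move=> FF fl; elim: r => [|i r IH].
  by under eq_fun do rewrite big_nil; rewrite big_nil; exact: cvg_cst.
by under eq_fun do rewrite big_cons; rewrite big_cons; exact: cvgD.
Qed.

(** * Normalized first moments of approximately stable laws *)

Section stable_zonoid.
Variables (R : realType) (q : R) (N : nat).
Hypothesis q12 : 1 < q <= 2.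
Implicit Types (b : 'rV[R]_N).

Let q1 : 1 < q. Proof. by case/andP: q12. Qed.

Let rho : R := 2 `^ (1 - q).

Let rho_lt1 : rho < 1.
Proof.
have qB : 0 < q - 1 by rewrite subr_gt0.
rewrite /rho -opprB powRN invf_lt1 ?powR_gt0//.
have := @gt0_ltr_powR _ _ qB 1 2; rewrite powR1; apply; rewrite ?nnegrE//.
by rewrite ltr1n.
Qed.

Variable c : nat -> R.
Hypothesis cP : forall n (z : R), 0 <= z <= 1 ->
  \sum_(i < n) c i * (1 - z ^+ i.+1) <= (1 - z) `^ 2^-1 <=
  \sum_(i < n) c i * (1 - z ^+ i.+1) + (1 - \sum_(i < n) c i).

(** Approximates the mean of [|sin (dot g b / 2^j)|] through [phi] alone: expand
    [|sin| = (1 - cos^2)^(1/2)] in even powers of the cosine and read the mean of each off [phi]. *)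
Definition sin_poly n j (phi : 'rV[R]_N -> R) b : R :=
  \sum_(i < n) c i * (1 - cos_avg (2 * i.+1) (fun s => phi ((s / 2 ^+ j) *: b)) 0).

(** The error bound is the same for all such [phi], and for fixed [n] and [j] the approximation uses
    finitely many values of [phi]; so it is compatible with pointwise limits. *)
Lemma pos_def_moment (phi : 'rV[R]_N -> R) : pos_def phi -> phi 0 = 1 ->
  (forall b, 1 - phi b <= sumpow q b) ->
  exists (I : finType) (g : I -> 'rV[R]_N),
    (forall b, (1 - phi (2 *: b)) / 2 <= \sum_i `|dot (g i) b|) /\
    forall n j b, `|\sum_i `|dot (g i) b| - 2 ^+ j * sin_poly n j phi b| <=
      2 ^+ j * (1 - \sum_(i < n) c i) + rho ^+ j / (1 - rho) * sumpow q b.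
Proof.
move=> [I [w [g [w0 ->]]]] phi1 phi_le.
have w1 : \sum_i w i = 1.
  by rewrite -phi1; apply: eq_bigr => i _; rewrite dot0r cos0 mulr1.
(* The masses are nonnegative and are absorbed into the atoms. *)
exists I, (fun i => w i *: g i).
have LE b : \sum_i `|dot (w i *: g i) b| = \sum_i w i * `|dot (g i) b|.
  by apply: eq_bigr => i _; rewrite dotZl normrM ger0_norm.
split=> [b|n j b]; rewrite LE.
  exact: moment_ge_phi w0 w1 _.
set D := sin_poly _ _ _ _.
set r := 1 - _.
pose S := \sum_i w i * `|sin (dot (g i) b / 2 ^+ j)|.
have DE : D = \sum_l w l * \sum_(i < n) c i *
    (1 - (cos (dot (g l) b / 2 ^+ j) ^+ 2) ^+ i.+1).
  rewrite /D /sin_poly.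
  under [RHS]eq_bigr do rewrite mulr_sumr.
  rewrite [RHS]exchange_big/=; apply: eq_bigr => i _.
  under eq_bigr do rewrite mulrCA.
  rewrite -mulr_sumr; congr (_ * _).
  under eq_bigr do rewrite mulrBr mulr1.
  rewrite sumrB w1; congr (_ - _).
  transitivity (cos_avg (2 * i.+1) (fun s => \sum_l w l * cos (s * (dot (g l) b / 2 ^+ j))) 0).
    apply: (congr1 (fun h => cos_avg (2 * i.+1) h 0)); apply/funext => s.
    apply: eq_bigr => l _.
    by rewrite dotZr mulrAC mulrA.
  rewrite -cos_avgE; apply: eq_bigr => l _.
  by rewrite mul0r cos0 mulr1 exprM.
have cs l : 0 <= cos (dot (g l) b / 2 ^+ j) ^+ 2 <= 1.
  by rewrite sqr_ge0/= -real_normK ?num_real// expr_le1// cos_max.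
have sinE l : `|sin (dot (g l) b / 2 ^+ j)| =
    (1 - cos (dot (g l) b / 2 ^+ j) ^+ 2) `^ 2^-1.
  by rewrite -[2^-1]mul1r powR_sin powRr1.
have DS : D <= S.
  rewrite DE /S; apply: ler_sum => l _; rewrite ler_wpM2l// sinE.
  by have /andP[] := cP n (cs l).
have SD : S <= D + r.
  have -> : r = \sum_l w l * r by rewrite -mulr_suml w1 mul1r.
  rewrite DE /S -big_split/=; apply: ler_sum => l _.
  by rewrite -mulrDr ler_wpM2l// sinE; have /andP[] := cP n (cs l).
have := moment_le q1 w0 w1 phi_le j b; rewrite -/rho -/S.
have := moment_ge g w0 j b; rewrite -/S.
have e0 : 0 <= 2 ^+ j :> R by rewrite exprn_ge0.
have := ler_wpM2l e0 DS; have := ler_wpM2l e0 SD.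
have : 0 <= rho ^+ j / (1 - rho) * sumpow q b.
  rewrite mulr_ge0 ?sumpow_ge0// divr_ge0 ?exprn_ge0 ?powR_ge0// subr_ge0.
  exact: ltW rho_lt1.
have : 0 <= 2 ^+ j * r by apply: mulr_ge0 => //; lra.
rewrite ler_norml => h1 h2 h3 h4 h5 h6; clearbody r D S.
by apply/andP; split; lra.
Qed.

End stable_zonoid.

(** The limit [exp (- sumpow q b)] depends on [b] only through [sumpow q b], so at all points of [s]
    the first moments are close to one common value [K]; dividing by [K] brings them close to 1. *)
Lemma stable_zonoid (R : realType) (q : R) (N : nat) (s : seq 'rV[R]_N) (e : R) :
  1 < q <= 2 -> 0 < e -> (forall b, b \in s -> sumpow q b = 1) ->
  exists (I : finType) (g : I -> 'rV[R]_N),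
    forall b, b \in s -> `|\sum_i `|dot (g i) b| - 1| <= e.
Proof.
move=> q12 e0 s1; have /andP[q1 q2] := q12.
have [s0|] := eqVneq s [::].
  by exists unit, (fun=> 0) => b; rewrite s0.
move=> sN; have [b0 b0s] : exists b, b \in s.
  by case: s sN {s1} => // b t _; exists b; rewrite mem_head.
have half01 : 0 < (2^-1 : R) <= 1 by rewrite invr_gt0// invf_le1// ler1n andbT.
have [c [c0 c1 ccvg cP]] := powR_series half01.
have [phi [phiP phi0 phi_le phi_cvg]] := stable_approx N q12.
have /choice[G GP] : forall M, exists G : {I : finType & I -> 'rV[R]_N},
    (forall b, (1 - phi M (2 *: b)) / 2 <= \sum_i `|dot (projT2 G i) b|) /\
    forall n j b, `|\sum_i `|dot (projT2 G i) b| - 2 ^+ j * sin_poly c n j (phi M) b| <=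
      2 ^+ j * (1 - \sum_(i < n) c i) +
      (2 `^ (1 - q)) ^+ j / (1 - 2 `^ (1 - q)) * sumpow q b.
  move=> M; have [I [g h]] := pos_def_moment q12 cP (phiP M) (phi0 M) (phi_le M).
  by exists (existT _ I g).
pose L M b := \sum_i `|dot (projT2 (G M) i) b|.
(* The limit of the lower bound [moment_ge_phi] where [sumpow q b = 1]. *)
pose kappa : R := (1 - expR (- 2 `^ q)) / 2.
have kappa0 : 0 < kappa.
  by rewrite /kappa divr_gt0// subr_gt0 expR_lt1 oppr_lt0 powR_gt0.
pose rho : R := 2 `^ (1 - q).
have rho0 : 0 <= rho by exact: powR_ge0.
have rho1 : rho < 1.
  have qB : 0 < q - 1 by rewrite subr_gt0.
  rewrite /rho -opprB powRN invf_lt1 ?powR_gt0//.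
  have := @gt0_ltr_powR _ _ qB 1 2; rewrite powR1; apply; rewrite ?nnegrE//.
  by rewrite ltr1n.
(* The moments will be within [3 d] of [K] and one of them at least [kappa / 2]. The first entry
   then gives [K >= kappa / 8], the second [3 d <= K e]. *)
pose d := Num.min (kappa / 8) (kappa * e / 24).
have d0 : 0 < d by rewrite lt_min !divr_gt0// mulr_gt0.
have [j jP] : exists j, rho ^+ j / (1 - rho) <= d.
  have : (rho ^+ j / (1 - rho)) @[j --> \oo] --> 0.
    rewrite -(mul0r (1 - rho)^-1); apply: cvgM; last exact: cvg_cst.
    by apply: cvg_expr; rewrite ger0_norm.
  move=> /cvgrPdist_le/(_ d d0)[j _ /(_ j (leqnn j))] /= h; exists j.
  by apply: le_trans h; rewrite sub0r normrN; exact: ler_norm.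
(* The order of choice matters: [2^j] amplifies the truncation error, so [j] is fixed before [n],
   and the measure [M] comes last. *)
have [n nP] : exists n, 2 ^+ j * (1 - \sum_(i < n) c i) <= d.
  have : (2 ^+ j * (1 - \sum_(i < n) c i)) @[n --> \oo] --> 0.
    by rewrite -[X in _ --> X](mulr0 (2 ^+ j)); apply: cvgM; [exact: cvg_cst|exact: ccvg].
  move=> /cvgrPdist_le/(_ d d0)[n _ /(_ n (leqnn n))] /= h; exists n.
  by apply: le_trans h; rewrite sub0r normrN; exact: ler_norm.
pose K := 2 ^+ j * \sum_(i < n) c i *
  (1 - cos_avg (2 * i.+1) (fun s => expR (- `|s / 2 ^+ j| `^ q)) 0).
have near1 b : b \in s -> \forall M \near \oo, `|L M b - K| <= 3 * d.
  move=> bs; have sb := s1 _ bs.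
  have : 2 ^+ j * sin_poly c n j (phi M) b @[M --> \oo] --> K.
    apply: cvgM; first exact: cvg_cst.
    apply: (@cvg_sum R R nat 'I_n \oo (index_enum 'I_n) (fun i M => c i *
      (1 - cos_avg (2 * i.+1) (fun s => phi M ((s / 2 ^+ j) *: b)) 0))) => i.
    apply: cvgM; first exact: cvg_cst.
    apply: cvgB; first exact: cvg_cst.
    apply: cvg_cos_avg => t.
    have := phi_cvg ((t / 2 ^+ j) *: b).
    by rewrite sumpowZ sb mulr1.
  move=> /cvgrPdist_le/(_ d d0); apply: filterS => M h.
  have [_ /(_ n j b)] := GP M; rewrite sb mulr1 -/rho -/(L M b) => h2.
  have -> : L M b - K = (L M b - 2 ^+ j * sin_poly c n j (phi M) b) -
     (K - 2 ^+ j * sin_poly c n j (phi M) b) by ring.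
  by rewrite (le_trans (ler_normB _ _))//; lra.
have near2 : \forall M \near \oo, kappa / 2 <= L M b0.
  have : (1 - phi M (2 *: b0)) / 2 @[M --> \oo] --> kappa.
    apply: cvgM; last exact: cvg_cst.
    apply: cvgB; first exact: cvg_cst.
    have := phi_cvg (2 *: b0).
    by rewrite sumpowZ (s1 _ b0s) mulr1 ger0_norm.
  move=> /cvgrPdist_le/(_ (kappa / 2)); rewrite divr_gt0// => /(_ isT).
  apply: filterS => M; rewrite ler_norml => /andP[_ h].
  have [/(_ b0) h2 _] := GP M; apply: le_trans h2.
  lra.
have near3 : \forall M \near \oo, forall b, b \in s -> `|L M b - K| <= 3 * d.
  by apply: near_seq => b bs; exact: near1.
have [M _ /(_ M (leqnn M))/= [M1 M2]] := filterI near3 near2.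
have dk : d <= kappa / 8 by rewrite ge_min lexx.
have dke : d <= kappa * e / 24 by rewrite ge_min lexx orbT.
have K4 : kappa / 8 <= K.
  by have := M1 _ b0s; rewrite ler_norml => /andP[_ h]; lra.
have K0 : 0 < K by apply: lt_le_trans K4; rewrite divr_gt0.
exists (projT1 (G M)), (fun i => K^-1 *: projT2 (G M) i) => b bs.
have -> : \sum_i `|dot (K^-1 *: projT2 (G M) i) b| = K^-1 * L M b.
  rewrite mulr_sumr; apply: eq_bigr => i _.
  by rewrite dotZl normrM ger0_norm// invr_ge0 ltW.
have -> : K^-1 * L M b - 1 = K^-1 * (L M b - K).
  by rewrite mulrBr mulVf// gt_eqF.
rewrite normrM ger0_norm ?invr_ge0 ?(ltW K0)// ler_pdivrMl//.
apply: le_trans (M1 _ bs) _.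
by have := ler_wpM2r (ltW e0) K4; lra.
Qed.

(** * The criterion for octahedrality *)

Section finite_net.
Variables (R : realType) (W : normedModType R).

Definition lincomb n (e : 'I_n -> W) (c : 'rV[R]_n) : W := \sum_i c 0 i *: e i.

Lemma lincombZ n (e : 'I_n -> W) a c : lincomb e (a *: c) = a *: lincomb e c.
Proof.
by rewrite /lincomb scaler_sumr; apply: eq_bigr => i _; rewrite mxE scalerA.
Qed.

Lemma lincombB n (e : 'I_n -> W) c d : lincomb e (c - d) = lincomb e c - lincomb e d.
Proof.
by rewrite /lincomb -sumrB; apply: eq_bigr => i _; rewrite !mxE scalerBl.
Qed.

Lemma lincomb_continuous n (e : 'I_n -> W) : continuous (lincomb e).
Proof.
move=> c; rewrite /lincomb.
apply: (@cvg_sum _ W _ _ (nbhs c) (index_enum 'I_n) (fun i c => c 0 i *: e i)) => i.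
apply: cvgZ; last exact: cvg_cst.
exact: coord_continuous.
Qed.

Lemma coord_le_norm n (c : 'rV[R]_n) i : `|c 0 i| <= `|c|.
Proof.
rewrite [leRHS]mx_normrE; exact: (le_bigmax _ (fun i : 'I_1 * 'I_n => `|c i.1 i.2|) (0, i)).
Qed.

(** If the vectors are dependent, one is dropped and induction applies. Otherwise the norm of the
    combination has a positive minimum on the compact unit sphere of coefficients. *)
Lemma lincomb_coef n (e : 'I_n -> W) : exists2 C : R, 0 <= C &
  forall c : 'rV[R]_n, exists2 c' : 'rV[R]_n, lincomb e c' = lincomb e c &
    forall i, `|c' 0 i| <= C * `|lincomb e c|.
Proof.
elim: n e => [|n IH] e; first by exists 0 => // c; exists c => // -[].
have [[d [d0 ed]]|indep] := pselect (exists d : 'rV[R]_n.+1, d != 0 /\ lincomb e d = 0).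
  have [i0 di0] : exists i, d 0 i != 0.
    apply: contrapT => nd; case/negP: d0; apply/eqP/rowP => i; rewrite mxE.
    by apply: contrapT => /eqP di; apply: nd; exists i.
  have [C C0 CP] := IH (e \o lift i0); exists C => // c.
  pose c1 := c - (c 0 i0 / d 0 i0) *: d.
  have ec1 : lincomb e c1 = lincomb e c by rewrite lincombB lincombZ ed scaler0 subr0.
  have c10 : c1 0 i0 = 0 by rewrite !mxE divfK// subrr.
  have [c2 ec2 c2C] := CP (\row_j c1 0 (lift i0 j)).
  have e12 : lincomb (e \o lift i0) (\row_j c1 0 (lift i0 j)) = lincomb e c.
    rewrite -ec1 /lincomb (bigD1_ord i0)//= c10 scale0r add0r.
    by apply: eq_bigr => j _; rewrite mxE.
  exists (\row_i if unlift i0 i is Some j then c2 0 j else 0).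
    rewrite -e12 -ec2 {1}/lincomb (bigD1_ord i0)//= mxE unlift_none scale0r add0r.
    by apply: eq_bigr => j _; rewrite mxE liftK.
  move=> i; rewrite mxE; case: unliftP => [j _|_]; first by rewrite -e12.
  by rewrite normr0 mulr_ge0.
pose A := [set c : 'rV[R]_n.+1 | `|c| = 1].
have An : A !=set0.
  exists (const_mx 1); rewrite /A/= [LHS]mx_normrE.
  apply/eqP; rewrite eq_le; apply/andP; split.
    by apply/bigmax_leP; split => // i _; rewrite mxE normr1.
  apply: le_trans (le_bigmax _ _ (0, ord0)) => /=.
  by rewrite mxE normr1.
have cA : compact A.
  apply: bounded_closed_compact.
    by exists 1; split => // M M1 c; rewrite /A/= => ->; exact: ltW.
  have -> : A = (fun c : 'rV[R]_n.+1 => `|c|) @^-1` [set x | x = 1] by [].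
  by apply: preimage_closed; [move=> x _; exact: norm_continuous|exact: closed_eq].
have ce : {within A, continuous (fun c => `|lincomb e c|)}.
  apply: continuous_subspaceT => c; apply: (continuous_comp (@lincomb_continuous _ e c)).
  exact: norm_continuous.
have [c0] := EVT_min_rV An cA ce; rewrite inE => c0A c0min.
set m := `|lincomb e c0| in c0min.
have m0 : 0 < m.
  rewrite /m normr_gt0; apply/eqP => ec0; apply: indep; exists c0; split => //.
  by apply/eqP => c00; move: c0A; rewrite /A/= c00 normr0 => /eqP; rewrite eq_sym oner_eq0.
exists m^-1 => [|c]; first by rewrite invr_ge0 ltW.
exists c => // i.
have [->|cn0] := eqVneq c 0; first by rewrite mxE normr0 mulr_ge0// invr_ge0 ltW.
apply: le_trans (coord_le_norm c i) _; rewrite ler_pdivlMl//.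
have cgt0 : 0 < `|c| by rewrite normr_gt0.
have := c0min (`|c|^-1 *: c); rewrite inE /A/= normrZ normfV normr_id mulVf ?gt_eqF//.
move=> /(_ erefl); rewrite lincombZ normrZ normfV normr_id ler_pdivlMl//.
by rewrite mulrC.
Qed.

Lemma finite_net (E : set W) (r eps : R) : finite_dimensional E -> 0 < eps ->
  exists2 s : seq W, (forall x, x \in s -> E x) &
    forall x, E x -> `|x| <= r -> exists2 y, y \in s & `|x - y| <= eps.
Proof.
move=> [s0 ->] eps0.
pose n := size s0; pose e (i : 'I_n) := s0`_i.
have se i : lin_span [set` s0] (e i).
  exists 1%N, (fun=> 1), (fun=> e i); split; first by move=> _ /=; exact: mem_nth.
  by rewrite big_ord1 scale1r.
have spanP c : lin_span [set` s0] (lincomb e c).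
  by exists n, (fun i => c 0 i), e; split => // i /=; exact: mem_nth.
have spanE x : lin_span [set` s0] x -> exists c, x = lincomb e c.
  move=> [m [c [f [fs ->]]]].
  (* A combination may repeat vectors of [s0]; coefficients are grouped by first position. *)
  exists (\row_i \sum_(j < m | index (f j) s0 == i) c j).
  rewrite /lincomb; under [RHS]eq_bigr do rewrite mxE scaler_suml.
  rewrite (exchange_big_dep xpredT)//=; apply: eq_bigr => j _.
  have fj : (index (f j) s0 < n)%N by rewrite index_mem; exact: fs.
  rewrite (big_pred1 (Ordinal fj))/=; last by move=> i; rewrite eq_sym.
  by rewrite /e/= nth_index//; exact: fs.
have [C C0 CP] := lincomb_coef e.
pose B := C * `|r|.
have B0 : 0 <= B by rewrite mulr_ge0.
pose K := (\sum_i `|e i|).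
have K0 : 0 <= K by apply: sumr_ge0 => i _.
(* The grid has mesh [1 / m] in each coefficient, which costs at most [K / m <= eps] in norm. *)
pose m : nat := (Num.trunc (K / eps)).+1.
have m0 : 0 < m%:R :> R by rewrite ltr0n.
have Km : K / m%:R <= eps.
  rewrite ler_pdivrMr// -ler_pdivrMl// mulrC ltW//.
  by have /andP[] := truncn_itv (divr_ge0 K0 (ltW eps0)).
pose T : nat := (Num.trunc (2 * B * m%:R)).+1.
pose pt (k : {ffun 'I_n -> 'I_T}) : W := lincomb e (\row_i ((k i)%:R / m%:R - B)).
exists [seq pt k | k : {ffun 'I_n -> 'I_T}].
  by move=> x /mapP[k _ ->]; exact: spanP.
move=> x /spanE[c0 ->]; have [c <- cC] := CP c0 => xr.
have cB i : - B <= c 0 i <= B.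
  rewrite -ler_norml (le_trans (cC i))// /B ler_wpM2l//.
  by rewrite (le_trans xr)// ler_norm.
have z0 i : 0 <= (c 0 i + B) * m%:R.
  by rewrite mulr_ge0// -lerBlDr sub0r; have /andP[] := cB i.
pose kn (i : 'I_n) : nat := Num.trunc ((c 0 i + B) * m%:R).
have kP i : (kn i < T)%N.
  rewrite ltnS; apply: le_truncn; rewrite ler_wpM2r//.
  by have /andP[_] := cB i; lra.
pose k : {ffun 'I_n -> 'I_T} := [ffun i => Ordinal (kP i)].
exists (pt k); first by apply: map_f; rewrite mem_enum.
rewrite /pt -lincombB; apply: le_trans Km.
rewrite /lincomb /K mulr_suml (le_trans (ler_norm_sum _ _ _))//.
apply: ler_sum => i _; rewrite normrZ mulrC ler_wpM2l// !mxE ffunE/=.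
have /andP[h1 h2] := truncn_itv (z0 i).
rewrite ler_norml; apply/andP; split.
  rewrite (@le_trans _ _ 0) ?oppr_le0 ?invr_ge0// subr_ge0 lerBlDr.
  by rewrite ler_pdivrMr.
have : c 0 i + B <= ((kn i)%:R + 1) / m%:R.
  by rewrite ler_pdivlMr// natr1 ltW.
by rewrite mulrDl mul1r; lra.
Qed.

End finite_net.

(** The copy of l_1 is exactly isometric and the additive error is independent of [a], so one [h]
    serves all scalars [lambda] of octahedrality at once. *)
Definition l1_far (R : realType) (X : normedModType R) : Prop :=
  forall (s : seq X) (J : finType) (eps : R), 0 < eps ->
  exists h : J -> X, forall a : J -> R,
    `|\sum_j a j *: h j| = \sum_j `|a j| /\
    forall x, x \in s -> `|x| + \sum_j `|a j| - eps <= `|x + \sum_j a j *: h j|.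

Section octahedral_criterion.
Variables (R : realType) (Z X : normedModType R).
Implicit Types (S T U : 'L(Z, X)) (z : Z).

Lemma bounded_operator_sumE (J : Type) (r : seq J) (T : J -> 'L(Z, X)) z :
  (\sum_(j <- r) T j) z = \sum_(j <- r) T j z.
Proof. exact: (big_morph (fun T : 'L(Z, X) => T z)). Qed.

Lemma operator_eval_le T z : `|z| <= 1 -> `|T z| <= `|T|.
Proof.
move=> z1; apply: le_trans (ler_operator_norm T z) _.
by rewrite ler_piMr// operator_norm_ge0.
Qed.

Lemma lin_spanZ (A : set 'L(Z, X)) a T : lin_span A T -> lin_span A (a *: T).
Proof.
move=> [n [c [e [eA ->]]]]; exists n, (fun i => a * c i), e; split => //.
by rewrite scaler_sumr; apply: eq_bigr => i _; rewrite scalerA.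
Qed.

Variables (H : set 'L(Z, X)) (Phi : set (Z -> R)).
Hypothesis Hsub : closed_subspace H.
Hypothesis Xfar : l1_far X.
Hypothesis tensH : forall phi x, Phi phi ->
  exists2 T, H T & forall z, T z = phi z *: x.

Lemma subspace_sum (J : Type) (r : seq J) (T : J -> 'L(Z, X)) :
  (forall j, H (T j)) -> H (\sum_(j <- r) T j).
Proof.
have [[H0 HD] _] := Hsub; move=> HT.
elim/big_ind: _ => [|S T' HS HT'|j _]; last exact: HT.
  by move: H0; rewrite inE.
have := HD 1 S T'; rewrite !inE scale1r; exact.
Qed.

Lemma subspaceZ a T : H T -> H (a *: T).
Proof.
have [[H0 HD] _] := Hsub; move=> HT.
by have := HD a T 0; rewrite !inE addr0; apply => //; rewrite inE in H0.
Qed.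

(* The finite set [s] of operators is nearly normed at points that the
   functionals [phi j] map isometrically, up to [eps], into l_1. *)
Definition nearly_norming : Prop :=
  forall (s : seq 'L(Z, X)) (eps : R), 0 < eps ->
  exists (b : 'L(Z, X) -> Z) (J : finType) (phi : J -> Z -> R),
    [/\ forall j, Phi (phi j), forall z, \sum_j `|phi j z| <= `|z| &
      forall T, T \in s -> [/\ `|b T| <= 1, `|T| - eps <= `|T (b T)| &
        1 - eps <= \sum_j `|phi j (b T)|]].

(** The operator [y0] maps into the copy of l_1 spanned by [h]. At [b T] the vectors [T (b T)] and
    [y0 (b T)] have norms close to [|T|] and 1 and nearly add up. This gives the estimate on a net,
    then on the unit sphere of [E], then on [E] by homogeneity. *)
Lemma nearly_norming_octahedral : nearly_norming -> octahedral H.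
Proof.
move=> norming E eps Efin EH eps0.
(* Four errors of size [e] add up: two at net points and two from passing to the net. The cap [1/8]
   keeps [1 - 4 e] positive. *)
pose e := Num.min (eps / 4) 8^-1.
have e0 : 0 < e by rewrite lt_min; apply/andP; split; lra.
have e4 : e <= eps / 4 by rewrite ge_min lexx.
have e8 : e <= 8^-1 by rewrite ge_min lexx orbT.
have [s sE snet] := finite_net 1 Efin e0.
(* The operator 0 is included in order to bound [|y0|] from below. *)
have [b [J [phi [phiP phi1 bP]]]] := norming (0 :: s) e e0.
have [h hP] := Xfar [seq (T : 'L(Z, X)) (b T) | T <- 0 :: s] J e0.
have /choice[A AP] : forall j, exists T, H T /\ forall z, T z = phi j z *: h j.
  by move=> j; have [T HT Tz] := tensH (h j) (phiP j); exists T.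
pose y0 := \sum_j A j.
have y0E z : y0 z = \sum_j phi j z *: h j.
  by rewrite /y0 bounded_operator_sumE; apply: eq_bigr => j _; rewrite (AP j).2.
have Hy0 : H y0 by apply: subspace_sum => j; exact: (AP j).1.
have y0_le1 : `|y0| <= 1.
  rewrite bounded_operator_normE; apply: operator_norm_le => z z1; rewrite y0E (hP _).1.
  exact: le_trans (phi1 z) z1.
have netP T l : T \in 0 :: s -> `|T| - 2 * e + `|l| * (1 - e) <= `|T + l *: y0|.
  move=> Ts; have [b1 Tb phib] := bP _ Ts.
  apply: le_trans (operator_eval_le (T + l *: y0) b1).
  have -> : (T + l *: y0) (b T) = T (b T) + \sum_j (l * phi j (b T)) *: h j.
    rewrite [LHS]/(T (b T) + l *: y0 (b T)) y0E scaler_sumr; congr (_ + _).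
    by apply: eq_bigr => j _; rewrite scalerA.
  apply: le_trans ((hP _).2 _ _); last by apply/mapP; exists T.
  have -> : \sum_j `|l * phi j (b T)| = `|l| * \sum_j `|phi j (b T)|.
    by rewrite mulr_sumr; apply: eq_bigr => j _; rewrite normrM.
  have := ler_wpM2l (normr_ge0 l) phib; lra.
have y0_ge : 1 - 3 * e <= `|y0|.
  have := netP 0 1 (mem_head _ _); rewrite normr0 normr1 !add0r scale1r; lra.
have y0_gt0 : 0 < `|y0| by lra.
have unitP U l : E U -> `|U| = 1 -> (1 - 4 * e) * (1 + `|l|) <= `|U + l *: y0|.
  move=> EU U1; have [|T Ts UT] := snet U EU; first by rewrite U1.
  have := netP T l; rewrite inE Ts orbT => /(_ isT).
  have : `|T + l *: y0| <= `|U + l *: y0| + `|U - T|.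
    have -> : T + l *: y0 = (U + l *: y0) - (U - T).
      by rewrite opprB addrCA addrAC subrr add0r.
    exact: ler_normB.
  have : `|U| <= `|T| + `|U - T|.
    by rewrite -{1}(subrK T U) addrC ler_normD.
  have := mulr_ge0 (ltW e0) (normr_ge0 l).
  rewrite U1; lra.
have allP U l : E U -> (1 - 4 * e) * (`|U| + `|l|) <= `|U + l *: y0|.
  move=> EU; have [->|U0] := eqVneq U 0.
    rewrite normr0 !add0r normrZ mulrC ler_wpM2l//; lra.
  have nU : 0 < `|U| by rewrite normr_gt0.
  have EU1 : E (`|U|^-1 *: U).
    by move: Efin EU => [s0 ->]; exact: lin_spanZ.
  have U1 : `|(`|U|^-1 *: U)| = 1.
    by rewrite normrZ normfV normr_id mulVf// gt_eqF.
  have := unitP _ (`|U|^-1 * l) EU1 U1.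
  have -> : `|U|^-1 *: U + (`|U|^-1 * l) *: y0 = `|U|^-1 *: (U + l *: y0).
    by rewrite scalerDr scalerA.
  have iU : 0 < `|U|^-1 by rewrite invr_gt0.
  rewrite normrM normrZ (ger0_norm (ltW iU)).
  have -> : (1 - 4 * e) * (1 + `|U|^-1 * `|l|) =
      `|U|^-1 * ((1 - 4 * e) * (`|U| + `|l|)).
    by rewrite [RHS]mulrCA; congr (_ * _); rewrite mulrDr mulVf// gt_eqF.
  by rewrite ler_pM2l.
exists (`|y0|^-1 *: y0); split.
- exact: subspaceZ.
- by rewrite normrZ normfV normr_id mulVf// gt_eqF.
(* Normalizing replaces [l] by [l / |y0|], whose modulus is no smaller because [|y0| <= 1]. *)
- move=> U l EU; rewrite scalerA; apply: le_trans (allP U (l * `|y0|^-1) EU).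
  rewrite normrM normfV normr_id.
  apply: (@le_trans _ _ ((1 - 4 * e) * (`|U| + `|l|))).
    by rewrite ler_wpM2r ?addr_ge0//; lra.
  rewrite ler_wpM2l//; first lra.
  by rewrite lerD2l ler_peMr// invf_ge1.
Qed.

End octahedral_criterion.

(** * L_1 and l_1 *)

Section L1_like.
Context d (T : measurableType d) (R : realType).
Variable mu : {measure set T -> \bar R}.
Implicit Types (u v : T -> R) (A : set T).

Local Notation intg u := (mu.-integrable setT (EFin \o u)).
Local Notation Rint u := (\int[mu]_t u t).

Lemma intgD u v : intg u -> intg v -> intg (fun t => u t + v t).
Proof. by move=> iu iv; have := integrableD measurableT iu iv. Qed.

Lemma intgB u v : intg u -> intg v -> intg (fun t => u t - v t).
Proof. by move=> iu iv; have := integrableB measurableT iu iv. Qed.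

Lemma intgZ a u : intg u -> intg (fun t => a * u t).
Proof. by move=> iu; have := integrableZl measurableT a iu. Qed.

Lemma intg_norm u : intg u -> intg (fun t => `|u t|).
Proof. by move=> iu; have := integrable_norm iu. Qed.

Lemma intg_sum (I : Type) (r : seq I) (u : I -> T -> R) :
  (forall i, intg (u i)) -> intg (fun t => \sum_(i <- r) u i t).
Proof.
move=> iu; have := integrable_sum measurableT r (fun i (_ : xpredT i) => iu i).
apply: eq_integrable => // t _ /=; by rewrite sumEFin.
Qed.

Lemma intgM1 u A : measurable A -> intg u -> intg (fun t => u t * \1_A t).
Proof.
move=> mA iu; have := @integrableMl _ _ _ mu setT measurableT _ (\1_A) iu.
apply.
  exact: measurable_indic.
exists 1; split => // x x1 t _ /=; rewrite indicE.
by case: (t \in A); rewrite ?normr1 ?normr0; exact/ltW/(le_lt_trans _ x1).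
Qed.

Lemma Rint_sum (I : Type) (r : seq I) (u : I -> T -> R) : (forall i, intg (u i)) ->
  Rint (fun t => \sum_(i <- r) u i t) = \sum_(i <- r) Rint (u i).
Proof.
move=> iu; elim: r => [|i r IH].
  under eq_Rintegral do rewrite big_nil; rewrite big_nil.
  by rewrite Rintegral_cst// mul0r.
under eq_Rintegral do rewrite big_cons; rewrite big_cons RintegralD//.
  by rewrite IH.
exact: intg_sum.
Qed.

Lemma intg_indic A : measurable A -> (mu A < +oo)%E -> intg (\1_A : T -> R).
Proof.
move=> mA Aoo; apply/integrableP; split; first exact/measurable_EFinP/measurable_indic.
under eq_integral do rewrite /= ger0_norm//.
by rewrite integral_indic// setIT.
Qed.

Variables (X : normedModType R) (rep : X -> T -> R).
Hypothesis rep_intg : forall x, intg (rep x).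
Hypothesis rep_norm : forall x, `|x| = Rint (fun t => `|rep x t|).
Hypothesis rep_lin : forall a x y,
  \forall t \ae mu, rep (a *: x + y) t = a * rep x t + rep y t.
Hypothesis rep_surj : forall u, intg u -> exists x, \forall t \ae mu, rep x t = u t.

Lemma rep0 : \forall t \ae mu, rep 0 t = 0.
Proof.
have := rep_lin 1 0 0; rewrite scale1r addr0; apply: filterS => t.
by rewrite mul1r => /eqP; rewrite -subr_eq0 opprD addrA subrr sub0r oppr_eq0 => /eqP.
Qed.

Lemma rep_sum (I : Type) (r : seq I) (c : I -> R) (x : I -> X) y :
  \forall t \ae mu, rep (y + \sum_(i <- r) c i *: x i) t =
    rep y t + \sum_(i <- r) c i * rep (x i) t.
Proof.
elim: r => [|i r IH].
  by apply: filterE => t; rewrite !big_nil !addr0.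
have := rep_lin (c i) (x i) (y + \sum_(i <- r) c i *: x i).
apply: filterS2 IH => t IH; rewrite !big_cons addrCA => ->.
by rewrite IH addrCA.
Qed.

Lemma eq_ae_Rint_norm u v : intg u -> intg v -> (\forall t \ae mu, u t = v t) ->
  Rint (fun t => `|u t|) = Rint (fun t => `|v t|).
Proof.
move=> iu iv uv; congr fine; apply: ae_eq_integral => //.
- by have /integrableP[] := intg_norm iu.
- by have /integrableP[] := intg_norm iv.
- by apply: filterS uv => t /= -> _.
Qed.

Lemma rep_norm_sum (I : Type) (r : seq I) (c : I -> R) (x : I -> X) y :
  `|y + \sum_(i <- r) c i *: x i| =
  Rint (fun t => `|rep y t + \sum_(i <- r) c i * rep (x i) t|).
Proof.
rewrite rep_norm; apply: eq_ae_Rint_norm => //; last exact: rep_sum.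
by apply: intgD => //; apply: intg_sum => i; exact: intgZ.
Qed.

(** The scalar inequality is applied at each point to the values of the representatives and
    integrated. Representatives are linear only almost everywhere, even [rep 0]. *)
Lemma L1_norm_inequality (I : finType) (n : nat) (al : I -> R) (c : I -> 'I_n -> R) :
  (forall g : 'I_n -> R, \sum_i al i * `|\sum_k c i k * g k| <= 0) ->
  forall x : 'I_n -> X, \sum_i al i * `|\sum_k c i k *: x k| <= 0.
Proof.
move=> ineq x.
have iu i : intg (fun t => rep 0 t + \sum_k c i k * rep (x k) t).
  by apply: intgD => //; apply: intg_sum => k; exact: intgZ.
have iv i : intg (fun t => \sum_k c i k * rep (x k) t).
  by apply: intg_sum => k; exact: intgZ.
have -> : \sum_i al i * `|\sum_k c i k *: x k| =
    Rint (fun t => \sum_i al i * `|\sum_k c i k * rep (x k) t|).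
  rewrite Rint_sum; last by move=> i; apply: intgZ; exact: intg_norm.
  apply: eq_bigr => i _; rewrite RintegralZl//; last exact: intg_norm.
  congr (_ * _); rewrite -[X in `|X|]add0r rep_norm_sum.
  apply: eq_ae_Rint_norm => //.
  by apply: filterS rep0 => t ->; rewrite add0r.
rewrite -[leRHS](mul0r (fine (mu setT))) -Rintegral_cst//.
apply: le_Rintegral => //.
- by apply: intg_sum => i; apply: intgZ; exact: intg_norm.
- exact: integrable0.
Qed.

Variable A : nat -> set T.
Hypothesis mA : forall k, measurable (A k).
Hypothesis muA : forall k, (0 < mu (A k) < +oo)%E.
Hypothesis tA : trivIset setT A.

Lemma disjoint_indic (J : finType) (f : J -> nat) (v : J -> R) j t :
  injective f -> A (f j) t -> \sum_i v i * \1_(A (f i)) t = v j.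
Proof.
move=> finj At; rewrite (bigD1 j)//= indicE mem_set// mulr1 big1 ?addr0// => i ij.
rewrite indicE memNset ?mulr0// => Ai; move/eqP: ij; apply; apply: finj.
by apply: (tA I I); exists t.
Qed.

(** Normalized indicators of disjoint sets span l_1 isometrically. The integrals of [|x|] over the
    [A k] have bounded partial sums, so they tend to 0, and far out in the sequence the vectors of
    [s] have almost no mass. *)
Lemma L1_like_far : l1_far X.
Proof.
move=> s J eps eps0.
pose f (K : nat) (j : J) : nat := (K + enum_rank j)%N.
have finj K : injective (f K).
  by move=> i j /addnI/ord_inj/enum_rank_inj.
(* The 2 matches the factor lost in the pointwise bound; the successor covers an empty [J]. *)
pose delta := eps / (2 * #|J|.+1%:R).
have delta0 : 0 < delta by rewrite divr_gt0// mulr_gt0.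
have small x : \forall k \near \oo,
    Rint (fun t => `|rep x t| * \1_(A k) t) <= delta.
  have h : Rint (fun t => `|rep x t| * \1_(A k) t) @[k --> \oo] --> 0.
    apply: cvg_series_cvg_0; apply: nondecreasing_is_cvgn.
      apply: nondecreasing_series => k _ _; apply: Rintegral_ge0 => t _.
      by rewrite mulr_ge0.
    exists `|x| => _ [n _ <-]; rewrite /series/= -Rint_sum; last first.
      by move=> k; apply: intgM1 => //; exact: intg_norm.
    rewrite rep_norm; apply: le_Rintegral => //.
    - by apply: intg_sum => k; apply: intgM1 => //; exact: intg_norm.
    - exact: intg_norm.
    move=> t _; rewrite big_mkord -mulr_sumr ler_piMr//.
    have [[j Aj]|nA] := pselect (exists j : 'I_n, A j t).
      have := @disjoint_indic 'I_n (@nat_of_ord n) (fun=> 1) j t (@ord_inj n) Aj.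
      by under eq_bigr do rewrite mul1r; move=> ->.
    rewrite big1// => i _; rewrite indicE memNset// => Ai; apply: nA; by exists i.
  have /cvgrPdist_le/(_ _ delta0) := h; apply: filterS => k.
  by rewrite sub0r normrN; apply: le_trans; exact: ler_norm.
have [K _ Kp] : \forall k \near \oo, forall x, x \in s ->
    Rint (fun t => `|rep x t| * \1_(A k) t) <= delta.
  by apply: near_seq => x xs; exact: small.
pose m j := fine (mu (A (f K j))).
have m0 j : 0 < m j.
  by rewrite /m fine_gt0.
pose u j t := (m j)^-1 * \1_(A (f K j)) t.
have iu j : intg (u j).
  by apply: intgZ; apply: intg_indic => //; have /andP[] := muA (f K j).
have u0 j t : 0 <= u j t by rewrite mulr_ge0// invr_ge0 ltW.
have uint j : Rint (u j) = 1.
  rewrite RintegralZl//; last by apply: intg_indic => //; have /andP[] := muA (f K j).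
  by rewrite /Rintegral integral_indic// setIT mulVf// gt_eqF.
have /choice[h hP] : forall j, exists x, \forall t \ae mu, rep x t = u j t.
  by move=> j; exact: rep_surj.
exists h => a.
have aeh : \forall t \ae mu, forall j, rep (h j) t = u j t.
  have : \forall t \ae mu, forall j, j \in enum J -> rep (h j) t = u j t.
    by apply: near_seq => j _; exact: hP.
  by apply: filterS => t ht j; apply: ht; rewrite mem_enum.
have ah x : `|x + \sum_j a j *: h j| = Rint (fun t => `|rep x t + \sum_j a j * u j t|).
  rewrite rep_norm_sum; apply: eq_ae_Rint_norm.
  - by apply: intgD => //; apply: intg_sum => j; exact: intgZ.
  - by apply: intgD => //; apply: intg_sum => j; exact: intgZ.
  - by apply: filterS aeh => t ht; congr (_ + _); apply: eq_bigr => j _; rewrite ht.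
have ia : intg (fun t => \sum_j `|a j| * u j t).
  by apply: intg_sum => j; exact: intgZ.
have Ra : Rint (fun t => \sum_j `|a j| * u j t) = \sum_j `|a j|.
  rewrite Rint_sum; last by move=> j; exact: intgZ.
  by apply: eq_bigr => j _; rewrite RintegralZl// uint mulr1.
have uE (v : J -> R) j t : A (f K j) t -> \sum_i v i * u i t = v j * (m j)^-1.
  move=> At; under eq_bigr do rewrite /u mulrA.
  exact: (disjoint_indic (fun i => v i * (m i)^-1) (finj K) At).
have uN (v : J -> R) t : ~ (exists j, A (f K j) t) -> \sum_i v i * u i t = 0.
  move=> nA; rewrite big1// => i _.
  by rewrite /u indicE memNset ?mulr0// => Ai; apply: nA; exists i.
split.
  rewrite -[X in `|X|]add0r ah -Ra.
  rewrite (@eq_ae_Rint_norm _ (fun t => \sum_j a j * u j t)).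
  - apply: eq_Rintegral => t _.
    have [[j Aj]|nA] := pselect (exists j, A (f K j) t).
      by rewrite !(uE _ j)// normrM (@ger0_norm _ (m j)^-1) ?invr_ge0 ?ltW.
    by rewrite !uN ?normr0.
  - by apply: intgD => //; apply: intg_sum => j; exact: intgZ.
  - by apply: intg_sum => j; exact: intgZ.
  - by apply: filterS rep0 => t ->; rewrite add0r.
move=> x xs; rewrite ah.
have i1 j : intg (fun t => `|rep x t| * \1_(A (f K j)) t).
  by apply: intgM1 => //; exact: intg_norm.
(* Pointwise, [|x + y| >= |y| - |x| = |x| + |y| - 2 |x|] on the chosen sets; elsewhere [y] vanishes
   and no correction arises. *)
apply: (@le_trans _ _ (Rint (fun t => `|rep x t| + \sum_j `|a j| * u j t -
    2 * \sum_j `|rep x t| * \1_(A (f K j)) t))).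
  rewrite RintegralB//; last 2 first.
  - by apply: intgD => //; exact: intg_norm.
  - by apply: intgZ; exact: intg_sum.
  rewrite RintegralD//; last exact: intg_norm.
  rewrite -rep_norm Ra RintegralZl//; last exact: intg_sum.
  rewrite Rint_sum// lerD2l lerN2.
  apply: (@le_trans _ _ (2 * \sum_(j : J) delta)).
    rewrite ler_wpM2l//; apply: ler_sum => j _; apply: Kp => //=.
    by rewrite leq_addr.
  have J1 : 0 < #|J|%:R + 1 :> R by rewrite ltr_wpDl.
  rewrite sumr_const -(mulr_natr delta) /delta -(natr1 #|J|).
  have -> : 2 * (eps / (2 * (#|J|%:R + 1)) * #|J|%:R) =
      eps * (#|J|%:R / (#|J|%:R + 1)) by field; rewrite gt_eqF.
  by rewrite ler_piMr ?(ltW eps0)// ler_pdivrMr// mul1r lerDl.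
apply: le_Rintegral => //.
- apply: intgB.
  + by apply: intgD => //; exact: intg_norm.
  + by apply: intgZ; exact: intg_sum.
- by apply: intg_norm; apply: intgD => //; apply: intg_sum => j; exact: intgZ.
move=> t _; have [[j Aj]|nA] := pselect (exists j, A (f K j) t).
  rewrite !(uE _ j)// (@disjoint_indic _ _ (fun=> `|rep x t|) j t (finj K))//.
  have := ler_normB (rep x t + a j * (m j)^-1) (rep x t).
  rewrite addrAC subrr add0r normrM (@ger0_norm _ (m j)^-1) ?invr_ge0 ?(ltW (m0 j))//; lra.
rewrite !uN// !addr0 gerBl mulr_ge0// sumr_ge0// => j _; by rewrite mulr_ge0.
Qed.

End L1_like.

(** The transfer of norm inequalities from the line, isolated as a property so that L_1 and l_1 can
    be treated together. *)
Definition l1_inequalities (R : realType) (X : normedModType R) : Prop :=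
  forall (I : finType) (n : nat) (al : I -> R) (c : I -> 'I_n -> R),
  (forall g : 'I_n -> R, \sum_i al i * `|\sum_k c i k * g k| <= 0) ->
  forall x : 'I_n -> X, \sum_i al i * `|\sum_k c i k *: x k| <= 0.

Section Lspace1.
Context d (T : measurableType d) (R : realType) (mu : {measure set T -> \bar R}).
Local Notation X := (LspaceType1 mu).

Let rep (x : X) : T -> R := x.

Let rep_intg (x : X) : mu.-integrable setT (EFin \o rep x).
Proof. by apply/Lfun1_integrable; exact: Lspace_Lfun. Qed.

Let rep_norm (x : X) : `|x| = \int[mu]_t `|rep x t|.
Proof. by rewrite Lspace_normE Lnorm1. Qed.

Let rep_lin a (x y : X) :
  \forall t \ae mu, rep (a *: x + y) t = a * rep x t + rep y t.
Proof.
apply: filterS2 (Lspace_addE (a *: x) y) (Lspace_scaleE a x) => t h1 h2.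
by rewrite /rep h1 h2.
Qed.

Let rep_surj (u : T -> R) : mu.-integrable setT (EFin \o u) ->
  exists x : X, \forall t \ae mu, rep x t = u t.
Proof.
move=> /Lfun1_integrable up; exists (Lspace_mk (lexx _) up).
by apply: filterS (Lspace_mkE (lexx _) up) => t; exact.
Qed.

Lemma Lspace1_inequalities : l1_inequalities X.
Proof. by move=> I n al c; exact: (L1_norm_inequality rep_intg rep_norm rep_lin). Qed.

Lemma Lspace1_far (A : nat -> set T) : (forall k, measurable (A k)) ->
  (forall k, (0 < mu (A k) < +oo)%E) -> trivIset setT A -> l1_far X.
Proof. exact: (L1_like_far rep_intg rep_norm rep_lin rep_surj). Qed.

End Lspace1.

Section ell1_like.
Variable R : realType.
Local Notation mu := (@counting nat R).
Let rep (x : ell1 R) : nat -> R := x.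

Let rep_intg (x : ell1 R) : mu.-integrable setT (EFin \o rep x).
Proof. by apply/Lfun1_integrable; exact: LfunP. Qed.

Let rep_norm (x : ell1 R) : `|x| = \int[mu]_t `|rep x t|.
Proof. by rewrite ell_normE Lnorm1. Qed.

Let rep_lin a (x y : ell1 R) :
  \forall t \ae mu, rep (a *: x + y) t = a * rep x t + rep y t.
Proof. exact: filterE. Qed.

Let rep_surj (u : nat -> R) : mu.-integrable setT (EFin \o u) ->
  exists x : ell1 R, \forall t \ae mu, rep x t = u t.
Proof.
move=> /Lfun1_integrable up; exists (Lfun_Sub (lexx _) up : LfunType _ _).
by apply: filterE => t; rewrite /rep Lfun_valP.
Qed.

Lemma ell1_inequalities : l1_inequalities (ell1 R).
Proof. by move=> I n al c; exact: (L1_norm_inequality rep_intg rep_norm rep_lin). Qed.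

Lemma ell1_far : l1_far (ell1 R).
Proof.
apply: (L1_like_far rep_intg rep_norm rep_lin rep_surj (A := fun k => [set k])).
- by [].
- move=> k; rewrite /= /counting asboolT; last exact: finite_set1.
  by rewrite fset_set1 /= finmap.cardfs1 lte_fin ltr01 ltry.
- by move=> i j _ _ [k [/= -> ->]].
Qed.

End ell1_like.

Lemma L1_far (R : realType) : l1_far (L1 R : normedModType R).
Proof.
pose A (k : nat) : set R := `]k.+2%:R^-1, k.+1%:R^-1]%classic.
have := @Lspace1_far _ _ R (mrestr (@lebesgue_measure R) (measurable_itv `[0, 1])) A.
apply.
- by move=> k; exact: measurable_itv.
- move=> k /=.
  have lk : k.+2%:R^-1 < k.+1%:R^-1 :> R by rewrite ltf_pV2 ?posrE ?ltr_nat.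
  have -> : mrestr lebesgue_measure (measurable_itv `[0%R, 1%R]) (A k) =
      (k.+1%:R^-1 - k.+2%:R^-1 : R)%:E.
    rewrite /mrestr setIidl; last first.
      move=> x; rewrite /A/= !in_itv/= => /andP[x0 x1]; apply/andP; split.
        by rewrite ltW// (le_lt_trans _ x0)// invr_ge0.
      by rewrite (le_trans x1)// invf_le1// ler1n.
    by rewrite lebesgue_measure_itv/= lte_fin lk.
  by rewrite lte_fin subr_gt0 lk ltry.
- have lt_disj i j (x : R) : (i < j)%N -> A i x -> A j x -> False.
    move=> ij; rewrite /A/= !in_itv/= => /andP[xi _] /andP[_ xj].
    have := lt_le_trans xi xj; rewrite ltf_pV2 ?posrE// ltr_nat.
    by rewrite ltnS leqNgt ltnS ij.
  move=> i j _ _ [x [Ai Aj]]; have [ij|ij|//] := ltngtP i j.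
    by case: (lt_disj _ _ _ ij Ai Aj).
  by case: (lt_disj _ _ _ ij Aj Ai).
Qed.

Lemma L1_or_ell1 (R : realType) (X : normedModType R) : X = L1 R \/ X = ell1 R ->
  l1_far X /\ l1_inequalities X.
Proof.
move=> [->|->]; split.
- exact: L1_far.
- exact: Lspace1_inequalities.
- exact: ell1_far.
- exact: ell1_inequalities.
Qed.

(** * Sections of l_q *)

Lemma powR_le_inv (R : realType) (r x y : R) :
  0 < r -> 0 <= x -> 0 <= y -> x `^ r <= y `^ r -> x <= y.
Proof.
move=> r0 x0 y0 xy; rewrite leNgt; apply/negP => yx.
have : y `^ r < x `^ r by apply: gt0_ltr_powR.
by rewrite ltNge xy.
Qed.

Lemma midpoint_le (R : realFieldType) (x0 x1 x2 y0 y1 y2 z : R) :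
  x0 + y0 = 1 -> x1 + y1 = 1 -> x2 + y2 = 1 ->
  x1 <= (x0 + x2) / 2 -> z <= (y0 + y2) / 2 -> z <= y1.
Proof. by move=> *; lra. Qed.

Lemma sum1_le (R : realFieldType) (x0 x1 y0 y1 : R) :
  x0 + y0 = 1 -> x1 + y1 = 1 -> x0 <= x1 -> y1 <= y0.
Proof. by move=> *; lra. Qed.

Lemma combination_le (R : realFieldType) (x y a b s t mi n : R) :
  a * x + b * y = n -> y * b <= t * b -> (x - mi) * a <= s * a ->
  a * mi <= n * mi -> (1 - mi) * n <= t * b + s * a.
Proof. by move=> <- *; lra. Qed.

(** * The l_q norm of the plane as a limit of sums of moduli *)

Section plane.
Variable R : realType.

Lemma powR_mid (p x y : R) : 1 <= p -> 0 <= x -> 0 <= y ->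
  ((x + y) / 2) `^ p <= (x `^ p + y `^ p) / 2.
Proof.
move=> p1 x0 y0; rewrite mulrC mulrDr [leRHS]mulrC mulrDr.
rewrite {2 4}(_ : 2^-1 = 1 - 2^-1); last by rewrite {2}(splitr 1) div1r addrK.
by apply: (convex_powR p1 (Itv01 _ _)) => //=;
  rewrite ?inE/= ?in_itv/= ?x0 ?y0// ?invr_ge0// invf_le1 ?ler1n.
Qed.

Lemma norm_addsub (x y : R) : `|x + y| + `|x - y| = 2 * Num.max `|x| `|y|.
Proof.
wlog y0 : y / 0 <= y.
  move=> h; have [/h//|/ltW yle] := leP 0 y.
  by rewrite -[in RHS](normrN y) -h ?oppr_ge0// opprK addrC.
wlog x0 : x / 0 <= x.
  move=> h; have [/h//|/ltW xle] := leP 0 x.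
  rewrite -[in RHS](normrN x) -h ?oppr_ge0// -[`|x + y|]normrN opprD.
  by rewrite -[`|x - y|]normrN opprB addrC [- x + y]addrC.
rewrite (ger0_norm x0) (ger0_norm y0) ger0_norm ?addr_ge0//.
have [xy|yx] := leP x y; [rewrite ler0_norm ?subr_le0//|rewrite gtr0_norm ?subr_gt0//]; lra.
Qed.

Lemma threshold (y : nat -> R) (c : R) m :
  (forall i, (i.+1 < m)%N -> y i.+1 <= y i) ->
  exists k, [/\ (k <= m)%N, forall i, (i < k)%N -> c <= y i &
    forall i, (k <= i < m)%N -> y i <= c].
Proof.
elim: m => [|m IH] ymono.
  by exists 0%N; split => // i; rewrite ltn0 andbF.
have [cy|yc] := leP c (y m).
  exists m.+1; split => // i; last by rewrite leqNgt => /andP[/negbTE->].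
  rewrite ltnS => im; apply: le_trans cy _.
  rewrite -(subKn im); elim: (m - i)%N => [|l IHl]; first by rewrite subn0.
  rewrite subnS; apply: le_trans IHl _; have [ml|lm] := leqP m l.
    by move: ml; rewrite -subn_eq0 => /eqP ->.
  have e : (m - l)%N = (m - l).-1.+1 by rewrite prednK// subn_gt0.
  rewrite {1}e; apply: ymono; rewrite -e ltnS leq_subr//.
have [|k [km k1 k2]] := IH; first by move=> i im; apply: ymono; exact: ltnW.
exists k; split => //; first exact: leqW.
move=> i /andP[ki]; rewrite ltnS leq_eqVlt => /predU1P[->|im]; first exact: ltW.
by apply: k2; rewrite ki.
Qed.

Variables p q : R.
Hypotheses (p1 : 1 <= p) (q1 : 1 < q) (pq : p^-1 + q^-1 = 1).

Let p0 : 0 < p. Proof. exact: lt_le_trans p1. Qed.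
Let q0 : 0 < q. Proof. exact: lt_trans q1. Qed.
Let qB : 0 < q - 1. Proof. by rewrite subr_gt0. Qed.
Let pE : (q - 1) * p = q.
Proof.
have -> : p = (1 - q^-1)^-1 by rewrite -pq addrK invrK.
by field; rewrite !gt_eqF.
Qed.

Variable m : nat.
Hypothesis m0 : (0 < m)%N.

(* Points of the first quadrant of the unit sphere of l_p^2, equally spaced in
   the first coordinate; the second coordinate is a concave function of [i]. *)
Definition arc_fst (i : nat) : R := 1 - i%:R / m%:R.
Definition arc_snd (i : nat) : R := (1 - arc_fst i `^ p) `^ p^-1.
Definition arc_step (i : nat) : R := arc_snd i.+1 - arc_snd i.

Let mR : 0 < m%:R :> R. Proof. by rewrite ltr0n. Qed.

Let al01 i : (i <= m)%N -> 0 <= arc_fst i <= 1.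
Proof.
move=> im; rewrite /arc_fst subr_ge0 ler_pdivrMr// mul1r ler_nat im/= gerBl.
by rewrite divr_ge0.
Qed.

Let alp i : (i <= m)%N -> arc_fst i `^ p <= 1.
Proof.
move=> /al01/andP[a0 a1].
by have <- : (1 : R) `^ p = 1 by [rewrite powR1]; rewrite ge0_ler_powR ?nnegrE ?(ltW p0).
Qed.

Let bep i : (i <= m)%N -> arc_fst i `^ p + arc_snd i `^ p = 1.
Proof.
move=> im; rewrite /arc_snd -powRrM mulVf ?gt_eqF// powRr1 ?subr_ge0 ?alp//.
by rewrite addrC subrK.
Qed.

Let be_ge0 i : 0 <= arc_snd i. Proof. exact: powR_ge0. Qed.

Let dy_ge0 i : (i < m)%N -> 0 <= arc_step i.
Proof.
move=> im.
rewrite subr_ge0 /arc_snd ge0_ler_powR ?invr_ge0 ?(ltW p0)// ?nnegrE ?subr_ge0 ?alp//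
  1?ltnW//.
rewrite lerD2l lerN2 ge0_ler_powR ?(ltW p0)// ?nnegrE.
- by have /andP[] := al01 im.
- by have /andP[] := al01 (ltnW im).
by rewrite lerD2l lerN2 ler_pM2r ?invr_gt0// ler_nat.
Qed.

(** The midpoint of two points of the arc lies in the l_p ball by convexity of the power, and it has
    the first coordinate of the arc point between them. *)
Let dy_mono i : (i.+1 < m)%N -> arc_step i.+1 <= arc_step i.
Proof.
move=> im; rewrite /arc_step.
suff : (arc_snd i + arc_snd i.+2) / 2 <= arc_snd i.+1.
  by move: (arc_snd i) (arc_snd i.+1) (arc_snd i.+2) => x y z; lra.
have s0 : 0 <= (arc_snd i + arc_snd i.+2) / 2 by rewrite divr_ge0 ?addr_ge0.
have := powR_mid p1 (be_ge0 i) (be_ge0 i.+2).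
have /andP[ai _] := al01 (ltnW (ltnW im)).
have /andP[ai2 _] := al01 im.
have := powR_mid p1 ai ai2.
have -> : (arc_fst i + arc_fst i.+2) / 2 = arc_fst i.+1.
  by rewrite /arc_fst -!natr1; field; rewrite gt_eqF.
have := bep (ltnW (ltnW im)); have := bep im; have := bep (ltnW im) => e1 e2 e3 h1 h2.
have := midpoint_le e3 e1 e2 h1 h2.
exact: powR_le_inv.
Qed.

Let dy_sum k : \sum_(i < k) arc_step i = arc_snd k.
Proof.
elim: k => [|k IH]; last first.
  rewrite big_ord_recr/= IH /arc_step; exact: subrKC.
rewrite big_ord0 /arc_snd /arc_fst mul0r subr0 powR1 subrr powR0//.
by rewrite invr_eq0 gt_eqF.
Qed.

(** For [a, b >= 0] this is the support function of the symmetric polygon inscribed in the l_p ball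
    at the arc points, written as a sum over its edges. *)
Definition arc_sum (a b : R) := \sum_(i < m) Num.max (a / m%:R) (b * arc_step i).

(** Since the steps decrease, the maxima switch sides at a single index [k]; the sum is then the
    functional of the [k]-th arc point, to which Hoelder's inequality applies. *)
Let G_le (a b : R) : 0 <= a -> 0 <= b -> arc_sum a b <= (a `^ q + b `^ q) `^ q^-1.
Proof.
move=> a0 b0.
have [k [km k1 k2]] := @threshold (fun i => b * arc_step i) (a / m%:R) m
  (fun i im => ler_wpM2l b0 (dy_mono im)).
have -> : arc_sum a b = arc_snd k * b + arc_fst k * a.
  rewrite /arc_sum -(big_mkord xpredT (fun i => Num.max (a / m%:R) (b * arc_step i))).
  rewrite (big_cat_nat (leq0n k) km)/=; congr (_ + _).
    rewrite -dy_sum mulr_suml -(big_mkord xpredT (fun i => arc_step i * b)).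
    by apply: eq_big_nat => i /andP[_ ik]; rewrite max_r ?k1// mulrC.
  rewrite (eq_big_nat _ _ (F2 := fun=> a / m%:R)); last first.
    by move=> i im; rewrite max_l ?k2.
  rewrite sumr_const_nat -(mulr_natr (a / m%:R)) natrB// /arc_fst; field; rewrite gt_eqF//.
rewrite addrC.
have /andP[a1 _] := al01 km.
have := hoelder2 a1 (be_ge0 k) a0 b0 p0 q0 pq.
by rewrite bep// powR1 mul1r.
Qed.

(** Every arc point gives a lower bound. The norming functional [(x, y)] of [(a, b)] lies on the l_p
    sphere; rounding [x] down to the grid costs at most [a / m] and does not lower the second
    coordinate. *)
Let G_ge (a b : R) : 0 <= a -> 0 <= b ->
  (1 - m%:R^-1) * (a `^ q + b `^ q) `^ q^-1 <= arc_sum a b.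
Proof.
move=> a0 b0; set n := (_ + _) `^ _.
have n0 : 0 <= n by exact: powR_ge0.
have nq : n `^ q = a `^ q + b `^ q.
  by rewrite -powRrM mulVf ?gt_eqF// powRr1 ?addr_ge0 ?powR_ge0.
have an : a <= n by apply: (powR_le_inv q0) => //; rewrite nq lerDl powR_ge0.
have kG k : (k <= m)%N -> arc_snd k * b + arc_fst k * a <= arc_sum a b.
  move=> km; rewrite /arc_sum -(big_mkord xpredT (fun i => Num.max (a / m%:R) (b * arc_step i))).
  rewrite (big_cat_nat (leq0n k) km)/=; apply: lerD.
    rewrite -dy_sum mulr_suml -(big_mkord xpredT (fun i => arc_step i * b)).
    by apply: ler_sum => i _; rewrite le_max mulrC lexx orbT.
  have -> : arc_fst k * a = \sum_(k <= i < m) (a / m%:R).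
    rewrite sumr_const_nat -(mulr_natr (a / m%:R)) natrB// /arc_fst; field; rewrite gt_eqF//.
  by apply: ler_sum => i _; rewrite le_max lexx.
have [n00|nn0] := eqVneq n 0.
  have G0 := kG 0%N (leq0n _); rewrite n00 mulr0; apply: le_trans G0.
  by rewrite addr_ge0// mulr_ge0//; have /andP[] := al01 (leq0n m).
have ngt0 : 0 < n by rewrite lt_neqAle eq_sym nn0.
pose x := (a / n) `^ (q - 1); pose y := (b / n) `^ (q - 1).
have x0 : 0 <= x by exact: powR_ge0.
have an1 : 0 <= a / n <= 1 by rewrite divr_ge0//= ler_pdivrMr// mul1r.
have x1 : x <= 1.
  have <- : (1 : R) `^ (q - 1) = 1 by rewrite powR1.
  by have /andP[? ?] := an1; rewrite ge0_ler_powR ?nnegrE ?(ltW qB).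
have powE z : ((z / n) `^ (q - 1)) `^ p = (z / n) `^ q.
  by rewrite -powRrM pE.
have divq z : 0 <= z -> (z / n) `^ q = z `^ q / n `^ q.
  move=> z0; rewrite powRM ?invr_ge0// -powR_inv1// -powRrM mulN1r powRN//.
have nq0 : 0 < n `^ q by rewrite powR_gt0.
have xyp : x `^ p + y `^ p = 1.
  by rewrite !powE !divq// -mulrDl -nq mulfV ?gt_eqF.
have norming z : 0 <= z -> z * (z / n) `^ (q - 1) = z `^ q / n `^ q * n.
  move=> z0; rewrite -divq//.
  rewrite -(@mulr_powRB1 _ (z / n) q) ?divr_ge0//.
  by rewrite mulrAC; congr (_ * _); rewrite divfK ?gt_eqF.
have xyn : a * x + b * y = n.
  by rewrite /x /y !norming// -mulrDl -mulrDl -nq mulfV ?gt_eqF// mul1r.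
pose l := Num.trunc (x * m%:R).
have xm0 : 0 <= x * m%:R by rewrite mulr_ge0// ltW.
have /andP[l1 l2] := truncn_itv xm0.
have lm : (l <= m)%N.
  by rewrite -(ler_nat R) (le_trans l1)// ler_piMl//.
have alE : arc_fst (m - l) = l%:R / m%:R.
  by rewrite /arc_fst natrB//; field; rewrite gt_eqF.
have al_le : arc_fst (m - l) <= x by rewrite alE ler_pdivrMr.
have al_ge : x - m%:R^-1 <= arc_fst (m - l).
  rewrite alE lerBlDr -[X in _ + X]mul1r -mulrDl ler_pdivlMr// natr1 ltW//.
have be_ge : y <= arc_snd (m - l).
  have ml := leq_subr l m.
  have : y `^ p <= arc_snd (m - l) `^ p.
    apply: (sum1_le (bep ml) xyp); rewrite ge0_ler_powR ?nnegrE ?(ltW p0)//.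
    by have /andP[] := al01 ml.
  exact: (powR_le_inv p0 (powR_ge0 _ _) (be_ge0 _)).
apply: le_trans (kG _ (leq_subr l m)).
have h1 := ler_wpM2r b0 be_ge; have h2 := ler_wpM2r a0 al_ge.
have mi0 : 0 <= m%:R^-1 :> R by rewrite invr_ge0 ltW.
exact: combination_le xyn h1 h2 (ler_wpM2r mi0 an).
Qed.

Lemma plane_zonoid : exists (I : finType) (g : I -> 'rV[R]_2), forall b : 'rV[R]_2,
  (1 - m%:R^-1) * (sumpow q b) `^ q^-1 <= \sum_i `|dot (g i) b| <=
  (sumpow q b) `^ q^-1.
Proof.
(* The two signs add up to twice a maximum by [norm_addsub], hence the halves. *)
pose g (i : 'I_m * bool) : 'rV[R]_2 := \row_(k < 2)
  (if k == 0 then (2 * m%:R)^-1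
   else if i.2 then arc_step i.1 / 2 else - (arc_step i.1 / 2)).
exists ('I_m * bool)%type, g => b.
have -> : sumpow q b = `|b 0 0| `^ q + `|b 0 1| `^ q.
  rewrite /sumpow big_ord_recl big_ord1; congr (_ + `|b _ _| `^ _).
  exact/val_inj.
suff -> : \sum_i `|dot (g i) b| = arc_sum `|b 0 0| `|b 0 1|.
  by rewrite G_ge// G_le.
rewrite -(pair_bigA _ (fun (i : 'I_m) (s : bool) => `|dot (g (i, s)) b|))/=.
apply: eq_bigr => i _; rewrite big_bool/= /dot !big_ord_recl !big_ord0 !mxE/=.
have -> : lift ord0 ord0 = 1 :> 'I_2 by exact/val_inj.
rewrite !addr0 mulNr norm_addsub !normrM normfV normrM.
rewrite (ger0_norm (dy_ge0 (ltn_ord i))) !normr_nat.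
rewrite normfV normr_nat maxr_pMr//; congr Num.max; last by field.
by field; rewrite gt_eqF.
Qed.

End plane.

(** A nearly isometric linear map from l_q^N to l_1^I. The upper bound has no error, because
    [nearly_norming] asks for a map of norm at most 1. *)
Definition almost_l1 (R : realType) (q : \bar R) (q1 : (1 <= q)%E) (N : nat) : Prop :=
  forall eps : R, 0 < eps ->
  exists (I : finType) (g : I -> 'rV[R]_N), forall b : elln q1 N,
    (1 - eps) * `|b| <= \sum_i `|dot (g i) b| <= `|b|.

Section almost_l1.
Variable R : realType.

Lemma elln_normEfin (r : R) (q1 : (1 <= r%:E)%E) N (b : elln q1 N) :
  `|b| = sumpow r b `^ r^-1.
Proof. by []. Qed.

Lemma elln_norm_powR (r : R) (q1 : (1 <= r%:E)%E) N (b : elln q1 N) :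
  `|b| `^ r = sumpow r b.
Proof.
have r1 : 1 <= r by rewrite -lee_fin.
have r0 : 0 < r by exact: lt_le_trans r1.
by rewrite elln_normEfin -powRrM mulVf ?gt_eqF// powRr1// sumpow_ge0.
Qed.

Lemma dot_delta N k (b : 'rV[R]_N) : dot (delta_mx 0 k) b = b 0 k.
Proof.
rewrite /dot (bigD1 k)//= mxE !eqxx mul1r big1 ?addr0// => l lk.
by rewrite mxE (negbTE lk) andbF mul0r.
Qed.

Lemma almost_l1_one (q1 : (1 <= 1%:E :> \bar R)%E) N : almost_l1 q1 N.
Proof.
move=> eps eps0; exists 'I_N, (fun k => delta_mx 0 k) => b.
have -> : \sum_i `|dot (delta_mx 0 i) b| = `|b|.
  rewrite elln_normEfin invr1 powRr1 ?sumpow_ge0//; apply: eq_bigr => k _.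
  by rewrite dot_delta powRr1.
by rewrite lexx andbT ler_piMl// gerBl ltW.
Qed.

Lemma almost_l1_line (q : \bar R) (q1 : (1 <= q)%E) : almost_l1 q1 1.
Proof.
move=> eps eps0; exists unit, (fun=> delta_mx 0 0) => b.
rewrite big_const card_unit /= addr0 dot_delta.
have -> : `|b 0 0| = `|b|.
  case: q q1 b => [r q1 b|q1 b|//].
    have r0 : 0 < r by rewrite -lte_fin (lt_le_trans _ q1).
    by rewrite elln_normEfin /sumpow big_ord1 -powRrM mulfV ?gt_eqF// powRr1.
  by rewrite elln_normE /elln_norm big_ord_recl big_ord0 max_l.
by rewrite lexx andbT ler_piMl// gerBl ltW.
Qed.

Lemma almost_l1_plane (r : R) (q1 : (1 <= r%:E)%E) : 1 < r -> almost_l1 q1 2.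
Proof.
move=> r1 eps eps0; pose m := (Num.trunc eps^-1).+1.
have mR : 0 < m%:R :> R by rewrite ltr0n.
have meps : m%:R^-1 <= eps.
  have ie : 0 <= eps^-1 by rewrite invr_ge0 ltW.
  have /andP[_ h] := truncn_itv ie.
  by rewrite -[leRHS]invrK lef_pV2 ?posrE ?invr_gt0// ltW.
have r0 : 0 < r by exact: lt_trans r1.
have rB : 0 < r - 1 by rewrite subr_gt0.
have p1 : 1 <= r / (r - 1) by rewrite ler_pdivlMr// mul1r gerBl.
have pr : (r / (r - 1))^-1 + r^-1 = 1 by field; rewrite !gt_eqF.
have [I [g gP]] := plane_zonoid p1 r1 pr (ltn0Sn (Num.trunc eps^-1)).
exists I, g => b; rewrite elln_normEfin.
have /andP[h1 h2] := gP b; apply/andP; split => //.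
by apply: le_trans h1; rewrite ler_wpM2r ?powR_ge0// lerB.
Qed.

Lemma elln_finite_dimensional (q : \bar R) (q1 : (1 <= q)%E) N :
  finite_dimensional [set: elln q1 N].
Proof.
exists [seq (delta_mx 0 k : elln q1 N) | k : 'I_N]; apply/seteqP; split => // x _.
exists N, (fun k => x 0 k), (fun k => delta_mx 0 k); split.
  by move=> k /=; apply: map_f; rewrite mem_enum.
exact: row_sum_delta.
Qed.

(** Let [sg] be the supremum of [L] on the sphere, finite thanks to [C]. It controls [L] on the
    difference of a unit vector and its approximation, so [sg <= 1 + e + 2 e sg], and
    [L >= 1 - e - 2 e sg] on the sphere. *)
Lemma seminorm_near_isometry (W : normedModType R) (L : W -> R) (C e : R) :
  (forall x y, L (x + y) <= L x + L y) ->
  (forall a x, L (a *: x) = `|a| * L x) ->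
  (forall x, 0 <= L x <= C * `|x|) ->
  (exists b : W, `|b| = 1) -> 0 < e <= 8^-1 ->
  (forall b, `|b| = 1 -> exists2 y, `|L y - 1| <= e & `|b - y| <= 2 * e) ->
  exists2 sg, 0 < sg & forall b, (1 - 8 * e) * (sg * `|b|) <= L b <= sg * `|b|.
Proof.
move=> LD LZ LC [b0 b01] /andP[e0 e8] approx.
have [sg [Lsg sg_lub]] : exists sg, (forall b, L b <= sg * `|b|) /\
    forall M, (forall b, `|b| = 1 -> L b <= M) -> sg <= M.
  exists (sup [set L b | b in [set b : W | `|b| = 1]]); split => [b|M LM].
    have [->|bn] := eqVneq b 0.
      by rewrite -{1}(scale0r (0 : W)) LZ !normr0 mul0r mulr0.
    have nb : 0 < `|b| by rewrite normr_gt0.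
    suff : L (`|b|^-1 *: b) <= sup [set L b | b in [set b : W | `|b| = 1]].
      by rewrite LZ normfV normr_id ler_pdivrMl// mulrC.
    apply: ub_le_sup.
      by exists C => _ [x /= x1 <-]; have /andP[_] := LC x; rewrite x1 mulr1.
    by exists (`|b|^-1 *: b) => //=; rewrite normrZ normfV normr_id mulVf// gt_eqF.
  by apply: ge_sup; [exists (L b0), b0|move=> _ [b /= b1 <-]; exact: LM].
have sg0 : 0 <= sg.
  by have /andP[h _] := LC b0; have := Lsg b0; rewrite b01 mulr1; exact: le_trans.
have upper : sg <= 1 + e + 2 * e * sg.
  apply: sg_lub => b b1; have [y yL ybn] := approx b b1.
  have := LD y (b - y); rewrite addrC subrK.
  have := Lsg (b - y); move: yL; rewrite ler_norml => /andP[_].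
  have := ler_wpM2l sg0 ybn; lra.
have lower b : `|b| = 1 -> 1 - e - 2 * e * sg <= L b.
  move=> b1; have [y yL ybn] := approx b b1.
  have := LD b (y - b); rewrite addrC subrK.
  have := Lsg (y - b); move: yL; rewrite ler_norml => /andP[+ _].
  by have := ler_wpM2l sg0 ybn; rewrite distrC; lra.
have h0 := ler_wpM2r sg0 e8.
(* A crude bound from [e <= 1/8]; inserted into [upper] it improves to [1 + 4 e]. *)
have sg32 : sg <= 3 / 2 by lra.
have h1 := ler_wpM2l (ltW e0) sg32.
have sg_le : sg <= 1 + 4 * e by lra.
have h2 := ler_wpM2l (ltW e0) sg_le.
have h3 : e * e <= e * 8^-1 by rewrite ler_wpM2l// ltW.
have e8' : 0 <= 1 - 8 * e by lra.
have h5 := ler_wpM2l e8' sg_le.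
have ee : 0 <= e * e by rewrite mulr_ge0// ltW.
have low_sg : (1 - 8 * e) * sg <= 1 - e - 2 * e * sg by lra.
exists sg => [|b].
  have := Lsg b0; rewrite b01 mulr1; apply: lt_le_trans.
  by apply: lt_le_trans (lower _ b01); lra.
rewrite Lsg andbT; have [->|bn] := eqVneq b 0.
  by rewrite normr0 !mulr0; have /andP[] := LC 0.
have nb : 0 < `|b| by rewrite normr_gt0.
have b1 : `|(`|b|^-1 *: b)| = 1 by rewrite normrZ normfV normr_id mulVf// gt_eqF.
have := le_trans low_sg (lower _ b1).
by rewrite LZ normfV normr_id ler_pdivlMl// mulrCA (mulrC `|b|).
Qed.

(** Normalizing a net point moves it by at most [e] more. This puts the net where [stable_zonoid]
    applies. *)
Lemma unit_net (W : normedModType R) (s : seq W) (e : R) : 0 < e < 1 ->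
  (forall x, `|x| = 1 -> exists2 y, y \in s & `|x - y| <= e) ->
  forall x, `|x| = 1 ->
  exists2 y, y \in [seq `|y|^-1 *: y | y <- s & y != 0] & `|x - y| <= 2 * e.
Proof.
move=> /andP[e0 e1] sP b b1; have [y ys by_] := sP b b1.
have y1 : `|1 - `|y| | <= e by rewrite -b1 (le_trans _ by_)// ler_dist_dist.
have y0 : 0 < `|y| by move: y1; rewrite ler_norml => /andP[_ ?]; lra.
exists (`|y|^-1 *: y).
  by apply: map_f; rewrite mem_filter ys andbT -normr_gt0.
have -> : b - `|y|^-1 *: y = (b - y) + (`|y| - 1) *: (`|y|^-1 *: y).
  rewrite scalerA mulrBl mulfV ?gt_eqF// mul1r scalerBl scale1r.
  by rewrite addrA subrK.
apply: le_trans (ler_normD _ _) _; rewrite [in X in _ + X]normrZ.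
rewrite [`|(_^-1 *: _)|]normrZ normfV normr_id mulVf ?gt_eqF// mulr1.
by rewrite distrC in y1; lra.
Qed.

Lemma almost_l1_stable (r : R) (q1 : (1 <= r%:E)%E) N : 1 < r <= 2 ->
  almost_l1 q1 N.
Proof.
move=> r12 eps eps0.
pose e := Num.min (eps / 8) 8^-1.
have e0 : 0 < e by rewrite lt_min; apply/andP; split; lra.
have e_eps : e <= eps / 8 by rewrite ge_min lexx.
have e8 : e <= 8^-1 by rewrite ge_min lexx orbT.
have e01 : 0 < e < 1 by rewrite e0/= (le_lt_trans e8)//; lra.
have [s _ sP] := finite_net (W := elln q1 N) 1 (elln_finite_dimensional q1 N) e0.
have {}sP (x : elln q1 N) : `|x| = 1 -> exists2 y, y \in s & `|x - y| <= e.
  by move=> x1; apply: sP => //; rewrite x1.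
have net := unit_net e01 sP.
have s1P (b : elln q1 N) : b \in [seq `|y|^-1 *: y | y <- s & y != 0] -> `|b| = 1.
  move=> /mapP[y]; rewrite mem_filter => /andP[y0 _] ->.
  by rewrite normrZ normfV normr_id mulVf// normr_eq0.
have s1pow (b : elln q1 N) : b \in [seq `|y|^-1 *: y | y <- s & y != 0] ->
    sumpow r b = 1.
  by move=> bs; rewrite -(elln_norm_powR b) (s1P _ bs) powR1.
have [I [g gP]] := stable_zonoid r12 e0 s1pow.
have [b0|N0] := pselect (exists b : elln q1 N, `|b| = 1); last first.
  exists unit, (fun=> 0) => b.
  have -> : b = 0.
    apply: contrapT => /eqP b0; apply: N0; exists (`|b|^-1 *: b).
    by rewrite normrZ normfV normr_id mulVf// normr_eq0.
  by rewrite normr0 mulr0 big1 ?lexx// => i _; rewrite dot0r normr0.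
have [||||x x1|sg sg0 sgP] := @seminorm_near_isometry (elln q1 N)
    (fun b => \sum_i `|dot (g i) b|) (\sum_i \sum_k `|g i 0 k|) e _ _ _ b0.
- move=> x y; rewrite -big_split; apply: ler_sum => i _ /=.
  rewrite (_ : dot _ _ = dot (g i) x + dot (g i) y) ?ler_normD//.
  by rewrite /dot -big_split; apply: eq_bigr => k _; rewrite !mxE mulrDr.
- by move=> a x; rewrite mulr_sumr; apply: eq_bigr => i _; rewrite -normrM -dotZr.
- move=> x; rewrite sumr_ge0//= mulr_suml.
  apply: ler_sum => i _; apply: le_trans (ler_norm_sum _ _ _) _.
  rewrite mulr_suml; apply: ler_sum => k _; rewrite normrM ler_wpM2l//.
  exact: elln_coord_le.
- by rewrite e0.
- by have [y ys xy] := net x x1; exists y => //; exact: gP.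
have sgV : 0 <= sg^-1 by rewrite invr_ge0 ltW.
exists I, (fun i => sg^-1 *: g i) => b.
have -> : \sum_i `|dot (sg^-1 *: g i) b| = sg^-1 * \sum_i `|dot (g i) b|.
  rewrite mulr_sumr; apply: eq_bigr => i _.
  by rewrite dotZl normrM ger0_norm.
have /andP[h1 h2] := sgP b.
rewrite ler_pdivrMl// h2 andbT ler_pdivlMl// mulrCA; apply: le_trans h1.
by rewrite ler_wpM2r ?mulr_ge0 ?(ltW sg0)//; lra.
Qed.

End almost_l1.

(** * Finitely supported sequences and truncation *)

Section padding.
Variables (R : realType) (n : nat).
Implicit Types (x : 'rV[R]_n).

Definition pad x (k : nat) : R := if insub k is Some i then x 0 i else 0.

Lemma padE x (i : 'I_n) : pad x i = x 0 i.
Proof. by rewrite /pad valK. Qed.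

Lemma pad0 x k : (n <= k)%N -> pad x k = 0.
Proof. by move=> nk; rewrite /pad insubF// ltnNge nk. Qed.

Lemma pad_lin a x y k : pad (a *: x + y) k = a * pad x k + pad y k.
Proof.
by rewrite /pad; case: insubP => [i _ _|_]; rewrite ?mxE// mulr0 addr0.
Qed.

Lemma pad_Lfun (p : \bar R) (p1 : (1 <= p)%E) x : pad x \in Lfun (@counting nat R) p.
Proof.
rewrite inE; apply/andP; split; rewrite inE//= /finite_norm.
case: p p1 => [r r1|_|//].
  have r0 : 0 < r by rewrite -lte_fin (lt_le_trans _ r1).
  rewrite Lnorm_counting// (nneseries_split 0 n); last by move=> k _; exact: poweR_ge0.
  rewrite add0n [X in (_ + X)%E]eseries0 ?adde0; last first.
    by move=> k nk _; rewrite /= pad0// normr0 powR0// gt_eqF.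
  rewrite (eq_bigr (fun k => (`|pad x k| `^ r)%:E))//.
  by rewrite sumEFin poweR_EFin ltry.
rewrite unlock /Lnorm; case: ifPn => // _.
apply: (@le_lt_trans _ _ (\sum_i `|x 0 i|)%:E); last exact: ltry.
apply/ess_supP; apply: filterE => k /=; rewrite lee_fin.
rewrite /pad; case: insubP => [i _ _|_]; last by rewrite normr0 sumr_ge0.
by rewrite (bigD1 i)//= lerDl sumr_ge0.
Qed.

Definition ell_pad (p : \bar R) (p1 : (1 <= p)%E) x : ell p1 := Lfun_Sub p1 (pad_Lfun p1 x).

Lemma ell_padE (p : \bar R) (p1 : (1 <= p)%E) x k : ell_pad p1 x k = pad x k.
Proof. by rewrite Lfun_valP. Qed.

Lemma ell_pairing_pad (p q : \bar R) (p1 : (1 <= p)%E) (q1 : (1 <= q)%E) x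
    (b : ell q1) : ell_pairing (ell_pad p1 x) b = \sum_(i < n) x 0 i * b i.
Proof.
apply/cvg_lim => //; apply: cvg_near_cst; exists n => // m /= nm.
rewrite /series/= (big_cat_nat (leq0n n) nm)/= [X in _ + X]big_nat [X in _ + X]big1 ?addr0.
  by rewrite big_mkord; apply: eq_bigr => i _; rewrite padE.
by move=> k /andP[nk _]; rewrite pad0// mul0r.
Qed.

Lemma ell_pad_c0 x : c0 R (ell_pad (leey (1%E : \bar R)) x).
Proof.
rewrite /c0/=; apply: cvg_near_cst; exists n => // m /= nm.
by rewrite ?ell_padE pad0.
Qed.

End padding.

Section ell_norm.
Variable R : realType.

Lemma ell_norm_cvg (r : R) (q1 : (1 <= r%:E)%E) (b : ell q1) :
  \sum_(k < n) `|b k| `^ r @[n --> \oo] --> `|b| `^ r.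
Proof.
have r0 : 0 < r by rewrite -lte_fin (lt_le_trans _ q1).
have bE : `|b|%:E = 'N[@counting nat R]_(r%:E)[EFin \o b]%E by exact: finite_norm_fine.
have : ((`|b| `^ r)%:E = \sum_(0 <= k <oo) (`|b k| `^ r)%:E)%E.
  rewrite -poweR_EFin bE powR_Lnorm ?gt_eqF//.
  rewrite ge0_integral_count//=.
move=> e.
have : (fun n => (\sum_(k < n) `|b k| `^ r)%:E) @ \oo --> (`|b| `^ r)%:E.
  rewrite e.
  have : cvgn (fun n => \sum_(0 <= k < n) (`|b k| `^ r)%:E)%E.
    by apply: is_cvg_nneseries => k _ _; rewrite lee_fin powR_ge0.
  by under eq_fun do rewrite sumEFin big_mkord.
exact: fine_cvg.
Qed.

Lemma ell_sum_le (r : R) (q1 : (1 <= r%:E)%E) (b : ell q1) n :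
  \sum_(k < n) `|b k| `^ r <= `|b| `^ r.
Proof.
rewrite -(cvg_lim _ (@ell_norm_cvg r q1 b))//.
have mono : nondecreasing_seq (fun n => \sum_(k < n) `|b k| `^ r).
  by apply/nondecreasing_seqP => m; rewrite big_ord_recr/= lerDl powR_ge0.
apply: (nondecreasing_cvgn_le mono); apply/cvg_ex; eexists; exact: ell_norm_cvg.
Qed.

Lemma ell_norm_le (r : R) (q1 : (1 <= r%:E)%E) (b : ell q1) (M : R) :
  (forall n, \sum_(k < n) `|b k| `^ r <= M) -> `|b| `^ r <= M.
Proof.
move=> bM; apply: (ler_cvg_to (@ell_norm_cvg r q1 b) (cvg_cst M)).
exact: nearW.
Qed.

Lemma ell_norm_pad (r : R) (q1 : (1 <= r%:E)%E) n (x : elln q1 n) :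
  `|ell_pad q1 x| = `|x|.
Proof.
have r0 : 0 < r by rewrite -lte_fin (lt_le_trans _ q1).
have : `|ell_pad q1 x| `^ r = `|x| `^ r.
  rewrite elln_norm_powR.
  have h1 := @ell_norm_cvg r q1 (ell_pad q1 x).
  have h2 : \sum_(k < m) `|ell_pad q1 x k| `^ r @[m --> \oo] --> sumpow r x.
    apply: cvg_near_cst; exists n => // m /= nm.
    rewrite -(big_mkord xpredT (fun k => `|ell_pad q1 x k| `^ r)).
    rewrite (big_cat_nat (leq0n n) nm)/= [X in _ + X]big_nat [X in _ + X]big1 ?addr0.
      by rewrite big_mkord; apply: eq_bigr => i _; rewrite ?ell_padE padE.
    by move=> k /andP[nk _]; rewrite ?ell_padE pad0// normr0 powR0// gt_eqF.
  exact: (cvg_unique _ h1 h2).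
move=> e; apply/eqP; rewrite eq_le; apply/andP; split;
  by apply: (powR_le_inv r0) => //; rewrite e.
Qed.

Definition ell_trunc (q : \bar R) (q1 : (1 <= q)%E) n (b : ell q1) : elln q1 n :=
  \row_(i < n) b i.

Lemma ell_trunc_norm_le (r : R) (q1 : (1 <= r%:E)%E) n (b : ell q1) :
  `|ell_trunc n b| <= `|b|.
Proof.
have r0 : 0 < r by rewrite -lte_fin (lt_le_trans _ q1).
apply: (powR_le_inv r0) => //; rewrite elln_norm_powR.
rewrite (_ : sumpow r _ = \sum_(k < n) `|b k| `^ r) ?ell_sum_le//.
by apply: eq_bigr => k _; rewrite mxE.
Qed.

(** The [r]-th power of the distance is at most the tail of the series for [|b|^r]. *)
Lemma ell_trunc_cvg (r : R) (q1 : (1 <= r%:E)%E) (b : ell q1) :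
  `|b - ell_pad q1 (ell_trunc n b)| @[n --> \oo] --> 0.
Proof.
have r0 : 0 < r by rewrite -lte_fin (lt_le_trans _ q1).
have main n : `|b - ell_pad q1 (ell_trunc n b)| `^ r <=
    `|b| `^ r - \sum_(k < n) `|b k| `^ r.
  have [d dE] : exists d : ell q1, d = b - ell_pad q1 (ell_trunc n b).
    by exists (b - ell_pad q1 (ell_trunc n b)).
  rewrite -dE.
  apply: ell_norm_le => m.
  have small k : (k < n)%N -> d k = 0.
    move=> kn; rewrite dE [LHS]/(b k - ell_pad q1 (ell_trunc n b) k) ell_padE.
    by have := padE (ell_trunc n b) (Ordinal kn); rewrite mxE /= => ->; exact: subrr.
  have big_ k : (n <= k)%N -> d k = b k.
    move=> kn; rewrite dE [LHS]/(b k - ell_pad q1 (ell_trunc n b) k) ell_padE.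
    by rewrite pad0//; exact: subr0.
  apply: (@le_trans _ _ (\sum_(k < n + m) `|d k| `^ r)).
    rewrite -!(big_mkord xpredT (fun k => `|d k| `^ r)).
    rewrite (big_cat_nat (leq0n m) (leq_addl n m))/= lerDl.
    by apply: sumr_ge0 => k _; exact: powR_ge0.
  rewrite lerBrDl; apply: le_trans (@ell_sum_le r q1 b (n + m)).
  rewrite !big_split_ord/= [X in _ + (X + _)]big1 ?add0r; last first.
    by move=> k _; rewrite small// normr0 powR0// gt_eqF.
  rewrite lerD2l; apply: ler_sum => k _; rewrite big_ ?leq_addr//.
have h : (`|b| `^ r - \sum_(k < n) `|b k| `^ r) @[n --> \oo] --> 0.
  rewrite -[X in _ --> X](subrr (`|b| `^ r)); apply: cvgB; first exact: cvg_cst.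
  exact: ell_norm_cvg.
apply/cvgrPdist_le => e e0 /=.
have er0 : 0 < e `^ r by exact: powR_gt0.
have /cvgrPdist_le/(_ _ er0) := h; apply: filterS => n.
rewrite !sub0r !normrN normr_id => hn.
apply: (powR_le_inv r0); rewrite ?normr_ge0 ?(ltW e0)//.
by rewrite (le_trans (main n))// (le_trans (ler_norm _)).
Qed.

End ell_norm.

(** * Points at which operators are nearly normed *)

Section norming.
Variables (R : realType) (Z X : normedModType R).
Implicit Types (T : 'L(Z, X)).

Lemma operator_norm_adherent T (eps : R) : 0 < eps ->
  exists2 z : Z, `|z| <= 1 & `|T| - eps <= `|T z|.
Proof.
move=> eps0.
have [_ [z /= z1 <-] /ltW h] := sup_adherent eps0 (operator_norm_has_sup T).
by exists z.
Qed.

Lemma operator_norm_unit T (eps : R) : (exists z : Z, `|z| = 1) -> 0 < eps ->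
  exists2 z : Z, `|z| = 1 & `|T| - eps <= `|T z|.
Proof.
move=> [u u1] eps0; have [z z1 Tz] := operator_norm_adherent T eps0.
have [z0|zn] := eqVneq z 0.
  by exists u => //; apply: le_trans Tz _; rewrite z0 linear0 normr0.
have nz : 0 < `|z| by rewrite normr_gt0.
exists (`|z|^-1 *: z); first by rewrite normrZ normfV normr_id mulVf// gt_eqF.
apply: (le_trans Tz); rewrite linearZ normrZ normfV normr_id.
by rewrite ler_peMl// invf_ge1.
Qed.

Lemma bigmax_operator_norm (s : seq 'L(Z, X)) :
  exists2 C : R, 0 < C & forall T, T \in s -> `|T| <= C.
Proof.
exists (1 + \sum_(T <- s) `|T|).
  by rewrite ltr_pwDl// sumr_ge0.
move=> T Ts; rewrite (big_rem T)//= addrCA lerDl addr_ge0// sumr_ge0//.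
Qed.

(* Every point of the unit ball is a convex combination of two points of the
   ball at which the functional [f] takes the values 1 and -1. *)
Lemma sup_nearly_norming (f : Z -> R) (e : Z) :
  linear f -> f e = 1 -> (forall z, `|f z| <= `|z|) ->
  (forall z t, `|z| <= 1 -> `|f z + t| <= 1 -> `|z + t *: e| <= 1) ->
  nearly_norming X [set f].
Proof.
move=> flin fe f_le ball s eps eps0.
have fZ z t : f (z + t *: e) = f z + t.
  by rewrite addrC flin fe addrC; congr (_ + _); exact: mulr1.
have key T : exists z, [/\ `|z| <= 1, `|T| - eps <= `|T z| & `|f z| = 1].
  have [z z1 Tz] := operator_norm_adherent T eps0.
  have fz1 : `|f z| <= 1 := le_trans (f_le z) z1.
  pose zp := z + (1 - f z) *: e; pose zm := z + (- 1 - f z) *: e.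
  have fzp : f zp = 1 by rewrite fZ addrC subrK.
  have fzm : f zm = -1 by rewrite fZ addrC subrK.
  have zp1 : `|zp| <= 1 by apply: ball => //; rewrite addrC subrK normr1.
  have zm1 : `|zm| <= 1 by apply: ball => //; rewrite addrC subrK normrN1.
  pose a := (1 + f z) / 2; pose c := (1 - f z) / 2.
  have [a0 c0] : 0 <= a /\ 0 <= c.
    by move: fz1; rewrite ler_norml /a /c => /andP[h1 h2]; split; lra.
  have ac : a + c = 1 by rewrite /a /c; lra.
  have zE : z = a *: zp + c *: zm.
    rewrite /zp /zm !scalerDr addrACA -scalerDl ac scale1r !scalerA -scalerDl.
    rewrite [X in X *: e](_ : _ = 0) ?scale0r ?addr0//.
    by rewrite /a /c; field.
  have le_max : `|T z| <= a * `|T zp| + c * `|T zm|.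
    rewrite {1}zE linearD !linearZ /=; apply: le_trans (ler_normD _ _) _.
    have nZ (l : R) (x : X) : 0 <= l -> `|l *: x| = l * `|x|.
      by move=> l0; rewrite normrZ ger0_norm.
    by rewrite !nZ.
  have [h|h] := leP `|T zm| `|T zp|.
    exists zp; split => //; last by rewrite fzp normr1.
    apply: (le_trans Tz); apply: (le_trans le_max).
    by rewrite -[leRHS]mul1r -ac mulrDl lerD2l ler_wpM2l.
  exists zm; split => //; last by rewrite fzm normrN1.
  apply: (le_trans Tz); apply: (le_trans le_max).
  by rewrite -[leRHS]mul1r -ac mulrDl lerD2r ler_wpM2l// ltW.
have /choice[b bP] := key.
exists b, unit, (fun=> f); split => [//|z|T _].
  by rewrite big_const card_unit /= addr0.
have [b1 Tb fb] := bP T; split => //.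
by rewrite big_const card_unit /= addr0 fb gerBl ltW.
Qed.

End norming.

Lemma trunc_arith (R : realFieldType) (a b c w e eps : R) :
  e <= eps / 2 -> a - e <= b -> b <= c + w -> w <= e -> a - eps <= c.
Proof. by move=> *; lra. Qed.

Lemma one_sub_sqr (R : realFieldType) (e eps : R) :
  e <= eps / 2 -> 1 - eps <= (1 - e) * (1 - e).
Proof. by move=> h; have := sqr_ge0 e; rewrite expr2; lra. Qed.

Section sequence_spaces.
Variables (R : realType) (X : normedModType R).

Lemma elln_unit (q : \bar R) (q1 : (1 <= q)%E) n : (0 < n)%N ->
  exists z : elln q1 n, `|z| = 1.
Proof.
case: n => // n _; pose u : elln q1 n.+1 := const_mx 1.
have u0 : u != 0 by apply/eqP => /rowP/(_ ord0)/eqP; rewrite !mxE oner_eq0.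
exists (`|u|^-1 *: u).
by rewrite normrZ normfV normr_id mulVf// normr_eq0.
Qed.

Lemma elln_nearly_norming (q : \bar R) (q1 : (1 <= q)%E) n : (0 < n)%N ->
  almost_l1 q1 n ->
  nearly_norming (Z := elln q1 n) X [set dot g | g in [set: 'rV[R]_n]].
Proof.
move=> n0 al s eps eps0; have [J [g gP]] := al eps eps0.
have /choice[b bP] : forall T : 'L(elln q1 n, X), exists z,
    `|z| = 1 /\ `|T| - eps <= `|T z|.
  by move=> T; have [z z1 Tz] := operator_norm_unit T (elln_unit q1 n0) eps0; exists z.
exists b, J, (fun j => dot (g j)); split => [j|z|T _].
- by exists (g j).
- by have /andP[] := gP z.
- have [b1 Tb] := bP T; split => //; first by rewrite b1.
  by have /andP[+ _] := gP (b T); rewrite b1 mulr1.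
Qed.

(** Such functionals come from l_p and from c_0 alike, so one argument serves both. *)
Definition finite_functional (q : \bar R) (q1 : (1 <= q)%E) : set (ell q1 -> R) :=
  [set phi | exists N (x : 'rV[R]_N),
    phi = fun b : ell q1 => \sum_(i < N) x 0 i * (b : nat -> R) i].

(** Nearly norming unit vectors are cut after [N] coordinates, with one [N] for the whole list, and
    l_q^N is mapped to l_1. *)
Lemma ell_nearly_norming (r : R) (q1 : (1 <= r%:E)%E) :
  (forall n, almost_l1 q1 n) -> nearly_norming X (finite_functional (q1 := q1)).
Proof.
move=> al s eps eps0.
pose e := Num.min (eps / 2) 1.
have e0 : 0 < e by rewrite lt_min ltr01 divr_gt0.
have e1 : e <= 1 by rewrite ge_min lexx orbT.
have e_eps : e <= eps / 2 by rewrite ge_min lexx.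
have unit_ell : exists z : ell q1, `|z| = 1.
  have [z z1] := @elln_unit r%:E q1 1 isT.
  by exists (ell_pad q1 z); rewrite ell_norm_pad.
have /choice[c cP] : forall T : 'L(ell q1, X), exists z,
    `|z| = 1 /\ `|T| - e <= `|T z|.
  by move=> T; have [z z1 Tz] := operator_norm_unit T unit_ell e0; exists z.
have [C C0 CP] := bigmax_operator_norm s.
(* The truncation error stays below [e] both before and after applying an operator of [s]. *)
pose d := Num.min e (e / C).
have d0 : 0 < d by rewrite lt_min e0 divr_gt0.
have [N _ NP] : \forall n \near \oo, forall T, T \in s ->
    `|c T - ell_pad q1 (ell_trunc n (c T))| <= d.
  apply: near_seq => T Ts; have /cvgrPdist_le/(_ d d0) := ell_trunc_cvg (c T).
  by apply: filterS => n; rewrite sub0r normrN normr_id.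
have {}NP T : T \in s -> `|c T - ell_pad q1 (ell_trunc N (c T))| <= d.
  by apply: NP => /=.
have [J [g gP]] := al N e e0.
exists (fun T => ell_pad q1 (ell_trunc N (c T))), J,
  (fun j (b : ell q1) => \sum_(i < N) g j 0 i * (b : nat -> R) i).
have dotE j (b : ell q1) : \sum_(i < N) g j 0 i * (b : nat -> R) i = dot (g j) (ell_trunc N b).
  by apply: eq_bigr => i _; rewrite mxE.
split => [j|z|T Ts].
- by exists N, (g j).
- under eq_bigr do rewrite dotE.
  have /andP[_ h] := gP (ell_trunc N z); apply: le_trans h _.
  exact: ell_trunc_norm_le.
have [c1 Tc] := cP T; have NT := NP T Ts.
set y := ell_pad q1 _ in NT *.
have yn : `|y| = `|ell_trunc N (c T)| := ell_norm_pad _.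
have dC : d <= e / C by rewrite ge_min lexx orbT.
have de : d <= e by rewrite ge_min lexx.
split.
- by rewrite yn -c1 ell_trunc_norm_le.
- have h1 : `|T (c T - y)| <= e.
    apply: le_trans (ler_operator_norm T _) _.
    apply: (@le_trans _ _ (C * (e / C))).
      apply: ler_pM => //; [exact: operator_norm_ge0|exact: CP|exact: le_trans NT dC].
    by rewrite mulrC divfK// gt_eqF.
  have : `|T (c T)| <= `|T y| + `|T (c T - y)|.
    by rewrite -{1}(subrK y (c T)) linearD addrC ler_normD.
  by move=> h2; exact: (trunc_arith e_eps Tc h2 h1).
- have -> : \sum_j `|\sum_(i < N) g j 0 i * (y : nat -> R) i| =
      \sum_j `|dot (g j) (ell_trunc N (c T))|.
    apply: eq_bigr => j _; rewrite dotE; congr (`|dot _ _|).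
    by apply/rowP => i; rewrite !mxE /y ?ell_padE padE mxE.
  have /andP[h _] := gP (ell_trunc N (c T)); apply: le_trans h.
  have : 1 - e <= `|ell_trunc N (c T)|.
    rewrite lerBlDr -yn -[X in X <= _]c1 -{1}(subrK y (c T)) addrC.
    by rewrite (le_trans (ler_normD _ _))// lerD2l (le_trans NT).
  have e1' : 0 <= 1 - e by rewrite subr_ge0.
  by move=> /(ler_wpM2l e1'); apply: le_trans; exact: one_sub_sqr.
Qed.

Lemma ellinf_coord_le (q1 : (1 <= +oo :> \bar R)%E) (b : ell q1) k : `|b k| <= `|b|.
Proof.
rewrite -lee_fin; have -> : `|b|%:E = 'N[@counting nat R]_(+oo)[EFin \o b]%E.
  exact: finite_norm_fine.
rewrite unlock /Lnorm ifT.
  by have := counting_ae (ess_sup_ge (@counting nat R) (abse \o (EFin \o b))) k.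
by rewrite /= /counting asboolF//; exact: infinite_nat.
Qed.

Lemma ellinf_norm_le (q1 : (1 <= +oo :> \bar R)%E) (b : ell q1) M : 
  (forall k, `|b k| <= M) -> `|b| <= M.
Proof.
move=> bM; rewrite -lee_fin.
have -> : `|b|%:E = 'N[@counting nat R]_(+oo)[EFin \o b]%E.
  exact: finite_norm_fine.
rewrite unlock /Lnorm ifT.
  by apply/ess_supP; apply: filterE => k /=; rewrite lee_fin.
by rewrite /= /counting asboolF//; exact: infinite_nat.
Qed.

(** In the sup norm coordinate 0 can be moved within [[-1, 1]] without leaving the ball. *)
Lemma ellinf_nearly_norming (q1 : (1 <= +oo :> \bar R)%E) :
  nearly_norming (Z := ell q1) X [set fun b : ell q1 => (b : nat -> R) 0%N].
Proof.
pose e : ell q1 := ell_pad q1 (const_mx 1 : 'rV[R]_1).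
have e0 : e 0%N = 1.
  by have := padE (const_mx 1 : 'rV[R]_1) ord0; rewrite mxE.
have eS k : e k.+1 = 0 by rewrite /e ?ell_padE pad0.
apply: (@sup_nearly_norming R (ell q1) X (fun b : ell q1 => (b : nat -> R) 0%N) e) => //.
- by move=> b; exact: ellinf_coord_le.
- move=> z t z1 zt; apply: ellinf_norm_le => -[|k].
    have -> : (z + t *: e) 0%N = z 0%N + t by rewrite [LHS]/(z 0%N + t * e 0%N) e0 mulr1.
    by [].
  have -> : (z + t *: e) k.+1 = z k.+1.
    by rewrite [LHS]/(z k.+1 + t * e k.+1) eS mulr0; exact: addr0.
  by apply: le_trans z1; exact: ellinf_coord_le.
Qed.

Lemma ellninf_nearly_norming (q1 : (1 <= +oo :> \bar R)%E) n :
  nearly_norming (Z := elln q1 n.+1) X [set dot g | g in [set: 'rV[R]_n.+1]].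
Proof.
move=> s eps eps0.
pose e : elln q1 n.+1 := delta_mx 0 0.
have [|||z t z1 zt|b [J [phi [phiP phi1 bP]]]] :=
  @sup_nearly_norming R (elln q1 n.+1) X (dot (delta_mx 0 0)) e _ _ _ _ s eps eps0.
- by move=> a x y; rewrite !dot_delta !mxE.
- by rewrite dot_delta mxE !eqxx.
- by move=> z; rewrite dot_delta elln_coord_le.
- rewrite elln_normE /elln_norm; apply/bigmax_leP; split => // i _.
  rewrite !mxE eqxx/=; have [->|i0] := eqVneq i 0.
    by move: zt; rewrite dot_delta mulr1.
  by rewrite mulr0 addr0 (le_trans _ z1)// elln_coord_le.
exists b, J, phi; split => // j.
by rewrite (phiP j); exists (delta_mx 0 0).
Qed.

End sequence_spaces.

(** * Failure for q > 2 *)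

Lemma test_arith (R : realFieldType) (D mi b x a M S : R) :
  D <= mi * b -> x * a <= M -> S <= 0 ->
  2 * (D - M) + S + (2 * x * a - 2 * mi * b) <= 0.
Proof. by move=> *; lra. Qed.

(** * An inequality valid in L_1 *)

Section zonoid_inequality.
Variables (R : realType) (m : nat) (x : R).
Hypothesis m0 : (0 < m)%N.

Let mR : 0 < m%:R :> R. Proof. by rewrite ltr0n. Qed.

Definition slope (j : 'I_(2 * m).+1) : R := j%:R / m%:R - 1.

Definition direction (w : bool * 'I_(2 * m).+1) : 'rV[R]_3 :=
  \row_(k < 3) (if k == 0 then 0 else if (k == 1) == w.1 then 1 else slope w.2).

Lemma slope_near (r : R) : `|r| <= 1 -> exists j, `|slope j - r| <= m%:R^-1.
Proof.
rewrite ler_norml => /andP[r1 r2].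
have z0 : 0 <= (r + 1) * m%:R by rewrite mulr_ge0//; lra.
pose k : nat := Num.trunc ((r + 1) * m%:R).
have /andP[k1 k2] := truncn_itv z0.
have km : (k < (2 * m).+1)%N.
  rewrite ltnS -(ler_nat R) (le_trans k1)// natrM ler_wpM2r//; lra.
exists (Ordinal km); rewrite /slope/= -/k in k1 k2 *.
have h1 : k%:R / m%:R <= r + 1 by rewrite ler_pdivrMr.
have h2 : r + 1 <= (k%:R + 1) / m%:R by rewrite ler_pdivlMr// natr1 ltW.
have h3 : 0 <= m%:R^-1 :> R by rewrite invr_ge0.
by rewrite mulrDl mul1r in h2; rewrite ler_norml; apply/andP; split; lra.
Qed.

Lemma norm_slope j : `|slope j| <= 1.
Proof.
have h1 : j%:R / m%:R <= 2 :> R.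
  by rewrite ler_pdivrMr// -natrM ler_nat -ltnS.
have h2 : 0 <= j%:R / m%:R :> R by rewrite divr_ge0.
by rewrite /slope ler_norml; apply/andP; split; lra.
Qed.

(** On the plane of the last two coordinates [g] kills a vector with an entry 1 at its smaller
    coefficient and the other entry in [[-1, 1]]; that entry is rounded to the grid. *)
Lemma direction_near (g : 'rV[R]_3) : exists w,
  `|dot (direction w) g| <= m%:R^-1 * (`|g 0 1| + `|g 0 2|).
Proof.
have dotE w : dot (direction w) g =
    (if w.1 then g 0 1 + slope w.2 * g 0 2 else slope w.2 * g 0 1 + g 0 2).
  rewrite /dot !big_ord_recl big_ord0 !mxE/= mul0r add0r addr0.
  have -> : lift ord0 ord0 = 1 :> 'I_3 by exact/val_inj.
  have -> : lift ord0 (lift ord0 ord0) = 2 :> 'I_3 by exact/val_inj.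
  by case: (w.1) => /=; rewrite mul1r.
have mi : 0 <= m%:R^-1 :> R by rewrite invr_ge0 ltW.
have key (a b : R) : `|b| <= `|a| -> exists j, `|slope j * a + b| <= m%:R^-1 * `|a|.
  move=> ba; have [a0|an] := eqVneq a 0.
    exists ord0; move: ba; rewrite a0 normr0 normr_le0 => /eqP ->.
    by rewrite !mulr0 addr0 normr0.
  have [|j hj] := @slope_near (- b / a).
    by rewrite normrM normrN normfV ler_pdivrMr ?normr_gt0// mul1r.
  exists j; have -> : slope j * a + b = (slope j - - b / a) * a by field.
  by rewrite normrM ler_wpM2r.
have [ba|ab] := leP `|g 0 2| `|g 0 1|.
  have [j hj] := key _ _ ba; exists (false, j); rewrite dotE/= (le_trans hj)//.
  by rewrite ler_wpM2l// lerDl.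
have [j hj] := key _ _ (ltW ab); exists (true, j); rewrite dotE/= addrC (le_trans hj)//.
by rewrite ler_wpM2l// lerDr.
Qed.

(** One family, as [l1_inequalities] requires: [inl (w, k)] lists [x e_0 + v], [x e_0 - v] and [v]
    for each direction [v], and [inr k] the basis vectors. *)
Definition test_index : finType := ((bool * 'I_(2 * m).+1) * 'I_3 + 'I_3)%type.

Definition test_weight (i : test_index) : R :=
  match i with
  | inl (_, k) => if k == 2 then 2 else -1
  | inr k => if k == 0 then 2 * x else - (2 / m%:R)
  end.

Definition test_vector (i : test_index) : 'rV[R]_3 :=
  match i with
  | inl (w, k) => if k == 2 then direction w
      else if k == 0 then x *: delta_mx 0 0 + direction w
      else x *: delta_mx 0 0 - direction w
  | inr k => delta_mx 0 k
  end.

Lemma test_sumE (L : 'rV[R]_3 -> R) :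
  \sum_i test_weight i * L (test_vector i) =
  \sum_w (2 * L (direction w) - L (x *: delta_mx 0 0 + direction w)
    - L (x *: delta_mx 0 0 - direction w)) +
  (2 * x * L (delta_mx 0 0) - 2 / m%:R * (L (delta_mx 0 1) + L (delta_mx 0 2))).
Proof.
rewrite big_sumType/=; congr (_ + _).
  transitivity (\sum_w \sum_k test_weight (inl (w, k)) * L (test_vector (inl (w, k)))).
    by rewrite pair_bigA /=; apply: eq_bigr => -[].
  apply: eq_bigr => w _; rewrite !big_ord_recl big_ord0/=; ring.
rewrite !big_ord_recl big_ord0/=.
have -> : lift ord0 ord0 = 1 :> 'I_3 by exact/val_inj.
have -> : lift ord0 (lift ord0 ord0) = 2 :> 'I_3 by exact/val_inj.
ring.
Qed.

Hypothesis x0 : 0 <= x.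

(** By [norm_addsub] a direction with value [v] contributes [2 (|v| - max (x |g_0|) |v|) <= 0]. The
    one on which [g] nearly vanishes already offsets [2 x |g_0|], up to the correction terms. *)
Lemma test_real (g : 'rV[R]_3) :
  \sum_i test_weight i * `|dot (test_vector i) g| <= 0.
Proof.
rewrite (test_sumE (fun v => `|dot v g|)).
have dE k : dot (delta_mx 0 k) g = g 0 k.
  rewrite /dot (bigD1 k)//= mxE !eqxx mul1r big1 ?addr0// => l lk.
  by rewrite mxE (negbTE lk) andbF mul0r.
rewrite !dE.
have termE w : 2 * `|dot (direction w) g|
    - `|dot (x *: delta_mx 0 0 + direction w) g|
    - `|dot (x *: delta_mx 0 0 - direction w) g| =
    2 * (`|dot (direction w) g| - Num.max (x * `|g 0 0|) `|dot (direction w) g|).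
  rewrite dotDl dotBl dotZl dE -[RHS]/(2 * _).
  have := norm_addsub (x * g 0 0) (dot (direction w) g).
  rewrite normrM (ger0_norm x0); lra.
under eq_bigr do rewrite termE.
have [w0 hw0] := direction_near g.
rewrite (bigD1 w0)//=.
apply: (test_arith hw0).
  by rewrite le_max lexx.
by apply: sumr_le0 => w _; rewrite mulr_ge0_le0// subr_le0 le_max lexx orbT.
Qed.

Lemma test_inequality (X : normedModType R) (U : {linear 'rV[R]_3 -> X}) :
  l1_inequalities X -> \sum_i test_weight i * `|U (test_vector i)| <= 0.
Proof.
move=> ineq.
have UE v : U v = \sum_k v 0 k *: U (delta_mx 0 k).
  rewrite {1}(row_sum_delta v) linear_sum; apply: eq_bigr => k _.
  by rewrite linearZ.
rewrite (eq_bigr _ (fun i _ => congr1 (fun y => test_weight i * `|y|) (UE _))).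
apply: (ineq _ _ _ (fun i k => test_vector i 0 k)) => g.
have := test_real (\row_k g k); congr (_ <= _); apply: eq_bigr => i _.
by congr (_ * `|_|); apply: eq_bigr => k _; rewrite mxE.
Qed.

End zonoid_inequality.

Lemma powR_lt (R : realType) (r x y : R) :
  0 < r -> 0 <= x -> x < y -> x `^ r < y `^ r.
Proof.
move=> r0 x0 xy; apply: gt0_ltr_powR => //.
exact: le_trans x0 (ltW xy).
Qed.

(** With [t = x^q] it shows that leaving the plane of directions by [x] raises the l_q norm by at
    most [x^q]. *)
Lemma powRD_ge (R : realType) (q s t : R) : 1 <= q -> 1 <= s -> 0 <= t ->
  s `^ q + t <= (s + t) `^ q.
Proof.
move=> q1 s1 t0; have s0 : 0 < s by exact: lt_le_trans s1.
have -> : s + t = s * (1 + t / s) by field; rewrite gt_eqF.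
have ts : 0 <= t / s by rewrite divr_ge0// ltW.
rewrite powRM ?(ltW s0) ?addr_ge0//.
apply: (@le_trans _ _ (s `^ q * (1 + t / s))).
  rewrite mulrDr mulr1 lerD2l mulrCA ler_peMr// ler_pdivlMr// mul1r.
  exact: le1r_powR.
by rewrite ler_wpM2l ?powR_ge0// le1r_powR// lerDl.
Qed.

(** Here [m'] stands for [1 / m], [K] counts directions and [k] is the isometry defect. For
    [x = 4 / m] the gain [2 x] is [8 / m], and the corrections consume [4 / m] of it. *)
Lemma test_arith_final (R : realFieldType) (I : finType) (K m' x xq k : R)
    (s l l1 l2 : I -> R) (L0 L1 L2 : R) :
  K = #|I|%:R -> 0 <= k -> 0 <= m' -> x = 4 * m' ->
  (forall w, 1 <= s w <= 2) -> (forall w, (1 - k) * s w <= l w) ->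
  (forall w, l1 w <= s w + xq) -> (forall w, l2 w <= s w + xq) ->
  1 - k <= L0 -> L1 <= 1 -> L2 <= 1 ->
  \sum_w (2 * l w - l1 w - l2 w) + (2 * x * L0 - 2 * m' * (L1 + L2)) <= 0 ->
  4 * m' <= 2 * (K * xq) + k * (4 * K + 8 * m').
Proof.
move=> -> k0 m0 -> s12 hl hl1 hl2 h0 h1 h2 h.
have : \sum_(w : I) (- (4 * k) - 2 * xq) <= \sum_w (2 * l w - l1 w - l2 w).
  apply: ler_sum => w _; have /andP[sw1 sw2] := s12 w.
  have := hl w; have := hl1 w; have := hl2 w; have := ler_wpM2l k0 sw2; lra.
rewrite sumr_const -[_ *+ _]mulr_natr => hs.
have := ler_wpM2l m0 h0; have := ler_wpM2l m0 h1; have := ler_wpM2l m0 h2.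
lra.
Qed.

Lemma mesh_factor (R : realFieldType) (K m : R) : m != 0 ->
  4 * K + 8 * m^-1 = (4 * K * m + 8) * m^-1.
Proof. by move=> m0; field. Qed.

Lemma mesh_contradiction (R : realFieldType) (u m : R) :
  0 < m -> 2 * u <= 2 * m -> 4 * m <= 2 * u + m -> False.
Proof. by move=> *; lra. Qed.

Lemma mesh_exists (R : realType) (q : R) : 2 < q -> exists2 m : nat, (0 < m)%N &
  (* There are at most [6 m] directions. With [4 / m <= t] and [t^(q - 2) = 1/96], the constant 96,
     six times the square of 4, leaves exactly [2 / m]. *)
  2 * ((2 * (2 * m).+1)%:R * (4 / m%:R) `^ q) <= 2 / m%:R :> R.
Proof.
move=> q2; pose t : R := 96 `^ (- (q - 2)^-1).
have qB : 0 < q - 2 by rewrite subr_gt0.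
have t0 : 0 < t by exact: powR_gt0.
have tq : t `^ (q - 2) = 96^-1.
  by rewrite /t -powRrM mulNr mulVf ?gt_eqF// powR_inv1.
pose m : nat := (Num.trunc (4 / t)).+1; exists m => //.
have mR : 0 < m%:R :> R by rewrite ltr0n.
have m1 : 1 <= m%:R :> R by rewrite ler1n.
have fm : 4 / m%:R <= t.
  have h0 : 0 <= 4 / t by rewrite divr_ge0// ltW.
  have /andP[_ h] := truncn_itv h0.
  by rewrite ler_pdivrMr// mulrC -ler_pdivrMr// ltW.
have f0 : 0 <= 4 / m%:R :> R by rewrite divr_ge0.
have -> : (4 / m%:R) `^ q = (4 / m%:R) `^ (q - 2) * (4 / m%:R) ^+ 2 :> R.
  rewrite -powR_mulrn// -powRD ?subrK//.
  have fp : 0 < 4 / m%:R :> R by rewrite divr_gt0.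
  by rewrite (gt_eqF fp) implybT.
have : (4 / m%:R) `^ (q - 2) <= 96^-1 :> R.
  by rewrite -tq ge0_ler_powR ?nnegrE ?(ltW qB) ?(ltW t0).
move: (_ `^ _) => z hz.
have K3 : (2 * (2 * m).+1)%:R <= 6 * m%:R :> R.
  by rewrite natrM -(natr1 (2 * m)%N) natrM; move: m1; clear; move: (m%:R) => u; lra.
have h1 : z * (4 / m%:R) ^+ 2 <= 96^-1 * (4 / m%:R) ^+ 2.
  by rewrite ler_wpM2r// sqr_ge0.
have h2 : 0 <= 96^-1 * (4 / m%:R) ^+ 2 :> R by rewrite mulr_ge0// sqr_ge0.
apply: (@le_trans _ _ (2 * ((6 * m%:R) * (96^-1 * (4 / m%:R) ^+ 2)))).
  rewrite ler_wpM2l//; apply: (@le_trans _ _ ((2 * (2 * m).+1)%:R * (96^-1 * (4 / m%:R) ^+ 2))).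
    by rewrite ler_wpM2l.
  by rewrite ler_wpM2r.
have -> : 2 * (6 * m%:R * (96^-1 * (4 / m%:R) ^+ 2)) = 2 / m%:R :> R.
  by field; rewrite gt_eqF.
by [].
Qed.

(** * Octahedrality contradicted by a copy of l_q^3 *)

Section not_octahedral.
Variables (R : realType) (Z X : normedModType R) (q : R) (H : set 'L(Z, X)).
Hypothesis q2 : 2 < q.
Variables (J : {linear 'rV[R]_3 -> Z}) (f : 'I_3 -> Z -> R) (x0 : X).
Hypothesis JN : forall c, `|J c| `^ q = sumpow q c.
Hypothesis flin : forall i, linear (f i).
Hypothesis x01 : `|x0| = 1.
Hypothesis fH : forall i, exists2 T, H T & forall z, T z = f i z *: x0.
Hypothesis Hsub : closed_subspace H.
Hypothesis dual : forall c, sumpow q c = 1 -> exists a : 'rV[R]_3,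
  \sum_i a 0 i * f i (J c) = 1 /\ forall z, `|\sum_i a 0 i * f i z| <= `|z|.
Hypothesis clarkson : forall z w : Z, `|z| <= 1 -> `|w| <= 1 ->
  `|z + w| `^ q + `|z - w| `^ q <= 2 `^ q.

Let q0 : 0 < q. Proof. exact: lt_trans q2. Qed.

(** Tensor a functional norming [J c] with [x0] to get [S]. A point [b] where [S + y] is nearly
    normed does so for [S] and [y] separately; the former puts [b] near [J c], up to sign, by
    uniform convexity, and then the latter passes to [J c]. *)
Lemma octahedral_isometry (d : R) : octahedral H -> 0 < d < 1 ->
  exists2 y : 'L(Z, X), `|y| = 1 & forall c, sumpow q c = 1 -> 1 - 2 * d <= `|y (J c)|.
Proof.
move=> octa /andP[d0 d1].
have d2 : 0 < (d / 2) `^ q < 1.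
  rewrite powR_gt0 ?divr_gt0//=.
  have e1 : (1 : R) `^ q = 1 by rewrite powR1.
  have d21 : d / 2 < 1 by lra.
  rewrite -[X in _ < X]e1; apply: powR_lt => //.
  by rewrite divr_ge0// ltW.
have /andP[d20 d21] := d2.
(* The modulus of convexity: by [clarkson], [|b + J c| >= 2 (1 - eta)] forces [|b - J c| <= d]. *)
have [eta [eta0 eta1 etaE]] : exists eta, [/\ 0 < eta, eta <= 1 &
    (1 - eta) `^ q = 1 - (d / 2) `^ q].
  exists (1 - (1 - (d / 2) `^ q) `^ q^-1); split.
  - have e1 : (1 : R) `^ q^-1 = 1 by rewrite powR1.
    rewrite subr_gt0 -[X in _ < X]e1.
    have h1 : 1 - (d / 2) `^ q < 1 by lra.
    by apply: powR_lt => //; rewrite ?invr_gt0// subr_ge0 ltW.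
  - by rewrite gerBl powR_ge0.
  - rewrite opprB addrC subrK -powRrM mulVf ?gt_eqF// powRr1//; lra.
(* This ensures [3 e <= 2 eta] for the convexity and [3 e <= d] for the final bound. *)
pose e := Num.min (eta / 2) (d / 3).
have e0 : 0 < e by rewrite lt_min; apply/andP; split; lra.
have e_eta : e <= eta / 2 by rewrite ge_min lexx.
have e_d : e <= d / 3 by rewrite ge_min lexx orbT.
have /choice[T TP] : forall i, exists T, H T /\ forall z, T z = f i z *: x0.
  by move=> i; have [T HT Tz] := fH i; exists T.
pose E := lin_span [set` [seq T i | i : 'I_3]].
have Espan (a : 'rV[R]_3) : E (\sum_i a 0 i *: T i).
  exists 3%N, (fun i => a 0 i), T; split => // i /=.
  by apply: map_f; rewrite mem_enum.
have EH : E `<=` H.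
  move=> _ [n [c [S [SE ->]]]]; apply: (subspace_sum Hsub) => i.
  apply: (subspaceZ Hsub); have /mapP[j _ ->] := SE i; exact: (TP j).1.
have [y [_ y1 yE]] := octa E e (ex_intro _ _ erefl) EH e0.
exists y => // c c1; have [a [ac a_le]] := dual c1.
pose S := \sum_i a 0 i *: T i.
have SE z : S z = (\sum_i a 0 i * f i z) *: x0.
  rewrite /S bounded_operator_sumE scaler_suml; apply: eq_bigr => i _.
  by rewrite [LHS]/(a 0 i *: T i z) (TP i).2; exact: scalerA.
have Sn z : `|S z| = `|\sum_i a 0 i * f i z| by rewrite SE normrZ x01 mulr1.
have Jc1 : `|J c| = 1.
  have e1 : `|J c| `^ q = 1 `^ q by rewrite JN c1 powR1.
  by apply/eqP; rewrite eq_le; apply/andP; split; apply: (powR_le_inv q0); rewrite ?e1.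
have S1 : 1 <= `|S|.
  have := operator_eval_le S (z := J c); rewrite Sn ac normr1 Jc1.
  by apply; rewrite lexx.
have Sy : 2 - 2 * e <= `|S + y|.
  have := yE S 1 (Espan a); rewrite scale1r normr1.
  have := @ler_wpM2l R (1 - e) _ _ _ S1; lra.
have [b b1 hb] := operator_norm_adherent (S + y) e0.
wlog fb : b b1 hb / 0 <= \sum_i a 0 i * f i b.
  move=> wl; have [fb|/ltW fb] := leP 0 (\sum_i a 0 i * f i b); first exact: (wl b).
  apply: (wl (- b)); rewrite ?normrN// ?linearN ?normrN//.
  rewrite (eq_bigr (fun i => - (a 0 i * f i b))) ?sumrN ?oppr_ge0// => i _.
  have := flin i (-1) b 0; rewrite scaleN1r addr0 => ->.
  have := flin i (-1) 0 0; rewrite scaler0 addr0 => e00.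
  have -> : f i 0 = 0.
    by move: e00; rewrite -[-1 *: f i 0]/(-1 * f i 0); lra.
  by rewrite addr0 -[-1 *: f i b]/(-1 * f i b) mulN1r mulrN.
have Syb : `|(S + y) b| <= \sum_i a 0 i * f i b + `|y b|.
  rewrite [X in `|X|]/(S b + y b) (le_trans (ler_normD _ _))// lerD2r Sn.
  by rewrite ger0_norm.
have yb1 : `|y b| <= 1 by rewrite -y1 operator_eval_le.
have fb1 : \sum_i a 0 i * f i b <= 1.
  by apply: (le_trans (ler_norm _)); exact: le_trans (a_le b) b1.
have fb_ge : 1 - 3 * e <= \sum_i a 0 i * f i b by lra.
have yb_ge : 1 - 3 * e <= `|y b| by lra.
have fbc : \sum_i a 0 i * f i (b + J c) = \sum_i a 0 i * f i b + 1.
  rewrite -ac -big_split; apply: eq_bigr => i _ /=.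
  have := flin i 1 b (J c); rewrite !scale1r => ->.
  by rewrite mulrDr.
have bc : 2 - 3 * e <= `|b + J c|.
  apply: le_trans (a_le _); apply: le_trans (ler_norm _); rewrite fbc; lra.
have bc' : `|b - J c| <= d.
  apply: (powR_le_inv q0); rewrite ?(ltW d0)//.
  have Jc1' : `|J c| <= 1 by rewrite Jc1.
  have h1 := clarkson b1 Jc1'.
  have h2 : (2 * (1 - eta)) `^ q <= `|b + J c| `^ q.
    rewrite ge0_ler_powR ?nnegrE ?(ltW q0)//; lra.
  have e1 : (2 * (1 - eta)) `^ q = 2 `^ q - d `^ q.
    rewrite powRM// ?subr_ge0// etaE mulrBr mulr1 -powRM ?divr_ge0 ?(ltW d0)//.
    by rewrite mulrC divfK.
  by move: h1; rewrite e1 in h2; move: (`|b - J c| `^ q) => u h1; lra.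
have : `|y b| <= `|y (J c)| + `|y (b - J c)|.
  by rewrite -{1}(subrK (J c) b) linearD addrC ler_normD.
have : `|y (b - J c)| <= `|b - J c|.
  by have := ler_operator_norm y (b - J c); rewrite -bounded_operator_normE y1 mul1r.
lra.
Qed.

Lemma not_octahedral : l1_inequalities X -> ~ octahedral H.
Proof.
move=> ineq octa.
have [m m0 mP] := mesh_exists q2.
have mR : 0 < m%:R :> R by rewrite ltr0n.
pose x : R := 4 / m%:R.
have x_ge0 : 0 <= x by rewrite divr_ge0.
pose K : R := (2 * (2 * m).+1)%:R.
have K0 : 0 <= K by exact: ler0n.
(* Then the total loss [k (4 K + 8 / m)] due to the isometry defect is exactly [1 / m]. *)
have [k kE] : exists k : R, k = (4 * K * m%:R + 8)^-1 by exists (4 * K * m%:R + 8)^-1.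
have k0 : 0 < k by rewrite kE invr_gt0 ltr_wpDl ?mulr_ge0.
have Km : 0 <= 4 * K * m%:R by rewrite !mulr_ge0// ltW.
have k1 : k <= 1 by rewrite kE invf_le1; [lra|rewrite ltr_wpDl].
have d01 : 0 < k / 2 < 1 by apply/andP; split; lra.
have [y y1 yP] := octahedral_isometry octa d01.
have k2 : 2 * (k / 2) = k by field.
have y_le z : `|y z| <= `|z|.
  by have := ler_operator_norm y z; rewrite -bounded_operator_normE y1 mul1r.
have y_ge c : (1 - k) * `|J c| <= `|y (J c)|.
  have [Jc0|Jcn] := eqVneq `|J c| 0; first by rewrite Jc0 mulr0.
  have Jc_gt0 : 0 < `|J c| by rewrite lt_neqAle eq_sym Jcn normr_ge0.
  have c1 : sumpow q (`|J c|^-1 *: c) = 1.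
    rewrite sumpowZ -JN normfV normr_id -powRM ?invr_ge0//.
    by rewrite mulVf// powR1.
  have yJ : y (J (`|J c|^-1 *: c)) = `|J c|^-1 *: y (J c) by rewrite !linearZ.
  have := yP _ c1; rewrite k2 yJ normrZ normfV normr_id ler_pdivlMl//.
  by rewrite mulrC.
have := test_inequality m0 x_ge0 (y \o J) ineq.
rewrite (test_sumE m x (fun v => `|(y \o J) v|)).
have m'0 : 0 <= m%:R^-1 :> R by rewrite invr_ge0 ltW.
have J1 i : `|J (delta_mx 0 i)| = 1.
  have : `|J (delta_mx 0 i)| `^ q = 1 `^ q.
    rewrite JN powR1 /sumpow (bigD1 i)//= mxE !eqxx normr1 powR1 big1 ?addr0// => l li.
    by rewrite mxE (negbTE li) andbF normr0 powR0// gt_eqF.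
  by move=> e; apply/eqP; rewrite eq_le; apply/andP; split;
    apply: (powR_le_inv q0); rewrite ?e.
have JwE w : `|J (direction R w)| `^ q = 1 + `|slope R w.2| `^ q.
  rewrite JN /sumpow !big_ord_recl big_ord0 !mxE/= normr0.
  rewrite powR0 ?(gt_eqF q0)// add0r addr0.
  by case: (w.1) => /=; rewrite normr1 powR1// addrC.
have sl1 j : `|slope R (m := m) j| `^ q <= 1.
  have <- : (1 : R) `^ q = 1 by rewrite powR1.
  by rewrite ge0_ler_powR ?nnegrE ?(ltW q0)//; exact: norm_slope.
have Jw12 w : 1 <= `|J (direction R (m := m) w)| <= 2.
  apply/andP; split; apply: (powR_le_inv q0) => //; rewrite JwE.
    by rewrite powR1 lerDl powR_ge0.
  apply: (@le_trans _ _ 2); first by rewrite -[leRHS]/(1 + 1) lerD2l.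
  by rewrite le1r_powR// ?ler1n// (le_trans _ (ltW q2))// ler1n.
have Jpm w (s : R) : `|s| = 1 ->
    `|J (x *: delta_mx 0 0 + s *: direction R w)| <= `|J (direction R (m := m) w)| + x `^ q.
  move=> s1; apply: (powR_le_inv q0) => //; first by rewrite addr_ge0// powR_ge0.
  have /andP[w1 _] := Jw12 w.
  apply: le_trans (powRD_ge _ w1 (powR_ge0 _ _)); last first.
    by rewrite (le_trans _ (ltW q2))// ler1n.
  rewrite !JN /sumpow !big_ord_recl !big_ord0 !mxE/=.
  rewrite !mulr0 !mulr1 !addr0 !add0r normr0 powR0 ?(gt_eqF q0)// add0r.
  by rewrite !(normrM s) s1 !mul1r (ger0_norm x_ge0) addrC.
have arith := @test_arith_final R _ K m%:R^-1 x (x `^ q) k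
  (fun w => `|J (direction R (m := m) w)|) (fun w => `|y (J (direction R w))|)
  (fun w => `|y (J (x *: delta_mx 0 0 + direction R w))|)
  (fun w => `|y (J (x *: delta_mx 0 0 - direction R w))|)
  `|y (J (delta_mx 0 0))| `|y (J (delta_mx 0 1))| `|y (J (delta_mx 0 2))|.
have {}arith := arith _ (ltW k0) m'0 erefl Jw12 (fun w => y_ge _).
move=> test.
have : 4 * m%:R^-1 <= 2 * (K * x `^ q) + k * (4 * K + 8 * m%:R^-1).
  apply: arith => //.
  - by rewrite /K card_prod card_bool card_ord.
  - move=> w; apply: (le_trans (y_le _)).
    by have := Jpm w 1 (normr1 _); rewrite scale1r.
  - move=> w; apply: (le_trans (y_le _)).
    by have := Jpm w (-1) (normrN1 _); rewrite scaleN1r.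
  - by have := y_ge (delta_mx 0 0); rewrite J1 mulr1.
  - by rewrite -(J1 1).
  - by rewrite -(J1 2).
have -> : k * (4 * K + 8 * m%:R^-1) = m%:R^-1.
  have -> : 4 * K + 8 * m%:R^-1 = (4 * K * m%:R + 8) * m%:R^-1.
    by rewrite mesh_factor// gt_eqF.
  by rewrite kE mulrA mulVf ?mul1r// gt_eqF// ltr_wpDl.
have mi : 0 < m%:R^-1 :> R by rewrite invr_gt0.
(* What is left is [4 / m <= 2 / m + 1 / m]. *)
by move=> h; exact: (mesh_contradiction mi mP h).
Qed.

End not_octahedral.

(** * Spaces of operators on l_q *)

Section exponents.
Variable R : realType.

Lemma powR_superadd (t u v : R) : 1 <= t -> 0 <= u -> 0 <= v ->
  u `^ t + v `^ t <= (u + v) `^ t.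
Proof.
move=> t1 u0 v0; have t0 : 0 < t by exact: lt_le_trans t1.
rewrite -!(mulr_powRB1 _ t0) ?addr_ge0// mulrDl.
have tB : 0 <= t - 1 by rewrite subr_ge0.
have uv : 0 <= u + v by exact: addr_ge0.
by apply: lerD; apply: ler_wpM2l => //; apply: ge0_ler_powR => //;
  rewrite ?lerDl ?lerDr.
Qed.

(** The parallelogram identity raised to the power [t = s / 2 >= 1]: superadditivity on the left,
    midpoint convexity on the right. *)
Lemma clarkson_real (s x y : R) : 2 <= s ->
  `|x + y| `^ s + `|x - y| `^ s <= 2 `^ s * ((`|x| `^ s + `|y| `^ s) / 2).
Proof.
move=> s2; pose t := s / 2.
have t1 : 1 <= t by rewrite ler_pdivlMr// mul1r.
have powE (z : R) : `|z| `^ s = (z ^+ 2) `^ t.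
  rewrite -[z ^+ 2]real_normK ?num_real// -powR_mulrn// -powRrM.
  by congr (_ `^ _); rewrite /t mulrC divfK.
have pow2 : 2 `^ s = 4 `^ t :> R.
  by have := powE 2; rewrite ger0_norm// => ->; congr (_ `^ _); rewrite expr2 -natrM.
rewrite pow2 !powE; apply: le_trans (powR_superadd t1 (sqr_ge0 _) (sqr_ge0 _)) _.
have -> : (x + y) ^+ 2 + (x - y) ^+ 2 = 4 * ((x ^+ 2 + y ^+ 2) / 2) by field.
rewrite powRM ?divr_ge0 ?addr_ge0 ?sqr_ge0// ler_wpM2l ?powR_ge0//.
exact: powR_mid t1 (sqr_ge0 _) (sqr_ge0 _).
Qed.

Lemma hoelder_conjugate_fin (r : R) : 1 < r ->
  hoelder_conjugate r%:E = (r / (r - 1))%:E.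
Proof.
move=> r1; have r0 : 0 < r by exact: lt_trans r1.
rewrite /hoelder_conjugate/= eqe gt_eqF// -EFinB inver.
by rewrite gt_eqF ?subr_gt0// -EFinM.
Qed.

Lemma dual_vector n (r s : R) (c : 'rV[R]_n) : 1 < s -> (s - 1) * r = s ->
  sumpow s c = 1 ->
  exists a : 'rV[R]_n, dot a c = 1 /\ sumpow r a = 1.
Proof.
move=> s1 rs c1; have s0 : 0 < s by exact: lt_trans s1.
exists (\row_i (Num.sg (c 0 i) * `|c 0 i| `^ (s - 1))); split; rewrite -[RHS]c1.
  apply: eq_bigr => i _; rewrite mxE mulrAC -normrEsg mulr_powRB1//.
apply: eq_bigr => i _; rewrite mxE normrM normr_sg.
rewrite (ger0_norm (powR_ge0 _ _)).
have [->|ci] := eqVneq (c 0 i) 0.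
  have r0 : r != 0.
    by apply/eqP => r0; move: s0; rewrite -rs r0 mulr0 ltxx.
  by rewrite mul0r normr0 (powR0 r0) (powR0 (lt0r_neq0 s0)).
by rewrite mul1r -powRrM rs.
Qed.

End exponents.

Section repad.
Variables (R : realType) (m n : nat).
Implicit Types (c a : 'rV[R]_m).

Definition repad c : 'rV[R]_n := \row_(i < n) pad c i.

Lemma repad_linear : linear repad.
Proof. by move=> a x y; apply/rowP => i; rewrite !mxE pad_lin. Qed.

HB.instance Definition _ :=
  GRing.isLinear.Build R 'rV[R]_m 'rV[R]_n _ repad repad_linear.

Hypothesis mn : (m <= n)%N.

Lemma pad_repad c k : pad (repad c) k = pad c k.
Proof.
have [kn|nk] := ltnP k n; last by rewrite !pad0// (leq_trans mn).
by have := padE (repad c) (Ordinal kn); rewrite mxE.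
Qed.

Lemma sum_pad (F : R -> nat -> R) c : (forall k, F 0 k = 0) ->
  \sum_(i < n) F (pad c i) i = \sum_(i < m) F (c 0 i) i.
Proof.
move=> F0; rewrite -(big_mkord xpredT (fun k => F (pad c k) k)).
rewrite (big_cat_nat (leq0n m) mn)/= [X in _ + X]big_nat [X in _ + X]big1 ?addr0.
  by rewrite big_mkord; apply: eq_bigr => i _; rewrite padE.
by move=> k /andP[mk _]; rewrite pad0.
Qed.

Lemma sumpow_repad (s : R) c : s != 0 -> sumpow s (repad c) = sumpow s c.
Proof.
move=> s0; rewrite /sumpow -(@sum_pad (fun z _ => `|z| `^ s)).
  by apply: eq_bigr => i _; rewrite mxE.
by move=> _; rewrite normr0 powR0.
Qed.

Lemma dot_repad c (z : 'rV[R]_n) : dot (repad c) z = \sum_(i < m) c 0 i * pad z i.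
Proof.
rewrite -(@sum_pad (fun x k => x * pad z k)); last by move=> k; rewrite mul0r.
by apply: eq_bigr => i _; rewrite mxE padE.
Qed.

End repad.

(** * Octahedrality and its failure for operators on l_q and l_q^n *)

Section ell_octahedral.
Variables (R : realType).

Lemma ell_pad_linear (q : \bar R) (q1 : (1 <= q)%E) n : linear (@ell_pad R n q q1).
Proof. by move=> a x y; apply/LfuneqP => k; rewrite [LHS]ell_padE pad_lin. Qed.

HB.instance Definition _ (q : \bar R) (q1 : (1 <= q)%E) n :=
  GRing.isLinear.Build R 'rV[R]_n (ell q1) _ (@ell_pad R n q q1) (@ell_pad_linear q q1 n).

Lemma ell_clarkson (s : R) (q1 : (1 <= s%:E)%E) (z w : ell q1) : 2 <= s ->
  `|z| <= 1 -> `|w| <= 1 -> `|z + w| `^ s + `|z - w| `^ s <= 2 `^ s.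
Proof.
move=> s2 z1 w1; have s0 : 0 < s by exact: lt_le_trans s2.
suff main n : \sum_(k < n) `|(z + w) k| `^ s + \sum_(k < n) `|(z - w) k| `^ s <= 2 `^ s.
  apply: (ler_cvg_to (cvgD (@ell_norm_cvg R s q1 (z + w))
    (@ell_norm_cvg R s q1 (z - w))) (cvg_cst (2 `^ s))).
  by apply: nearW => n; exact: main.
rewrite -big_split/=.
apply: (@le_trans _ _ (\sum_(k < n) 2 `^ s * ((`|z k| `^ s + `|w k| `^ s) / 2))).
  by apply: ler_sum => k _; exact: clarkson_real.
rewrite -mulr_sumr ler_piMr ?powR_ge0// -mulr_suml big_split/= ler_pdivrMr// mul1r.
have le1 (u : ell q1) : `|u| <= 1 -> \sum_(k < n) `|u k| `^ s <= 1.
  move=> u1; apply: le_trans (ell_sum_le u n) _.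
  have e1 : (1 : R) `^ s = 1 by rewrite powR1.
  by rewrite -[leRHS]e1 ge0_ler_powR ?nnegrE ?(ltW s0).
by rewrite -[leRHS]/(1 + 1) lerD// le1.
Qed.

Lemma elln_clarkson (s : R) (q1 : (1 <= s%:E)%E) n (z w : elln q1 n) : 2 <= s ->
  `|z| <= 1 -> `|w| <= 1 -> `|z + w| `^ s + `|z - w| `^ s <= 2 `^ s.
Proof.
move=> s2; rewrite -!(ell_norm_pad (q1 := q1)) => z1 w1.
have := ell_clarkson s2 z1 w1.
by rewrite -(linearD (ell_pad q1)) -(linearB (ell_pad q1)).
Qed.

Lemma elln_hoelder (p : \bar R) (r s : R) (p1 : (1 <= p)%E) (q1 : (1 <= s%:E)%E) n
    (a : 'rV[R]_n) (z : elln q1 n) :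
  p = r%:E -> s%:E = hoelder_conjugate p -> sumpow r a = 1 ->
  `|dot a z| <= `|z|.
Proof.
move=> pr; subst p => pq a1.
have -> : dot a z = ell_pairing (ell_pad p1 a) (ell_pad q1 z).
  by rewrite ell_pairing_pad; apply: eq_bigr => i _; rewrite ?ell_padE padE.
apply: le_trans (ell_pairing_le pq _ _) _.
by rewrite !ell_norm_pad elln_normEfin a1 powR1 mul1r.
Qed.

Lemma ell_hoelder (p : \bar R) (r s : R) (p1 : (1 <= p)%E) (q1 : (1 <= s%:E)%E) n
    (a : 'rV[R]_n) (z : ell q1) :
  p = r%:E -> s%:E = hoelder_conjugate p -> sumpow r a = 1 ->
  `|\sum_(i < n) a 0 i * z i| <= `|z|.
Proof.
move=> pr; subst p => pq a1; rewrite -(ell_pairing_pad p1).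
apply: le_trans (ell_pairing_le pq _ _) _.
by rewrite !ell_norm_pad elln_normEfin a1 powR1 mul1r.
Qed.

Variable X : normedModType R.
Hypotheses (Xfar : l1_far X) (Xineq : l1_inequalities X).

Lemma l1_far_unit : exists x : X, `|x| = 1.
Proof.
have [h hP] := Xfar [::] unit ltr01.
exists (h tt); have [+ _] := hP (fun=> 1).
by rewrite !(big_pred1 tt) ?scale1r ?normr1//; case.
Qed.

Section positive.
Variables (p q : \bar R) (p1 : (1 <= p)%E) (q1 : (1 <= q)%E).
Variable pq : q = hoelder_conjugate p.

(** Requiring of [A] the finitely supported sequences covers l_p and c_0 together. *)
Lemma ell_octahedral (A : set (ell p1)) (H : set 'L(ell q1, X)) :
  (forall n (x : 'rV[R]_n), A (ell_pad p1 x)) ->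
  closed_subspace H -> ell_tensors q1 pq A X `<=` H ->
  q = +oo%E \/ (exists2 s : R, q = s%:E & 1 <= s <= 2) -> octahedral H.
Proof.
move=> Afin Hsub AH qcase.
apply: (nearly_norming_octahedral (Phi := finite_functional (q1 := q1)) Hsub Xfar).
  move=> _ x [n [a ->]]; exists (ell_tensor q1 pq (ell_pad p1 a) x).
    apply: AH; exists 1%N, (fun=> 1), (fun=> ell_tensor q1 pq (ell_pad p1 a) x).
    split; last by rewrite big_ord1 scale1r.
    by move=> _; exists (ell_pad p1 a) => //; exists x.
  by move=> z; rewrite /= ell_pairing_pad.
case: qcase => [qoo|[s qs /andP[s1 s2]]].
  clear AH H Hsub pq; subst q => t eps eps0.
  have [b [J [phi [phiP h1 h2]]]] :=
    @ellinf_nearly_norming R X q1 t eps eps0.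
  exists b, J, phi; split => // j; rewrite (phiP j).
  exists 1%N, (const_mx 1); apply/funext => z.
  by rewrite big_ord1 mxE mul1r.
clear AH H Hsub pq; subst q; apply: ell_nearly_norming => n.
move: s1; rewrite le_eqVlt => /predU1P[e1|s1]; last by apply: almost_l1_stable; rewrite s1.
by subst s; exact: almost_l1_one.
Qed.

Lemma elln_octahedral n (H : set 'L(elln q1 n, X)) :
  (0 < n)%N -> closed_subspace H -> elln_tensors q1 [set: elln p1 n] X `<=` H ->
  q = +oo%E \/ (exists2 s : R, q = s%:E & 1 <= s /\ (s <= 2 \/ (n <= 2)%N)) ->
  octahedral H.
Proof.
move=> n0 Hsub AH qcase.
apply: (@nearly_norming_octahedral R (elln q1 n) X H
  ([set dot g | g in [set: 'rV[R]_n]] : set (elln q1 n -> R)) Hsub Xfar).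
  move=> _ x [a _ <-]; exists (elln_tensor q1 (a : elln p1 n) x) => //.
  apply: AH; exists 1%N, (fun=> 1), (fun=> elln_tensor q1 (a : elln p1 n) x).
  split; last by rewrite big_ord1 scale1r.
  by move=> _; exists a => //; exists x.
case: qcase => [qoo|[s qs [s1 sn]]].
  clear AH H Hsub pq; subst q; case: n n0 => // n _; exact: ellninf_nearly_norming.
clear AH H Hsub pq; subst q; apply: elln_nearly_norming => //.
move: s1; rewrite le_eqVlt => /predU1P[e1|s1]; first by subst s; exact: almost_l1_one.
have [s2|s2] := leP s 2; first by apply: almost_l1_stable; rewrite s1.
case: sn => [s2'|n2]; first by move: s2; rewrite ltNge s2'.
case: n n0 n2 => [//|[_ _|[_ _|//]]]; first exact: almost_l1_line.
exact: almost_l1_plane.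
Qed.

End positive.

Section negative.
Variables (p q : \bar R) (p1 : (1 <= p)%E) (q1 : (1 <= q)%E).
Variable pq : q = hoelder_conjugate p.
Variables (r s : R).
Hypotheses (pr : p = r%:E) (qs : q = s%:E) (s2 : 2 < s) (rs : (s - 1) * r = s).

Let s1 : 1 < s. Proof. by rewrite (lt_trans _ s2)// ltr1n. Qed.

Lemma ell_not_octahedral (H : set 'L(ell q1, X)) :
  closed_subspace H -> ell_tensors q1 pq [set: ell p1] X `<=` H -> ~ octahedral H.
Proof.
move: q1 pq H; rewrite qs => q1' pq' H Hsub AH; have [x0 x01] := l1_far_unit.
apply: (not_octahedral (q := s) s2 (J := @ell_pad R 3 _ q1')
  (f := fun (i : 'I_3) (z : ell q1') => (z : nat -> R) i) (x0 := x0)) => //.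
- move=> c; rewrite -(@elln_norm_powR R s q1' 3 c).
  by congr (_ `^ _); exact: ell_norm_pad.
- move=> i; set T := ell_tensor q1' pq' (ell_pad p1 (delta_mx 0 i : 'rV[R]_3)) x0.
  exists T.
    apply: AH; exists 1%N, (fun=> 1), (fun=> T).
    split; last by rewrite big_ord1 scale1r.
    by move=> _; exists (ell_pad p1 (delta_mx 0 i : 'rV[R]_3)) => //; exists x0.
  move=> z; rewrite /= ell_pairing_pad; congr (_ *: _).
  rewrite (bigD1 i)//= mxE !eqxx mul1r big1 ?addr0// => l li.
  by rewrite mxE (negbTE li) andbF mul0r.
- move=> c c1; have [a [ac a1]] := dual_vector s1 rs c1; exists a; split.
    by rewrite -ac; apply: eq_bigr => i _; rewrite ?ell_padE padE.
  by move=> z; exact: (ell_hoelder p1 z pr pq' a1).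
- by move=> z w z1 w1; apply: ell_clarkson => //; exact: ltW.
Qed.

Lemma elln_not_octahedral n (H : set 'L(elln q1 n, X)) : (2 < n)%N ->
  closed_subspace H -> elln_tensors q1 [set: elln p1 n] X `<=` H -> ~ octahedral H.
Proof.
move: q1 pq H; rewrite qs => q1' pq' H n3 Hsub AH; have [x0 x01] := l1_far_unit.
have s0 : s != 0 by rewrite gt_eqF// (lt_trans ltr01).
have r0 : r != 0 by apply/eqP => r0; move: s0; rewrite -rs r0 mulr0 eqxx.
apply: (@not_octahedral R (elln q1' n) X s H s2 (@repad R 3 n)
  (fun (i : 'I_3) (z : elln q1' n) => pad z i) x0) => //.
- by move=> c; rewrite -(sumpow_repad n3)//; exact: elln_norm_powR.
- by move=> i a x y; rewrite pad_lin.
- move=> i.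
  set T := elln_tensor q1' (repad n (delta_mx 0 i : 'rV[R]_3) : elln p1 n) x0.
  exists T.
    apply: AH; exists 1%N, (fun=> 1), (fun=> T).
    split; last by rewrite big_ord1 scale1r.
    by move=> _; exists (repad n (delta_mx 0 i : 'rV[R]_3)) => //; exists x0.
  move=> z; congr (_ *: _); rewrite [LHS](dot_repad n3).
  rewrite (bigD1 i)//= mxE !eqxx mul1r big1 ?addr0// => l li.
  by rewrite mxE (negbTE li) andbF mul0r.
- move=> c c1; have [a [ac a1]] := dual_vector s1 rs c1; exists a; split.
    by rewrite -ac; apply: eq_bigr => i _; rewrite pad_repad// padE.
  move=> z; rewrite -dot_repad//.
  by apply: (elln_hoelder p1 z pr pq'); rewrite sumpow_repad.
- by move=> z w z1 w1; exact: (elln_clarkson (ltW s2) z1 w1).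
Qed.

End negative.
End ell_octahedral.

Theorem theorem3p10 (R : realType) (p : \bar R) (p1 : (1 <= p)%E)
    (X : normedModType R) (hX : X = L1 R \/ X = ell1 R) :
  (forall H : set 'L(ell (hoelder_conj_ge1 p1), X),
    closed_subspace H ->
    ell_tensors (hoelder_conj_ge1 p1) erefl [set: ell p1] X `<=` H ->
    octahedral H <-> ((2%:E <= p)%E \/ p = 1%E)) /\
  (forall H : set 'L(ell1 R, X),
    closed_subspace H ->
    ell_tensors (lexx 1%E) (esym hoelder_conjugatey) (c0 R) X `<=` H ->
    octahedral H) /\
  (forall (n : nat) (H : set 'L(elln (hoelder_conj_ge1 p1) n, X)),
    (0 < n)%N ->
    closed_subspace H ->
    elln_tensors (hoelder_conj_ge1 p1) [set: elln p1 n] X `<=` H ->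
    octahedral H <->
      ((n <= 2)%N \/ ((2 < n)%N /\ ((2%:E <= p)%E \/ p = 1%E)))).
Proof.
have [Xfar Xineq] := L1_or_ell1 hX.
have conj_cases : (2%:E <= p)%E \/ p = 1%E -> hoelder_conjugate p = +oo%E \/
    (exists2 s : R, hoelder_conjugate p = s%:E & 1 <= s <= 2).
  move=> [|->]; last by left; exact: hoelder_conjugate1.
  case: p p1 => [r r1|_ _|//]; last first.
    by right; exists 1; rewrite ?hoelder_conjugatey// lexx ler1n.
  rewrite lee_fin => r2; right; have r1' : 1 < r by rewrite (lt_le_trans _ r2)// ltr1n.
  exists (r / (r - 1)); first exact: hoelder_conjugate_fin.
  by rewrite ler_pdivlMr ?subr_gt0// ler_pdivrMr ?subr_gt0//; apply/andP; split; lra.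
(* What remains is [1 < p < 2], where the conjugate is finite and exceeds 2. *)
have conj_small : ~ ((2%:E <= p)%E \/ p = 1%E) -> exists r s : R,
    [/\ p = r%:E, hoelder_conjugate p = s%:E, 2 < s & (s - 1) * r = s].
  case: p p1 {conj_cases} => [r r1 np|_ []|//]; last by left; rewrite leey.
  have r2 : r < 2.
    by rewrite ltNge; apply/negP => h; apply: np; left; rewrite lee_fin.
  have r1' : 1 < r.
    rewrite lt_neqAle -lee_fin r1 andbT; apply/eqP => e; apply: np.
    by right; rewrite -e.
  have rB : 0 < r - 1 by rewrite subr_gt0.
  exists r, (r / (r - 1)); split => //; first exact: hoelder_conjugate_fin.
    by rewrite ltr_pdivlMr//; lra.
  by field; rewrite gt_eqF.
split; [|split].
- move=> H Hsub AH; split => [octa|pP]; last first.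
    by apply: (ell_octahedral Xfar _ Hsub AH) => //; exact: conj_cases.
  apply: contrapT => /conj_small[r [s [pr ps s2 rs]]].
  exact: (ell_not_octahedral Xfar Xineq pr ps s2 rs Hsub AH octa).
- move=> H Hsub AH; apply: (ell_octahedral Xfar _ Hsub AH).
    by move=> n x; exact: ell_pad_c0.
  by right; exists 1; rewrite ?lexx ?ler1n.
- move=> n H n0 Hsub AH; split => [octa|].
    have [n2|n2] := leqP n 2; [by left|right; split => //].
    apply: contrapT => /conj_small[r [s [pr ps s2 rs]]].
    exact: (elln_not_octahedral Xfar Xineq erefl pr ps s2 rs n2 Hsub AH octa).
  move=> hn; apply: (elln_octahedral Xfar n0 Hsub AH).
  have [pP|nP] := pselect ((2%:E <= p)%E \/ p = 1%E).
    have [qoo|[s qs /andP[s1 s2]]] := conj_cases pP; first by left.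
    by right; exists s => //; split => //; left.
  (* For [1 < p < 2] the assumption leaves [n <= 2], where every finite conjugate exponent is
     admissible. *)
  have [r [s [_ qs s2 _]]] := conj_small nP; right; exists s => //.
  split; first by rewrite (le_trans _ (ltW s2))// ler1n.
  by case: hn => [n2|[_ /nP//]]; right.
Qed.
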